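(* Let $n\ge 2$ be an integer, let $\beta_0,\dots,\beta_{n-1}$ be real parameters and let $N\in\mathbb N$. Define operators $\hat C_{[i\ldots j]}$ for $1\le i\le j\le n$ (where $[i\ldots j]=\{i,i+1,\dots,j\}$ and $[m]=[1\ldots m]$) by \[ \hat C_{[m]}=\kappa(x_{m-1},\beta_{m-1})\quad (1\le m\le n), \] \[ \hat C_{[2\ldots m+1]}=-\mathcal L_{m-1}+\kappa(0,\beta_m-\beta_0-1)\quad (1\le m\le n-1), \] \[ \hat C_{[p\ldots q]}=\sigma^{p-2}\big(\hat C_{[2\ldots q-p+2]}\big)\quad (2<p\le q\le n), \] and then (after having applied the powers of $\sigma$) set $x_0=0$ and $x_{n-1}=N$ in all these operators. Here $\kappa$, $\mathcal L_j$, $\sigma$ are as defined in the context. Then the algebra generated by these operators is a discrete realization of the Racah algebra $R(n)$; that is, there is an algebra homomorphism from $R(n)$ onto the algebra generated by the difference operators $\hat C_{[i\ldots j]}$, sending $C_{[i\ldots j]}\mapsto \hat C_{[i\ldots j]}$ for all $1\le i\le j\le n$.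
   Context: **Racah algebra.** $\mathfrak{su}(1,1)$ is the Lie algebra over $\mathbb C$ generated by $J_+,J_-,A_0$ with $[J_-,J_+]=2A_0$, $[A_0,J_\pm]=\pm J_\pm$; $\mathcal U(\mathfrak{su}(1,1))$ is its universal enveloping algebra, with Casimir $C=A_0^2-A_0-J_+J_-$. For $X\in\{J_\pm,A_0\}$ and $a\in[n]=\{1,\dots,n\}$ let $X^{(a)}\in\bigotimes_{i=1}^n\mathcal U(\mathfrak{su}(1,1))$ be $X$ in the $a$-th tensor factor and $1$ in the others. For nonempty $A\subset[n]$ put $X^A=\sum_{a\in A}X^{(a)}$ and \[C_A=(A_0^A)^2-A_0^A-J_+^AJ_-^A\] (i.e. the Casimir lifted by iterated comultiplication $X\mapsto X\otimes1+1\otimes X$ to the factors in $A$). The Racah algebra $R(n)$ of rank $n-2$ is the subalgebra of $\bigotimes_{i=1}^n\mathcal U(\mathfrak{su}(1,1))$ generated by all $C_A$, $A\subset[n]$; it is generated already by the $C_{[i\ldots j]}$, $1\le i\le j\le n$. **The polynomial $\kappa$.** $\kappa(x,\beta)=\left(x+\frac{\beta+1}{2}\right)\left(x+\frac{\beta-1}{2}\right)$. **The Racah operators $\mathcal L_j$.** $\mathcal L_0=0$, and for $j\ge1$ \[\mathcal L_j=\sum_{\vec\nu\in\{-1,0,1\}^j,\ \vec\nu\ne\vec 0}G_{\vec\nu}\,(E_{\vec\nu}-1),\qquad E_{\vec\nu}=E_{x_1}^{\nu_1}\cdots E_{x_j}^{\nu_j},\] where $E_{x_i}$ is the shift $x_i\mapsto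 x_i+1$ (leaving the other variables fixed). Put $\nu_0=\nu_{j+1}=0$, and let $|\vec\nu|_0$ be the number of zeros among $\nu_1,\dots,\nu_j$. Then \[G_{\vec\nu}=2^{|\vec\nu|_0}\,\frac{\prod_{i=0}^jB_i^{\nu_i,\nu_{i+1}}}{\prod_{i=1}^jb_i^{\nu_i}},\] a rational function of $x_0,\dots,x_{j+1},\beta_0,\dots,\beta_{j+1}$, with \begin{align*} B_i^{0,0}&=x_i(x_i+\beta_i)+x_{i+1}(x_{i+1}+\beta_{i+1})+\tfrac{(\beta_i+1)(\beta_{i+1}-1)}{2},\\ B_i^{0,1}&=(x_{i+1}+x_i+\beta_{i+1})(x_{i+1}-x_i+\beta_{i+1}-\beta_i),\\ B_i^{1,0}&=(x_{i+1}-x_i)(x_{i+1}+x_i+\beta_{i+1}),\\ B_i^{1,1}&=(x_{i+1}+x_i+\beta_{i+1})(x_{i+1}+x_i+\beta_{i+1}+1),\\ b_i^0&=(2x_i+\beta_i+1)(2x_i+\beta_i-1),\qquad b_i^1=(2x_i+\beta_i+1)(2x_i+\beta_i). \end{align*} With $I_i$ denoting the substitution $x_i\mapsto -x_i-\beta_i$: $B_i^{-1,t}=I_i(B_i^{1,t})$ and $B_i^{t,-1}=I_{i+1}(B_i^{t,1})$ for $t\in\{0,1\}$, $B_i^{-1,-1}=I_i(I_{i+1}(B_i^{1,1}))$, and $b_i^{-1}=I_i(b_i^1)$. **The map $\sigma$.** $\sigma$ is the index-raising isomorphism of algebras of difference operators given by $\sigma(x_i)=x_{i+1}$, $\sigma(\beta_i)=\beta_{i+1}$,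 $\sigma(E_{x_i})=E_{x_{i+1}}$. **Operators.** After setting $x_0=0$, $x_{n-1}=N$, all operators are regarded as elements of the algebra of difference operators with rational-function coefficients in $x_1,\dots,x_{n-2}$, generated by those coefficients and the shifts $E_{x_1}^{\pm1},\dots,E_{x_{n-2}}^{\pm1}$ (acting on functions of $x_1,\dots,x_{n-2}$). *)

(* Defs.v *)
From HB Require Import structures.
From mathcomp Require Import all_boot all_order all_algebra.
From mathcomp Require Import boolp reals complex mpoly ring.
Set Implicit Arguments.
Unset Strict Implicit.
Unset Printing Implicit Defensive.
Import GRing.Theory.
Local Open Scope ring_scope.
Local Open Scope quotient_scope.

(* An algebra presented by generators X and relations rel is the quotient of
   the formal expressions by the least congruence that contains rel and forces
   the axioms of unital associative K-algebras. *)
Section Presentation.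
Variables (K : fieldType) (X : Type).

Inductive alg_term : Type :=
| Tgen of X
| Tscal of K
| Tadd of alg_term & alg_term
| Tmul of alg_term & alg_term.

HB.instance Definition _ := gen_eqMixin alg_term.
HB.instance Definition _ := gen_choiceMixin alg_term.

Variable rel : alg_term -> alg_term -> Prop.

Inductive cong : alg_term -> alg_term -> Prop :=
| cong_rel s t : rel s t -> cong s t
| cong_refl s : cong s s
| cong_sym s t : cong s t -> cong t s
| cong_trans s t u : cong s t -> cong t u -> cong s u
| cong_add s s' t t' : cong s s' -> cong t t' -> cong (Tadd s t) (Tadd s' t')
| cong_mul s s' t t' : cong s s' -> cong t t' -> cong (Tmul s t) (Tmul s' t')
| cong_addA s t u : cong (Tadd s (Tadd t u)) (Tadd (Tadd s t) u)
| cong_addC s t : cong (Tadd s t) (Tadd t s)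
| cong_add0 s : cong (Tadd (Tscal 0) s) s
| cong_mulA s t u : cong (Tmul s (Tmul t u)) (Tmul (Tmul s t) u)
| cong_mul1 s : cong (Tmul (Tscal 1) s) s
| cong_mul0 s : cong (Tmul (Tscal 0) s) (Tscal 0)
| cong_mulDl s t u : cong (Tmul (Tadd s t) u) (Tadd (Tmul s u) (Tmul t u))
| cong_mulDr s t u : cong (Tmul s (Tadd t u)) (Tadd (Tmul s t) (Tmul s u))
| cong_scalD a b : cong (Tscal (a + b)) (Tadd (Tscal a) (Tscal b))
| cong_scalM a b : cong (Tscal (a * b)) (Tmul (Tscal a) (Tscal b))
| cong_scalC a s : cong (Tmul (Tscal a) s) (Tmul s (Tscal a)).

Definition congb : alg_term -> alg_term -> bool := fun s t => `[< cong s t >].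

Lemma congb_refl : reflexive congb.
Proof. by move=> s; apply/asboolP; apply: cong_refl. Qed.

Lemma congb_sym : ssrbool.symmetric congb.
Proof. by move=> s t; apply/asboolP/asboolP; apply: cong_sym. Qed.

Lemma congb_trans : transitive congb.
Proof.
by move=> t s u /asboolP st /asboolP tu; apply/asboolP; apply: cong_trans tu.
Qed.

Canonical congb_equiv := EquivRel congb congb_refl congb_sym congb_trans.

Definition presented := {eq_quot congb}.
HB.instance Definition _ : EqQuotient _ congb presented :=
  EqQuotient.on presented.
HB.instance Definition _ := Choice.on presented.

Implicit Types a b c : presented.

Definition tclass (t : alg_term) : presented := \pi t.

Lemma tclassP s t : cong s t <-> tclass s = tclass t.
Proof.
split=> [st|/eqP]; first by apply/eqP; rewrite eqmodE; apply/asboolP.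
by rewrite eqmodE => /asboolP.
Qed.

Lemma tclass_ind (P : presented -> Prop) :
  (forall t, P (tclass t)) -> forall a, P a.
Proof. by move=> Pt a; rewrite -[a]reprK; apply: Pt. Qed.

Lemma cong_repr t : cong (repr (tclass t)) t.
Proof. by apply/tclassP; rewrite /tclass reprK. Qed.

Definition padd a b : presented := tclass (Tadd (repr a) (repr b)).
Definition pmul a b : presented := tclass (Tmul (repr a) (repr b)).
Definition pscal (k : K) : presented := tclass (Tscal k).
Definition popp a : presented := pmul (pscal (- 1)) a.
Definition pscale (k : K) a : presented := pmul (pscal k) a.
Definition pgen (x : X) : presented := tclass (Tgen x).

Lemma tclassD s t : tclass (Tadd s t) = padd (tclass s) (tclass t).
Proof. by apply/tclassP/cong_add; apply/cong_sym/cong_repr. Qed.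

Lemma tclassM s t : tclass (Tmul s t) = pmul (tclass s) (tclass t).
Proof. by apply/tclassP/cong_mul; apply/cong_sym/cong_repr. Qed.

Let tclassE := (fun s t => esym (tclassD s t), fun s t => esym (tclassM s t)).

Lemma paddA : associative padd.
Proof.
elim/tclass_ind=> s; elim/tclass_ind=> t; elim/tclass_ind=> u.
by rewrite !tclassE; apply/tclassP/cong_addA.
Qed.

Lemma paddC : commutative padd.
Proof.
elim/tclass_ind=> s; elim/tclass_ind=> t.
by rewrite !tclassE; apply/tclassP/cong_addC.
Qed.

Lemma padd0 : left_id (pscal 0) padd.
Proof.
by elim/tclass_ind=> s; rewrite !tclassE; apply/tclassP/cong_add0.
Qed.

Lemma pmulA : associative pmul.
Proof.
elim/tclass_ind=> s; elim/tclass_ind=> t; elim/tclass_ind=> u.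
by rewrite !tclassE; apply/tclassP/cong_mulA.
Qed.

Lemma pmul1 : left_id (pscal 1) pmul.
Proof.
by elim/tclass_ind=> s; rewrite !tclassE; apply/tclassP/cong_mul1.
Qed.

Lemma pmul0 a : pmul (pscal 0) a = pscal 0.
Proof.
by elim/tclass_ind: a => s; rewrite !tclassE; apply/tclassP/cong_mul0.
Qed.

Lemma pscalC k a : pmul (pscal k) a = pmul a (pscal k).
Proof.
by elim/tclass_ind: a => s; rewrite !tclassE; apply/tclassP/cong_scalC.
Qed.

Lemma pmulr1 : right_id (pscal 1) pmul.
Proof. by move=> a; rewrite -pscalC pmul1. Qed.

Lemma pmulDl : left_distributive pmul padd.
Proof.
elim/tclass_ind=> s; elim/tclass_ind=> t; elim/tclass_ind=> u.
by rewrite !tclassE; apply/tclassP/cong_mulDl.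
Qed.

Lemma pmulDr : right_distributive pmul padd.
Proof.
elim/tclass_ind=> s; elim/tclass_ind=> t; elim/tclass_ind=> u.
by rewrite !tclassE; apply/tclassP/cong_mulDr.
Qed.

Lemma pscalD k l : pscal (k + l) = padd (pscal k) (pscal l).
Proof. by rewrite !tclassE; apply/tclassP/cong_scalD. Qed.

Lemma pscalM k l : pscal (k * l) = pmul (pscal k) (pscal l).
Proof. by rewrite !tclassE; apply/tclassP/cong_scalM. Qed.

Lemma paddN : left_inverse (pscal 0) popp padd.
Proof.
by move=> a; rewrite /popp -{2}[a]pmul1 -pmulDl -pscalD addNr pmul0.
Qed.

HB.instance Definition _ :=
  GRing.isZmodule.Build presented paddA paddC padd0 paddN.
HB.instance Definition _ :=
  GRing.Zmodule_isPzRing.Build presented pmulA pmul1 pmulr1 pmulDl pmulDr.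

Lemma pscaleA k l a : pscale k (pscale l a) = pscale (k * l) a.
Proof. by rewrite /pscale pmulA -pscalM. Qed.

Lemma pscale1 : left_id 1 pscale.
Proof. exact: pmul1. Qed.

Lemma pscaleDr : right_distributive pscale +%R.
Proof. by move=> k a b; apply: pmulDr. Qed.

Lemma pscaleDl a : {morph pscale^~ a : k l / k + l}.
Proof. by move=> k l; rewrite /pscale pscalD pmulDl. Qed.

HB.instance Definition _ :=
  GRing.Zmodule_isLmodule.Build K presented pscaleA pscale1 pscaleDr pscaleDl.

Lemma presented_scaleAl (k : K) (a b : presented) : k *: (a * b) = k *: a * b.
Proof. exact: pmulA. Qed.

Lemma presented_scaleAr (k : K) (a b : presented) : k *: (a * b) = a * (k *: b).
Proof.
rewrite -[LHS]/(pmul _ (pmul _ _)) -[RHS]/(pmul _ (pmul _ _)).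
by rewrite !pmulA pscalC.
Qed.

Lemma presented_rel s t : rel s t -> tclass s = tclass t.
Proof. by move=> st; apply/tclassP/cong_rel. Qed.

Section Eval.
Variables (A : algType K) (f : X -> A).

Fixpoint alg_eval (t : alg_term) : A :=
  match t with
  | Tgen x => f x
  | Tscal k => k%:A
  | Tadd s t => alg_eval s + alg_eval t
  | Tmul s t => alg_eval s * alg_eval t
  end.

Hypothesis f_rel : forall s t, rel s t -> alg_eval s = alg_eval t.

Lemma eval_cong s t : cong s t -> alg_eval s = alg_eval t.
Proof.
elim=> {s t} /=.
- exact: f_rel.
- by [].
- by move=> s t _ ->.
- by move=> s t u _ -> _ ->.
- by move=> s s' t t' _ -> _ ->.
- by move=> s s' t t' _ -> _ ->.
- by move=> s t u; rewrite addrA.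
- by move=> s t; rewrite addrC.
- by move=> s; rewrite scale0r add0r.
- by move=> s t u; rewrite mulrA.
- by move=> s; rewrite scale1r mul1r.
- by move=> s; rewrite scale0r mul0r.
- by move=> s t u; rewrite mulrDl.
- by move=> s t u; rewrite mulrDr.
- by move=> a b; rewrite scalerDl.
- by move=> a b; rewrite -scalerAl mul1r scalerA.
- by move=> a s; rewrite -scalerAl -scalerAr mul1r mulr1.
Qed.

Definition plift (a : presented) : A := alg_eval (repr a).

Lemma plift_tclass t : plift (tclass t) = alg_eval t.
Proof. exact/eval_cong/cong_repr. Qed.

Lemma plift_gen x : plift (pgen x) = f x.
Proof. exact: plift_tclass. Qed.

Lemma pliftD (a b : presented) : plift (a + b) = plift a + plift b.
Proof.
elim/tclass_ind: a => s; elim/tclass_ind: b => t.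
by rewrite -[_ + _]tclassD !plift_tclass.
Qed.

Lemma pliftM (a b : presented) : plift (a * b) = plift a * plift b.
Proof.
elim/tclass_ind: a => s; elim/tclass_ind: b => t.
by rewrite -[_ * _]tclassM !plift_tclass.
Qed.

Lemma plift1 : plift 1 = 1.
Proof. by rewrite [LHS]plift_tclass /= scale1r. Qed.

Lemma pliftZ (k : K) (a : presented) : plift (k *: a) = k *: plift a.
Proof.
elim/tclass_ind: a => s.
by rewrite -[_ *: _]tclassM !plift_tclass /= -scalerAl mul1r.
Qed.

Lemma presented_oner_neq0 : (1 : presented) != 0.
Proof.
apply: contraNneq (oner_neq0 A) => e.
by rewrite -plift1 e [X in X == _]plift_tclass /= scale0r.
Qed.

End Eval.
End Presentation.

Section Enveloping.
Variables (K : fieldType) (g : lmodType K) (br : g -> g -> g).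

Inductive env_rel : alg_term K g -> alg_term K g -> Prop :=
| env_lin k x y : env_rel (Tgen K (k *: x + y))
    (Tadd (Tmul (Tscal g k) (Tgen K x)) (Tgen K y))
| env_br x y : env_rel (Tgen K (br x y))
    (Tadd (Tmul (Tgen K x) (Tgen K y))
          (Tmul (Tscal g (- 1)) (Tmul (Tgen K y) (Tgen K x)))).

Definition enveloping := presented env_rel.

HB.instance Definition _ := GRing.PzRing.on enveloping.
HB.instance Definition _ := GRing.Lmodule.on enveloping.

Lemma env_counit_rel s t : env_rel s t ->
  alg_eval (fun=> 0 : K^o) s = alg_eval (fun=> 0 : K^o) t.
Proof. by case=> * /=; rewrite ?mulr0 addr0. Qed.

HB.instance Definition _ := GRing.PzSemiRing_isNonZero.Build enveloping
  (presented_oner_neq0 env_counit_rel).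
HB.instance Definition _ := GRing.Lmodule_isLalgebra.Build K enveloping
  (@presented_scaleAl _ _ env_rel).
HB.instance Definition _ := GRing.Lalgebra_isAlgebra.Build K enveloping
  (@presented_scaleAr _ _ env_rel).

Definition env_in (x : g) : enveloping := pgen env_rel x.

Lemma env_in_linear : linear env_in.
Proof.
by move=> k x y; rewrite [LHS](presented_rel (env_lin k x y)) tclassD tclassM.
Qed.

Lemma env_in_br x y : env_in (br x y) = env_in x * env_in y - env_in y * env_in x.
Proof. by rewrite [LHS](presented_rel (env_br x y)) tclassD !tclassM. Qed.

Definition env_counit (a : enveloping) : K^o := plift (fun=> 0 : K^o) a.

End Enveloping.

(* The generator attached to u stands for the pure tensor of the u_i. As pure
   tensors are closed under product and contain 1, imposing multilinearity and
   the factorwise product yields the usual tensor product of algebras. *)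
Section TensorPower.
Variables (K : fieldType) (g : lmodType K) (br : g -> g -> g) (n : nat).
Local Notation U := (enveloping br).
Local Notation X := {ffun 'I_n -> U}.

Definition upd (u : X) (i : 'I_n) (a : U) : X :=
  [ffun k => if k == i then a else u k].

Inductive tens_rel : alg_term K X -> alg_term K X -> Prop :=
| tens_lin u i k a b : tens_rel (Tgen K (upd u i (k *: a + b)))
    (Tadd (Tmul (Tscal X k) (Tgen K (upd u i a))) (Tgen K (upd u i b)))
| tens_mul (u v : X) : tens_rel (Tgen K [ffun i => u i * v i])
    (Tmul (Tgen K u) (Tgen K v))
| tens_one : tens_rel (Tgen K [ffun=> 1]) (Tscal X 1).

Definition tensor_power := presented tens_rel.

HB.instance Definition _ := GRing.PzRing.on tensor_power.
HB.instance Definition _ := GRing.Lmodule.on tensor_power.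

Lemma tens_counit_rel s t : tens_rel s t ->
  alg_eval (fun u : X => \prod_i env_counit (u i) : K^o) s =
  alg_eval (fun u : X => \prod_i env_counit (u i) : K^o) t.
Proof.
have cr := @env_counit_rel K g br.
case=> [u i k a b|u v|] /=.
- have E c : \prod_j env_counit (upd u i c j) =
      env_counit c * \prod_(j | j != i) env_counit (u j).
    rewrite (bigD1 i) //= ffunE eqxx; congr (_ * _).
    by apply: eq_bigr => j /negPf ji; rewrite ffunE ji.
  rewrite !E /env_counit (pliftD cr) (pliftZ cr) mulrDl; congr (_ + _).
  by rewrite -[k *: _]/(k * _) -[k%:A]/(k * 1) mulr1 mulrA.
- rewrite -big_split; apply: eq_bigr => i _.
  by rewrite ffunE /env_counit (pliftM cr).
- by rewrite scale1r big1 // => i _; rewrite ffunE /env_counit (plift1 cr).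
Qed.

HB.instance Definition _ := GRing.PzSemiRing_isNonZero.Build tensor_power
  (presented_oner_neq0 tens_counit_rel).
HB.instance Definition _ := GRing.Lmodule_isLalgebra.Build K tensor_power
  (@presented_scaleAl _ _ tens_rel).
HB.instance Definition _ := GRing.Lalgebra_isAlgebra.Build K tensor_power
  (@presented_scaleAr _ _ tens_rel).

Definition pure (u : X) : tensor_power := pgen tens_rel u.

Lemma pure_lin u i k a b :
  pure (upd u i (k *: a + b)) = k *: pure (upd u i a) + pure (upd u i b).
Proof. by rewrite [LHS](presented_rel (tens_lin u i k a b)) tclassD tclassM. Qed.

Lemma pureM (u v : X) : pure [ffun i => u i * v i] = pure u * pure v.
Proof. by rewrite [LHS](presented_rel (tens_mul u v)) tclassM. Qed.

Lemma pure1 : pure [ffun=> 1] = 1.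
Proof. exact: (presented_rel tens_one). Qed.

Definition in_factor (x : U) (a : 'I_n) : tensor_power :=
  pure [ffun k => if k == a then x else 1].

End TensorPower.

Section GeneratedSubalgebra.
Variables (K : fieldType) (A : algType K) (S : A -> Prop).

Inductive generated : A -> Prop :=
| generated_gen x : S x -> generated x
| generated_one : generated 1
| generated_lin k x y : generated x -> generated y -> generated (k *: x + y)
| generated_mul x y : generated x -> generated y -> generated (x * y).

Definition generatedb : {pred A} := fun x => `[< generated x >].

Lemma generatedP x : reflect (generated x) (x \in generatedb).
Proof. exact: asboolP. Qed.

Lemma generatedb_closed : GRing.subalg_closed generatedb.
Proof.
split=> [|k x y /generatedP gx /generatedP gy|x y /generatedP gx /generatedP gy].
- exact/generatedP/generated_one.
- exact/generatedP/generated_lin.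
- exact/generatedP/generated_mul.
Qed.

Record gen_alg := GenAlg { gen_alg_val : A; _ : generatedb gen_alg_val }.

HB.instance Definition _ := [isSub for gen_alg_val].
HB.instance Definition _ := [Choice of gen_alg by <:].
HB.instance Definition _ :=
  GRing.SubChoice_isSubAlgebra.Build K A generatedb gen_alg
    (GRing.subalg_closed_semi generatedb_closed).

End GeneratedSubalgebra.

Section Racah.
Variable K : fieldType.

Local Notation su11 := 'rV[K]_3.

(* Coordinates are taken in the basis (J_+, J_-, A_0). *)
Definition Jp : su11 := \row_k (k == 0%N :> nat)%:R.
Definition Jm : su11 := \row_k (k == 1%N :> nat)%:R.
Definition A0 : su11 := \row_k (k == 2%N :> nat)%:R.

Definition su11_br (x y : su11) : su11 :=
  let: (xp, xm, x0) := (x 0 0, x 0 1, x 0 2%:R) in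
  let: (yp, ym, y0) := (y 0 0, y 0 1, y 0 2%:R) in
  (x0 * yp - xp * y0) *: Jp + (xm * y0 - x0 * ym) *: Jm
    + (2%:R * (xm * yp - xp * ym)) *: A0.

Lemma su11_br_JmJp : su11_br Jm Jp = 2%:R *: A0.
Proof. by apply/rowP=> i; rewrite !mxE /=; ring. Qed.

Lemma su11_br_A0Jp : su11_br A0 Jp = Jp.
Proof. by apply/rowP=> i; rewrite !mxE /=; ring. Qed.

Lemma su11_br_A0Jm : su11_br A0 Jm = - Jm.
Proof. by apply/rowP=> i; rewrite !mxE /=; ring. Qed.

Lemma su11_brxx x : su11_br x x = 0.
Proof. by apply/rowP=> i; rewrite !mxE /=; ring. Qed.

Lemma su11_br_linear x : linear (su11_br x).
Proof. by move=> k y z; apply/rowP=> i; rewrite !mxE /=; ring. Qed.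

Lemma su11_jacobi x y z :
  su11_br x (su11_br y z) + su11_br y (su11_br z x)
    + su11_br z (su11_br x y) = 0.
Proof. by apply/rowP=> i; rewrite !mxE /=; ring. Qed.

Variable n : nat.

Definition lifted (x : su11) (A : {set 'I_n}) : tensor_power su11_br n :=
  \sum_(a in A) in_factor (env_in su11_br x) a.

Definition casimir (A : {set 'I_n}) : tensor_power su11_br n :=
  lifted A0 A ^+ 2 - lifted A0 A - lifted Jp A * lifted Jm A.

Definition racah_gens (c : tensor_power su11_br n) : Prop :=
  exists2 A : {set 'I_n}, A != set0 & c = casimir A.

Definition racah := gen_alg racah_gens.

(* The a.+1-st tensor factor is indexed by a : 'I_n. *)
Definition segment (i j : nat) : {set 'I_n} := [set a : 'I_n | (i <= a.+1 <= j)%N].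

End Racah.

Section FracMap.
Variables (R : idomainType) (s : {rmorphism R -> R}).
Hypothesis s_inj : injective s.
Local Notation "x %:F" := (@FracField.tofrac R x).

Definition frac_map (f : {fraction R}) : {fraction R} :=
  (s \n_(repr f))%:F / (s \d_(repr f))%:F.

Lemma tofrac_neq0 (d : R) : d != 0 -> d%:F != 0.
Proof. by rewrite tofrac_eq0. Qed.

Lemma frac_repr (f : {fraction R}) : f = (\n_(repr f))%:F / (\d_(repr f))%:F.
Proof.
have dn0 := denom_ratioP (repr f).
apply: (canRL (mulfK (tofrac_neq0 dn0))); rewrite -[f in LHS]reprK.
unlock FracField.tofrac; rewrite -[LHS]FracField.pi_mul.
apply/eqmodP; rewrite /= FracField.equivfE /FracField.mulf.
by rewrite !numden_Ratio ?mulf_neq0 ?oner_neq0 ?mulr1 // reprK mulrC.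
Qed.

Lemma frac_mapE (a d : R) : d != 0 ->
  frac_map (a%:F / d%:F) = (s a)%:F / (s d)%:F.
Proof.
move=> dn0; set f := _ / _; have en0 := denom_ratioP (repr f).
have sn0 c : c != 0 -> (s c)%:F != 0.
  by move=> cn0; rewrite tofrac_eq0 -(rmorph0 s) (inj_eq s_inj).
have /eqP := frac_repr f; rewrite {1}/f eqr_div ?tofrac_neq0 //.
rewrite -!tofracM tofrac_eq => /eqP e.
by apply/eqP; rewrite eqr_div ?sn0 // -!tofracM tofrac_eq -!rmorphM e.
Qed.

Lemma frac_map_tofrac a : frac_map a%:F = (s a)%:F.
Proof.
rewrite -[a%:F]divr1 -tofrac1 frac_mapE ?oner_neq0 //.
by rewrite rmorph1 tofrac1 divr1.
Qed.

Lemma frac_mapD f g : frac_map (f + g) = frac_map f + frac_map g.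
Proof.
have sn0 c : c != 0 -> (s c)%:F != 0.
  by move=> cn0; rewrite tofrac_eq0 -(rmorph0 s) (inj_eq s_inj).
have [fn0 gn0] := (denom_ratioP (repr f), denom_ratioP (repr g)).
rewrite {1}(frac_repr f) {1}(frac_repr g) addf_div ?tofrac_neq0 //.
rewrite -!tofracM -tofracD frac_mapE ?mulf_neq0 //.
by rewrite rmorphD !rmorphM tofracD !tofracM -addf_div ?sn0.
Qed.

Lemma frac_mapM f g : frac_map (f * g) = frac_map f * frac_map g.
Proof.
have [fn0 gn0] := (denom_ratioP (repr f), denom_ratioP (repr g)).
rewrite {1}(frac_repr f) {1}(frac_repr g) mulf_div.
rewrite -!tofracM frac_mapE ?mulf_neq0 //.
by rewrite !rmorphM -mulf_div.
Qed.

End FracMap.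

Section RationalFunctions.
Variables (K : fieldType) (m : nat).

Definition ratfun := {fraction {mpoly K[m]}}.
HB.instance Definition _ := GRing.Field.on ratfun.

Definition ratpoly (p : {mpoly K[m]}) : ratfun := FracField.tofrac p.

Definition ratfun_scale (k : K) (f : ratfun) : ratfun := ratpoly k%:MP * f.

Fact ratfun_scaleA k l f :
  ratfun_scale k (ratfun_scale l f) = ratfun_scale (k * l) f.
Proof. by rewrite /ratfun_scale mulrA /ratpoly -tofracM mpolyCM. Qed.

Fact ratfun_scale1 : left_id 1 ratfun_scale.
Proof. by move=> f; rewrite /ratfun_scale /ratpoly mpolyC1 tofrac1 mul1r. Qed.

Fact ratfun_scaleDr : right_distributive ratfun_scale +%R.
Proof. by move=> k f g; apply: mulrDr. Qed.

Fact ratfun_scaleDl f : {morph ratfun_scale^~ f : k l / k + l}.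
Proof.
by move=> k l; rewrite /ratfun_scale /ratpoly mpolyCD tofracD mulrDl.
Qed.

HB.instance Definition _ := GRing.Zmodule_isLmodule.Build K ratfun
  ratfun_scaleA ratfun_scale1 ratfun_scaleDr ratfun_scaleDl.

Fact ratfun_scaleAl (k : K) (f g : ratfun) : k *: (f * g) = k *: f * g.
Proof. exact: mulrA. Qed.

Fact ratfun_scaleAr (k : K) (f g : ratfun) : k *: (f * g) = f * (k *: g).
Proof. exact: mulrCA. Qed.

HB.instance Definition _ :=
  GRing.Lmodule_isLalgebra.Build K ratfun ratfun_scaleAl.
HB.instance Definition _ :=
  GRing.Lalgebra_isAlgebra.Build K ratfun ratfun_scaleAr.

Definition translated (c : 'I_m -> K) : m.-tuple {mpoly K[m]} :=
  [tuple 'X_i + (c i)%:MP | i < m].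

Lemma translatedK c : cancel (comp_mpoly (translated c))
                             (comp_mpoly (translated (fun i => - c i))).
Proof.
have fix_mon (f : {linear {mpoly K[m]} -> {mpoly K[m]}}) :
    (forall e : 'X_{1..m}, f 'X_[e] = 'X_[e]) -> forall p, f p = p.
  move=> fX p; rewrite [p]mpolyE raddf_sum; apply: eq_bigr => e _ /=.
  by rewrite linearZ /= fX.
apply: (fix_mon (comp_mpoly (translated (fun i => - c i))
  \o comp_mpoly (translated c))) => e /=.
rewrite comp_mpolyX rmorph_prod [RHS]mpolyXE_id /=.
apply: eq_bigr => i _; rewrite rmorphXn /= tnth_mktuple rmorphD /= comp_mpolyC.
by rewrite comp_mpolyXU -tnth_nth tnth_mktuple mpolyCN addrNK.
Qed.

Definition ratfun_translate (c : 'I_m -> K) : ratfun -> ratfun :=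
  frac_map (comp_mpoly (translated c)).

Lemma ratfun_translate_linear c : linear (ratfun_translate c).
Proof.
have inj := can_inj (translatedK c).
move=> k f g; rewrite /ratfun_translate (frac_mapD inj) (frac_mapM inj).
by rewrite (frac_map_tofrac inj) /= comp_mpolyC.
Qed.

End RationalFunctions.

Section LinearOperators.
Variables (K : fieldType) (V : algType K).

Record linop := LinOp { linop_fun :> V -> V; linop_linear : linear linop_fun }.

HB.instance Definition _ := gen_eqMixin linop.
HB.instance Definition _ := gen_choiceMixin linop.

Lemma linopP (s t : linop) : s =1 t -> s = t.
Proof.
case: s t => [s ls] [t lt] /= st; have est : s = t by apply/funext.
by subst t; congr LinOp; apply: Prop_irrelevance.
Qed.

Fact linop_zero_linear : linear (fun _ : V => 0 : V).
Proof. by move=> k u v; rewrite scaler0 addr0. Qed.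
Fact linop_one_linear : linear (id : V -> V).
Proof. by []. Qed.
Fact linop_opp_linear (s : linop) : linear (fun v => - s v).
Proof. by move=> k u v; rewrite linop_linear opprD scalerN. Qed.
Fact linop_add_linear (s t : linop) : linear (fun v => s v + t v).
Proof. by move=> k u v; rewrite !linop_linear scalerDr addrACA. Qed.
Fact linop_mul_linear (s t : linop) : linear (fun v => s (t v)).
Proof. by move=> k u v; rewrite !linop_linear. Qed.
Fact linop_scale_linear (k : K) (s : linop) : linear (fun v => k *: s v).
Proof.
by move=> l u v; rewrite linop_linear scalerDr !scalerA [k * l]mulrC.
Qed.

Definition linop_zero := LinOp linop_zero_linear.
Definition linop_one := LinOp linop_one_linear.
Definition linop_opp s := LinOp (linop_opp_linear s).
Definition linop_add s t := LinOp (linop_add_linear s t).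
Definition linop_mul s t := LinOp (linop_mul_linear s t).
Definition linop_scale k s := LinOp (linop_scale_linear k s).

Lemma linopD (s : linop) u v : s (u + v) = s u + s v.
Proof. by rewrite -{1}[u]scale1r linop_linear scale1r. Qed.

Lemma linopZ (s : linop) k v : s (k *: v) = k *: s v.
Proof.
have s0 : s 0 = 0 by apply: (addrI (s 0)); rewrite -linopD !addr0.
by rewrite -[_ *: v]addr0 linop_linear s0 addr0.
Qed.

Fact linop_addA : associative linop_add.
Proof. by move=> s t u; apply: linopP => v /=; rewrite addrA. Qed.
Fact linop_addC : commutative linop_add.
Proof. by move=> s t; apply: linopP => v /=; rewrite addrC. Qed.
Fact linop_add0 : left_id linop_zero linop_add.
Proof. by move=> s; apply: linopP => v /=; rewrite add0r. Qed.
Fact linop_addN : left_inverse linop_zero linop_opp linop_add.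
Proof. by move=> s; apply: linopP => v /=; rewrite addNr. Qed.

HB.instance Definition _ :=
  GRing.isZmodule.Build linop linop_addA linop_addC linop_add0 linop_addN.

Fact linop_mulA : associative linop_mul.
Proof. by move=> s t u; apply: linopP. Qed.
Fact linop_mul1 : left_id linop_one linop_mul.
Proof. by move=> s; apply: linopP. Qed.
Fact linop_mulr1 : right_id linop_one linop_mul.
Proof. by move=> s; apply: linopP. Qed.
Fact linop_mulDl : left_distributive linop_mul +%R.
Proof. by move=> s t u; apply: linopP. Qed.
Fact linop_mulDr : right_distributive linop_mul +%R.
Proof. by move=> s t u; apply: linopP => v; apply: linopD. Qed.
Fact linop_oner_neq0 : linop_one != 0.
Proof.
by apply: contraNneq (oner_neq0 V) => /(congr1 (fun s : linop => s 1)) /= ->.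
Qed.

HB.instance Definition _ := GRing.Zmodule_isNzRing.Build linop
  linop_mulA linop_mul1 linop_mulr1 linop_mulDl linop_mulDr linop_oner_neq0.

Fact linop_scaleA k l s :
  linop_scale k (linop_scale l s) = linop_scale (k * l) s.
Proof. by apply: linopP => v /=; rewrite scalerA. Qed.
Fact linop_scale1 : left_id 1 linop_scale.
Proof. by move=> s; apply: linopP => v /=; rewrite scale1r. Qed.
Fact linop_scaleDr : right_distributive linop_scale +%R.
Proof. by move=> k s t; apply: linopP => v /=; rewrite scalerDr. Qed.
Fact linop_scaleDl s : {morph linop_scale^~ s : k l / k + l}.
Proof. by move=> k l; apply: linopP => v /=; rewrite scalerDl. Qed.

HB.instance Definition _ := GRing.Zmodule_isLmodule.Build K linop
  linop_scaleA linop_scale1 linop_scaleDr linop_scaleDl.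

Fact linop_scaleAl (k : K) (s t : linop) : k *: (s * t) = k *: s * t.
Proof. by apply: linopP. Qed.
Fact linop_scaleAr (k : K) (s t : linop) : k *: (s * t) = s * (k *: t).
Proof. by apply: linopP => v; apply/esym/linopZ. Qed.

HB.instance Definition _ := GRing.Lmodule_isLalgebra.Build K linop linop_scaleAl.
HB.instance Definition _ := GRing.Lalgebra_isAlgebra.Build K linop linop_scaleAr.

Fact mulop_linear (f : V) : linear (fun v => f * v).
Proof. by move=> k u v; rewrite mulrDr scalerAr. Qed.

Definition mulop (f : V) : linop := LinOp (mulop_linear f).

End LinearOperators.

Section RacahCoefficients.
Variable L : fieldType.
Implicit Types (x y b c : L) (s t : int).

Definition kappa x b : L := (x + (b + 1) / 2%:R) * (x + (b - 1) / 2%:R).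

(* I^s: the substitution x |-> - x - b if s = -1, and nothing otherwise. *)
Definition reflect_var s x b : L := if s == -1 then - x - b else x.

(* (x, b) = (x_i, beta_i) and (y, c) = (x_{i+1}, beta_{i+1}); the booleans
   stand for the superscripts 0 and 1. *)
Definition B01 (s t : bool) x b y c : L :=
  match s, t with
  | false, false =>
      x * (x + b) + y * (y + c) + (b + 1) * (c - 1) / 2%:R
  | false, true => (y + x + c) * (y - x + c - b)
  | true, false => (y - x) * (y + x + c)
  | true, true => (y + x + c) * (y + x + c + 1)
  end.

Definition b01 (s : bool) x b : L :=
  if s then (2%:R * x + b + 1) * (2%:R * x + b)
  else (2%:R * x + b + 1) * (2%:R * x + b - 1).

Definition Bcoef s t x b y c : L :=
  B01 (s != 0) (t != 0) (reflect_var s x b) b (reflect_var t y c) c.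

Definition bcoef s x b : L := b01 (s != 0) (reflect_var s x b) b.

End RacahCoefficients.

(* Vectors nu in {-1,0,1}^j, encoded by the values nu_i + 1 in {0,1,2}. *)
Definition trits j := {ffun 'I_j -> 'I_3}.

Definition trit_val (k : 'I_3) : int := k%:Z - 1.

(* nu_i for 1 <= i <= j, and 0 for all other i. *)
Definition trit_at j (nu : trits j) (i : nat) : int :=
  if i is i'.+1 then
    if insub i' is Some k then trit_val (nu k) else 0
  else 0.

Definition num_zeros j (nu : trits j) : nat :=
  #|[set i : 'I_j | trit_val (nu i) == 0]|.

(* A difference operator in m variables is represented by its action on
   rational functions; this is faithful, since distinct automorphisms of a field
   are linearly independent over that field. *)
Section RacahOperators.
Variables (K : fieldType) (m : nat).
Local Notation L := (ratfun K m).
Local Notation D := (linop L).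

(* E_{x_i}^r, the substitution x_i |-> x_i + r; x_i is 'X_(i.-1), 1 <= i <= m. *)
Definition shiftop (i : nat) (r : int) : D :=
  LinOp (ratfun_translate_linear
    (fun k : 'I_m => if k.+1 == i then r%:~R else 0)).

Lemma shiftop_var (i : nat) (r : int) (k : 'I_m) :
  shiftop i r (ratpoly 'X_k) =
  ratpoly 'X_k + (if k.+1 == i then r%:~R else 0)%:A.
Proof.
rewrite /= /ratfun_translate (frac_map_tofrac (can_inj (translatedK _))).
rewrite /= comp_mpolyXU -tnth_nth tnth_mktuple (rmorphD (@FracField.tofrac _)).
by congr (_ + _); apply/esym/mulr1.
Qed.

(* The operators below are written in terms of arbitrary sequences x_i, beta_i
   and E_{x_i}^r, so that sigma^k acts by reindexing these three sequences, and
   the values x_0 = 0 and x_{n-1} = N are substituted last. *)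
Definition raise (T : Type) (k : nat) (u : nat -> T) : nat -> T :=
  fun i => u (k + i)%N.

Definition Gcoef (x b : nat -> L) j (nu : trits j) : L :=
  2%:R ^+ num_zeros nu *
    (\prod_(0 <= i < j.+1)
       Bcoef (trit_at nu i) (trit_at nu i.+1) (x i) (b i) (x i.+1) (b i.+1)) /
    (\prod_(1 <= i < j.+1) bcoef (trit_at nu i) (x i) (b i)).

Definition Enu (E : nat -> int -> D) j (nu : trits j) : D :=
  \prod_(1 <= i < j.+1) E i (trit_at nu i).

Definition racah_op (x b : nat -> L) (E : nat -> int -> D) (j : nat) : D :=
  \sum_(nu : trits j | [exists i, trit_val (nu i) != 0])
    mulop (Gcoef x b nu) * (Enu E nu - 1).

Lemma racah_op0 x b E : racah_op x b E 0 = 0.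
Proof. by rewrite /racah_op big_pred0 // => nu; apply/existsP => -[[]]. Qed.

Definition hatC_initial (x b : nat -> L) (k : nat) : D :=
  mulop (kappa (x k.-1) (b k.-1)).

Definition hatC_from2 (x b : nat -> L) (E : nat -> int -> D) (k : nat) : D :=
  - racah_op x b E k.-1 + mulop (kappa 0 (b k - b 0%N - 1)).

(* hatC_initial k is the operator of [1..k], hatC_from2 k that of [2..k+1]. *)
Definition hatC_of (x b : nat -> L) (E : nat -> int -> D) (p q : nat) : D :=
  if p == 1%N then hatC_initial x b q
  else hatC_from2 (raise (p - 2) x) (raise (p - 2) b) (raise (p - 2) E)
         (q - p + 1).

End RacahOperators.

Section DiscreteRealization.
Variables (R : realType) (n : nat) (beta : nat -> R) (N : nat).
Local Notation L := (ratfun R[i] n.-2).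

(* x_0 = 0, the independent variables x_1..x_{n-2}, and x_{n-1} = N. *)
Definition xvar (i : nat) : L :=
  if i is i'.+1 then
    if insub i' is Some k then ratpoly 'X_k else N%:R
  else 0.

Lemma xvar_last : (2 <= n)%N -> xvar n.-1 = N%:R.
Proof.
rewrite /xvar => n_ge2; have -> : n.-1 = n.-2.+1 by case: n n_ge2 => [|[]].
by rewrite insubF ?ltnn.
Qed.

Definition bpar (i : nat) : L := (real_complex R (beta i))%:A.

Definition hatC (p q : nat) : linop L := hatC_of xvar bpar (@shiftop _ _) p q.

Definition hatC_gens (d : linop L) : Prop :=
  exists p q : nat, (1 <= p <= q)%N /\ (q <= n)%N /\ d = hatC p q.

Definition discrete_racah := gen_alg hatC_gens.

End DiscreteRealization.

(* Main.v *)
Require Import Defs.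
From HB Require Import structures.
From mathcomp Require Import all_boot all_order all_algebra.
From mathcomp Require Import boolp reals complex mpoly functions ring zify.
Import GRing.Theory.
Local Open Scope ring_scope.

(** Why the realization exists.  The algebra R(n) is realized on vectors that
    are themselves indexed by points, so that moving a vector from point to point
    is a difference operator.

    Let L be the field of rational functions and let n commuting su(1,1) triples
    act on formal series in n variables with exponents in L, the
    i-th by d/dt, t d/dt + k_i and t^2 d/dt + 2 k_i t.  For every point x of the
    lattice (x_0, x_1 + Z, ..., x_(n-2) + Z, x_(n-1)) a vector F x is obtained by
    coupling the variables one after the other: if e_0, e_1, ... is the Verma
    module reached after the first m + 1 factors, the sum of the terms
    (-1)^j binom(y, j) e_j t^(y - j) with y = x_(m+1) - x_m is a lowest weight
    vector for the first m + 2 factors.  Its weights are such that the Casimir of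
    [1..q] has eigenvalue kappa(x_(q-1), beta_(q-1)) on F x.

    For an inner interval, C_[p..q] is the Casimir of J^[q] - J^[p-1].  Here
    J^[p-1] is a vector operator for J^[q], so it splits into three parts that
    shift x_(q-1) by -1, 0, 1; only the part of shift 0 enters the Casimir
    (casimir_complement).  The splitting is known for J^[p-1] itself and is
    propagated from one coupling to the next (V_lower_coupled, coupled_middle,
    coupled_upper, next_fam_decomposition).  When the vectors are rescaled by
    values of a function with the recursion of Gamma, the factors picked up on
    the way are exactly the B_i and b_i (gauge_identity), whence
    C_[p..q] F x = (kappa + kappa') F x - sum of the G_nu F (x + nu), with all
    nu including 0 (coupled_vectors).  The sum of all the G_nu telescopes
    (transfer_identity, pathweight_sum), and this gives the constant term of the
    difference operator (translate_hatC_inner).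

    The points being generic, distinct F x have distinct eigenvalues for some
    C_[1..q]; so they are independent, and an element of the tensor product that
    acts on them by given coefficients determines the difference operator with
    those coefficients (realizes_unique).  This correspondence respects sums and
    products, and contains the pairs (C_[i..j], hat C_[i..j]).  Every C_A is a
    linear combination of Casimirs of intervals (gen_block_casimir).  Hence each
    element of R(n) has exactly one partner, which defines the morphism, and each
    element of the algebra of difference operators is a partner. *)

Set Implicit Arguments.
Unset Strict Implicit.
Unset Printing Implicit Defensive.

(** * Linear identities in modules *)

Section ModuleReflection.
Variables (R : pzRingType) (V : lmodType R).

Inductive lin_term : Type :=
| Lvar of nat
| Lzero
| Ladd of lin_term & lin_term
| Lopp of lin_term
| Lscale of R & lin_term
| Lmuln of lin_term & nat.

Fixpoint lin_eval (v : seq V) (e : lin_term) : V :=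
  match e with
  | Lvar i => nth 0 v i
  | Lzero => 0
  | Ladd e e' => lin_eval v e + lin_eval v e'
  | Lopp e => - lin_eval v e
  | Lscale k e => k *: lin_eval v e
  | Lmuln e n => lin_eval v e *+ n
  end.

Fixpoint lin_coef (e : lin_term) (i : nat) : R :=
  match e with
  | Lvar j => if eqn i j then 1 else 0
  | Lzero => 0
  | Ladd e e' => lin_coef e i + lin_coef e' i
  | Lopp e => - lin_coef e i
  | Lscale k e => k * lin_coef e i
  | Lmuln e n => lin_coef e i *+ n
  end.

Lemma lin_evalE v e : lin_eval v e = \sum_(i < size v) lin_coef e i *: v`_i.
Proof.
elim: e => /= [j||e -> e' ->|e ->|k e ->|e -> n].
- have [jv|vj] := ltnP j (size v); last first.
    rewrite nth_default // big1 // => i _.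
    by rewrite -[eqn _ _]/(val i == j) ltn_eqF ?scale0r // (leq_trans (ltn_ord i)).
  rewrite (bigD1 (Ordinal jv)) //= big1 => [|i].
    by rewrite -[eqn _ _]/(j == j) eqxx scale1r addr0.
  by rewrite -val_eqE /= -[eqn _ _]/(val i == j) => /negPf->; rewrite scale0r.
- by rewrite big1 // => i _; rewrite scale0r.
- by rewrite -big_split; apply: eq_bigr => i _; rewrite scalerDl.
- by rewrite -sumrN; apply: eq_bigr => i _; rewrite scaleNr.
- by rewrite scaler_sumr; apply: eq_bigr => i _; rewrite scalerA.
- by rewrite -sumrMnl; apply: eq_bigr => i _; rewrite scalerMnl.
Qed.

Fixpoint coefs_agree (e e' : lin_term) (n : nat) : Prop :=
  if n is n'.+1 then lin_coef e n' = lin_coef e' n' /\ coefs_agree e e' n' else True.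

(** Reduces an equation between vectors to one equation of scalars for each
    atom, where the normal form of rings and fields is available. *)
Lemma lin_eval_eq v e e' : coefs_agree e e' (size v) -> lin_eval v e = lin_eval v e'.
Proof.
move=> ee; rewrite !lin_evalE; apply: eq_bigr => -[i iv] _ /=; congr (_ *: _).
by elim: (size v) iv ee => //= n IH; rewrite ltnS leq_eqVlt => /predU1P[-> []|/IH h []].
Qed.
End ModuleReflection.

(** Atoms are compared up to the algebraic structures that the operations carry,
    because convertible structures can differ syntactically. *)
Ltac lin_same x y := lazymatch constr:((x, y)) with
  | (?a, ?a) => constr:(true)
  | (@GRing.mul _ ?a ?b, @GRing.mul _ ?c ?d) =>
      lazymatch lin_same a c with true => lin_same b d | _ => constr:(false) end
  | (@GRing.add _ ?a ?b, @GRing.add _ ?c ?d) =>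
      lazymatch lin_same a c with true => lin_same b d | _ => constr:(false) end
  | (@GRing.opp _ ?a, @GRing.opp _ ?b) => lin_same a b
  | (@GRing.natmul _ ?a ?n, @GRing.natmul _ ?b ?n) => lin_same a b
  | (@GRing.one _, @GRing.one _) => constr:(true)
  | (?f ?a, ?f ?b) => lin_same a b
  | _ => constr:(false)
  end.
Ltac lin_mem x l := lazymatch l with
  | nil => constr:(false)
  | ?y :: ?l' => lazymatch lin_same x y with true => constr:(true) | _ => lin_mem x l' end
  end.
Ltac lin_index x l := lazymatch l with
  | ?y :: ?l' => lazymatch lin_same x y with true => constr:(O)
      | _ => let n := lin_index x l' in constr:(S n) end
  end.
Ltac lin_atoms R V t l := lazymatch t with
  | GRing.zero => l
  | GRing.add ?a ?b => let l' := lin_atoms R V a l in lin_atoms R V b l'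
  | GRing.opp ?a => lin_atoms R V a l
  | @GRing.scale _ _ _ ?a => lin_atoms R V a l
  | GRing.natmul ?a _ => lin_atoms R V a l
  | _ => lazymatch lin_mem t l with true => l | false => constr:(t :: l) end
  end.
Ltac lin_quote R t l := lazymatch t with
  | GRing.zero => constr:(@Lzero R)
  | GRing.add ?a ?b => let a' := lin_quote R a l in let b' := lin_quote R b l in
      constr:(@Ladd R a' b')
  | GRing.opp ?a => let a' := lin_quote R a l in constr:(@Lopp R a')
  | @GRing.scale _ _ ?k ?a => let a' := lin_quote R a l in constr:(@Lscale R k a')
  | GRing.natmul ?a ?n => let a' := lin_quote R a l in constr:(@Lmuln R a' n)
  | _ => let n := lin_index t l in constr:(@Lvar R n)
  end.

Ltac linear_comb R V :=
  lazymatch goal with |- ?a = ?b =>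
    let l := lin_atoms R V a (@nil V) in
    let l := lin_atoms R V b l in
    let a' := lin_quote R a l in
    let b' := lin_quote R b l in
    change (@lin_eval R V l a' = @lin_eval R V l b');
    apply: lin_eval_eq; cbn [coefs_agree lin_coef size eqn];
    repeat (apply: conj); try exact: I
  end.
(** An additive group is a module over the integers; this proves the linear
    identities of a non-commutative ring, products counting as atoms. *)
Ltac zlinear A := linear_comb int (ssrint.zmodule A); by [].

(** * Triples satisfying the relations of su(1,1) *)

Variant su11_index := Jplus | Jminus | Jzero.

Section Su11Triples.
Variable A : pzRingType.
Implicit Types (x y z : A) (j : su11_index -> A) (J : nat -> su11_index -> A).

Definition su11_triple j : Prop :=
  [/\ j Jminus * j Jplus - j Jplus * j Jminus = j Jzero *+ 2,
      j Jzero * j Jplus - j Jplus * j Jzero = j Jplus &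
      j Jzero * j Jminus - j Jminus * j Jzero = - j Jminus].

Definition triple_casimir j : A := j Jzero * j Jzero - j Jzero - j Jplus * j Jminus.

Definition commuting_triples n J : Prop :=
  (forall a, (a < n)%N -> su11_triple (J a)) /\
  (forall a b s t, (a < n)%N -> (b < n)%N -> a != b -> GRing.comm (J a s) (J b t)).

Definition range_total J (l h : nat) : su11_index -> A :=
  fun s => \sum_(l <= a < h) J a s.

Definition block_total n (J : 'I_n -> su11_index -> A) (S : {set 'I_n}) : su11_index -> A :=
  fun s => \sum_(a in S) J a s.

Lemma subr_eqD x y z : x - y = z -> x = y + z.
Proof. by move=> <-; rewrite addrC subrK. Qed.

Lemma su11_tripleD j j' : su11_triple j -> su11_triple j' ->
  (forall s t, GRing.comm (j s) (j' t)) -> su11_triple (fun s => j s + j' s).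
Proof.
have E x y x' y' : GRing.comm x y' -> GRing.comm y x' ->
    (x + x') * (y + y') - (y + y') * (x + x') = (x * y - y * x) + (x' * y' - y' * x').
  by move=> c1 c2; rewrite !mulrDl !mulrDr c1 c2; zlinear A.
move=> [r1 r2 r3] [s1 s2 s3] c; split; rewrite E // ?r1 ?r2 ?r3 ?s1 ?s2 ?s3.
- by rewrite mulrnDl.
- by [].
- by rewrite opprD.
Qed.

Lemma su11_triple0 : su11_triple (fun=> 0).
Proof. by split; rewrite !mulr0 subr0 ?mul0rn ?oppr0. Qed.

Lemma triple_casimir_comm j s : su11_triple j -> GRing.comm (triple_casimir j) (j s).
Proof.
move=> [/subr_eqD + /subr_eqD + /subr_eqD]; rewrite /GRing.comm /triple_casimir.
rewrite !mulrBl !mulrBr; case: s;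
move: (j Jplus) (j Jminus) (j Jzero) => p m z; rewrite mulr2n => r1 r2 r3.
- rewrite -!mulrA r1 r2 !mulrDr [z * (p * z)]mulrA r2 mulrDl -!mulrA; zlinear A.
- have E : z * z * m = m * z * z - m * z *+ 2 + m.
    by rewrite -mulrA r3 mulrDr mulrN !mulrA r3 mulrDl mulNr; zlinear A.
  by rewrite E r3 [m * (p * m)]mulrA r1 !mulrDl r3 !mulrA; zlinear A.
- have E : p * m * z = z * (p * m).
    by rewrite mulrA r2 mulrDl -!mulrA r3 mulrDr mulrN; zlinear A.
  by rewrite E !mulrA.
Qed.

(** The Casimir is a polynomial in the triple. *)
Lemma triple_casimir_comm_other j y :
  (forall s, GRing.comm (j s) y) -> GRing.comm (triple_casimir j) y.
Proof.
move=> c; apply/commr_sym; apply: commrB; first apply: commrB.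
- by apply: commrM; apply/commr_sym/c.
- exact/commr_sym/c.
- by apply: commrM; apply/commr_sym/c.
Qed.

Section Commuting.
Variables (n : nat) (J : nat -> su11_index -> A).
Hypothesis HJ : commuting_triples n J.

Lemma total_comm l h l' h' s t : (h <= n)%N -> (h' <= n)%N ->
  (h <= l')%N || (h' <= l)%N -> GRing.comm (range_total J l h s) (range_total J l' h' t).
Proof.
move=> hn hn' d; rewrite /range_total !big_nat.
apply: commr_sum => b /andP[b1 b2]; apply: commr_sym; apply: commr_sum => a /andP[a1 a2].
apply: HJ.2; lia.
Qed.

Lemma total_triple l h : (h <= n)%N -> su11_triple (range_total J l h).
Proof.
elim: h => [|h IH] hn.
  have -> : range_total J l 0 = fun=> 0 by apply/funext => s; rewrite /range_total big_geq.
  exact: su11_triple0.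
have [lh|hl] := leqP l h; last first.
  have -> : range_total J l h.+1 = fun=> 0 by apply/funext => s; rewrite /range_total big_geq.
  exact: su11_triple0.
have -> : range_total J l h.+1 = fun s => range_total J l h s + J h s.
  by apply/funext => s; rewrite /range_total big_nat_recr.
apply: su11_tripleD; [by apply: IH; lia | exact: HJ.1|].
move=> s t; rewrite /range_total big_nat; apply/commr_sym.
apply: commr_sum => a /andP[a1 a2]; apply: HJ.2; lia.
Qed.

Lemma total_split l k h s : (l <= k <= h)%N ->
  range_total J l h s = range_total J l k s + range_total J k h s.
Proof. by move=> /andP[lk kh]; rewrite /range_total (@big_cat_nat _ _ _ k). Qed.

(** The larger total splits into the total of the range itself, for which the
    Casimir is central, and totals of other factors. *)
Lemma total_casimir_comm l k h s : (l <= h <= k)%N -> (k <= n)%N ->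
  GRing.comm (triple_casimir (range_total J l h)) (range_total J 0 k s).
Proof.
move=> /andP[lh hk] kn; rewrite (@total_split 0 l k) ?(@total_split l h k); try lia.
apply: commrD; last apply: commrD.
- by apply: triple_casimir_comm_other => t; apply: total_comm; lia.
- by apply: triple_casimir_comm; apply: total_triple; lia.
- by apply: triple_casimir_comm_other => t; apply: total_comm; lia.
Qed.

End Commuting.

(** The cross term is bilinear in the two triples; it is the reason why
    Casimirs of pairs and single factors suffice to express all others. *)
Lemma triple_casimirD j j' :
  triple_casimir (fun s => j s + j' s) = triple_casimir j + triple_casimir j' +
    (j Jzero * j' Jzero + j' Jzero * j Jzero
     - j Jplus * j' Jminus - j' Jplus * j Jminus).
Proof. by rewrite /triple_casimir !mulrDl !mulrDr; zlinear A. Qed.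

End Su11Triples.

(** * Operators composed from left to right *)
Section RightOperators.
Variables (L : fieldType) (W : lmodType L).

(** The product of s and t applies s first.  If a Casimir C sends F x to the sum
    of the c_y(x) F y, then C' (C (F x)) is the sum of the c_y(x) C' (F y): the
    coefficients of the operator applied first stay outermost, as those of the
    left factor do in a product of difference operators.  With this product the
    correspondence between the two kinds of operators preserves the order of
    factors, and the relations of su(1,1) make J_+ a lowering operator. *)
Record rop := ROp { rop_fun :> W -> W; rop_linear : linear rop_fun }.

HB.instance Definition _ := gen_eqMixin rop.
HB.instance Definition _ := gen_choiceMixin rop.

Lemma ropP (s t : rop) : s =1 t -> s = t.
Proof.
case: s t => [s ls] [t lt] /= st; have est : s = t by apply/funext.
by subst t; congr ROp; apply: Prop_irrelevance.
Qed.

HB.instance Definition _ (s : rop) :=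
  GRing.isLinear.Build L W W *:%R s (rop_linear s).

Fact rop_zero_linear : linear (fun _ : W => 0 : W).
Proof. by move=> k u v; rewrite scaler0 addr0. Qed.
Fact rop_one_linear : linear (id : W -> W).
Proof. by []. Qed.
Fact rop_opp_linear (s : rop) : linear (fun v => - s v).
Proof. by move=> k u v; rewrite linearP opprD scalerN. Qed.
Fact rop_add_linear (s t : rop) : linear (fun v => s v + t v).
Proof. by move=> k u v; rewrite !linearP scalerDr addrACA. Qed.
Fact rop_mul_linear (s t : rop) : linear (fun v => t (s v)).
Proof. by move=> k u v; rewrite !linearP. Qed.

Definition rop_add s t := ROp (rop_add_linear s t).
Definition rop_opp s := ROp (rop_opp_linear s).
Definition rop_mul s t := ROp (rop_mul_linear s t).

Fact rop_addA : associative rop_add.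
Proof. by move=> s t u; apply: ropP => v /=; rewrite addrA. Qed.
Fact rop_addC : commutative rop_add.
Proof. by move=> s t; apply: ropP => v /=; rewrite addrC. Qed.
Fact rop_add0 : left_id (ROp rop_zero_linear) rop_add.
Proof. by move=> s; apply: ropP => v /=; rewrite add0r. Qed.
Fact rop_addN : left_inverse (ROp rop_zero_linear) rop_opp rop_add.
Proof. by move=> s; apply: ropP => v /=; rewrite addNr. Qed.

HB.instance Definition _ :=
  GRing.isZmodule.Build rop rop_addA rop_addC rop_add0 rop_addN.

Fact rop_mulA : associative rop_mul.
Proof. by move=> s t u; apply: ropP. Qed.
Fact rop_mul1 : left_id (ROp rop_one_linear) rop_mul.
Proof. by move=> s; apply: ropP. Qed.
Fact rop_mulr1 : right_id (ROp rop_one_linear) rop_mul.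
Proof. by move=> s; apply: ropP. Qed.
Fact rop_mulDl : left_distributive rop_mul +%R.
Proof. by move=> s t u; apply: ropP => v; rewrite /= linearD. Qed.
Fact rop_mulDr : right_distributive rop_mul +%R.
Proof. by move=> s t u; apply: ropP. Qed.

HB.instance Definition _ := GRing.Zmodule_isPzRing.Build rop
  rop_mulA rop_mul1 rop_mulr1 rop_mulDl rop_mulDr.

Lemma ropD (s t : rop) v : (s + t) v = s v + t v. Proof. by []. Qed.
Lemma ropN (s : rop) v : (- s) v = - s v. Proof. by []. Qed.
Lemma ropB (s t : rop) v : (s - t) v = s v - t v. Proof. by []. Qed.
Lemma ropM (s t : rop) v : (s * t) v = t (s v). Proof. by []. Qed.
Lemma ropZ (s : rop) k v : s (k *: v) = k *: s v. Proof. exact: linearZ. Qed.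
Lemma ropDr (s : rop) u v : s (u + v) = s u + s v. Proof. exact: linearD. Qed.
Lemma rop0r (s : rop) : s 0 = 0. Proof. exact: linear0. Qed.
Lemma ropNr (s : rop) u : s (- u) = - s u. Proof. exact: linearN. Qed.
Lemma ropBr (s : rop) u v : s (u - v) = s u - s v. Proof. exact: linearB. Qed.
Lemma rop_sumr I r (P : pred I) (s : rop) (F : I -> W) :
  s (\sum_(i <- r | P i) F i) = \sum_(i <- r | P i) s (F i).
Proof. exact: linear_sum. Qed.
End RightOperators.

(** * Representations of the tensor power *)

Section ProductLemmas.
Variables (K : fieldType) (A : algType K) (I : eqType).
Implicit Types (r : seq I) (f g : I -> A).

Lemma prod_linear_at r i f g h (k : K) : uniq r -> i \in r ->
  (forall j, j != i -> f j = h j /\ g j = h j) -> h i = k *: f i + g i ->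
  \prod_(j <- r) h j = k *: (\prod_(j <- r) f j) + \prod_(j <- r) g j.
Proof.
move=> + + fgh hi; elim: r => // j r IH /= /andP[jr ur]; rewrite inE !big_cons.
case: eqVneq => [ij _|ij /= ir]; last first.
  by rewrite IH // mulrDr -scalerAr !(fgh j _).1 ?(fgh j _).2 // eq_sym.
rewrite -ij in jr *; rewrite hi mulrDl -scalerAl; congr (_ *: (_ * _) + _ * _);
  apply: eq_big_seq => l lr; have li : l != i by [apply: contraNneq jr => <-].
- by rewrite (fgh l li).1.
- by rewrite (fgh l li).2.
Qed.

Lemma prod_comm_split r f g : uniq r ->
  (forall i j, i != j -> GRing.comm (f i) (g j)) ->
  \prod_(i <- r) (f i * g i) = (\prod_(i <- r) f i) * \prod_(i <- r) g i.
Proof.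
move=> + c; elim: r => [|i r IH] /=; first by rewrite !big_nil mulr1.
move=> /andP[ir ur]; rewrite !big_cons IH // !mulrA; congr (_ * _).
rewrite -!mulrA; congr (_ * _); apply/commr_sym.
rewrite big_seq; elim/big_rec: _ => [|j x jr cx]; first exact/commr_sym/commr1.
apply/commr_sym; apply: commrM => //; apply/commr_sym; apply: c.
by apply: contraNneq ir => <-.
Qed.

Lemma prod_single r i f : uniq r -> i \in r ->
  (forall j, j != i -> f j = 1) -> \prod_(j <- r) f j = f i.
Proof.
move=> + + f1; elim: r => // j r IH /= /andP[jr ur]; rewrite inE big_cons.
case: eqVneq => [ij _|ij /= ir]; last by rewrite IH // f1 ?mul1r // eq_sym.
rewrite -ij in jr *; rewrite big1_seq ?mulr1 // => l /= lr; apply: f1.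
by apply: contraNneq jr => <-.
Qed.
End ProductLemmas.

Section TensorPowerHom.
Variables (K : fieldType) (A : algType K) (n : nat) (J : nat -> su11_index -> A).
Hypothesis HJ : commuting_triples n J.
Local Notation br := (@su11_br K).
Local Notation U := (enveloping br).
Local Notation X := {ffun 'I_n -> U}.

Definition triple_span (j : su11_index -> A) (x : 'rV[K]_3) : A :=
  x 0 0 *: j Jplus + x 0 1 *: j Jminus + x 0 2%:R *: j Jzero.

Lemma triple_span_rel j : su11_triple j -> forall s t, env_rel br s t ->
  alg_eval (triple_span j) s = alg_eval (triple_span j) t.
Proof.
move=> [/subr_eqD + /subr_eqD + /subr_eqD].
rewrite /triple_span; move: (j Jplus) (j Jminus) (j Jzero) => p m z; rewrite mulr2n.
move=> r1 r2 r3 s t [k x y|x y] /=; rewrite !mxE /=.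
  rewrite -!scalerAl !mul1r; linear_comb K A; ring.
rewrite -[_%:A * _]scalerAl mul1r !mulrDl !mulrDr -!scalerAl -!scalerAr r1 r2 r3.
linear_comb K A; ring.
Qed.

Definition env_map (a : nat) : U -> A := plift (triple_span (J a)).

Lemma plift_comm (Y : Type) rel (f : Y -> A) y :
  (forall s t, rel s t -> alg_eval f s = alg_eval f t) ->
  (forall x, GRing.comm y (f x)) -> forall u : presented rel, GRing.comm y (plift f u).
Proof.
move=> fr c; elim/tclass_ind=> t; rewrite (plift_tclass fr).
elim: t => //= [k|s IHs t IHt|s IHs t IHt].
- exact/commr_sym/comm_alg.
- exact: commrD.
- exact: commrM.
Qed.

Lemma env_map_comm (i j : 'I_n) u v : i != j -> GRing.comm (env_map i u) (env_map j v).
Proof.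
move=> ij; have ri (k : 'I_n) := triple_span_rel (HJ.1 k (ltn_ord k)).
apply: (plift_comm (ri j)) => y; apply/commr_sym; apply: (plift_comm (ri i)) => x.
have c s t : GRing.comm (J j s) (J i t) by apply: HJ.2 => //; rewrite eq_sym.
have cs (k l : K) (a b : A) : GRing.comm a b -> GRing.comm (k *: a) (l *: b).
  by rewrite /GRing.comm -!scalerAl -!scalerAr => ->; rewrite !scalerA mulrC.
rewrite /triple_span; apply: commrD; [apply: commrD|]; apply/commr_sym;
  (apply: commrD; [apply: commrD|]); exact/commr_sym/cs.
Qed.

(** Multilinearity is that of a product in which one factor varies, and the
    factorwise product is respected because different factors commute. *)
Lemma tensor_span_rel (s t : alg_term K X) : tens_rel s t ->
  alg_eval (fun u : X => \prod_(i < n) env_map i (u i)) s =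
  alg_eval (fun u : X => \prod_(i < n) env_map i (u i)) t.
Proof.
have ri (k : 'I_n) := triple_span_rel (HJ.1 k (ltn_ord k)).
case=> [u i k a b|u v|] /=.
- rewrite -scalerAl mul1r; apply: (@prod_linear_at _ _ _ _ i); rewrite ?mem_index_enum //.
  + exact: index_enum_uniq.
  + by move=> j ji; rewrite !ffunE (negPf ji).
  + by rewrite !ffunE eqxx /env_map (pliftD (ri i)) (pliftZ (ri i)).
- rewrite -prod_comm_split ?index_enum_uniq // => [|i j ij]; last exact: env_map_comm.
  by apply: eq_bigr => i _; rewrite ffunE /env_map (pliftM (ri i)).
- rewrite scale1r big1 // => i _; rewrite ffunE /env_map (plift1 (ri i)) //.
Qed.

Definition tensor_map : tensor_power br n -> A := plift (fun u : X => \prod_(i < n) env_map i (u i)).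

Lemma tensor_mapD c d : tensor_map (c + d) = tensor_map c + tensor_map d.
Proof. exact: pliftD tensor_span_rel c d. Qed.
Lemma tensor_mapM c d : tensor_map (c * d) = tensor_map c * tensor_map d.
Proof. exact: pliftM tensor_span_rel c d. Qed.
Lemma tensor_mapZ k c : tensor_map (k *: c) = k *: tensor_map c.
Proof. exact: pliftZ tensor_span_rel k c. Qed.
Lemma tensor_map1 : tensor_map 1 = 1.
Proof. exact: plift1 tensor_span_rel. Qed.

Lemma tensor_mapB c d : tensor_map (c - d) = tensor_map c - tensor_map d.
Proof. by rewrite -scaleN1r tensor_mapD tensor_mapZ scaleN1r. Qed.

Lemma tensor_map_sum I (r : seq I) (P : pred I) F :
  tensor_map (\sum_(i <- r | P i) F i) = \sum_(i <- r | P i) tensor_map (F i).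
Proof.
apply: (big_morph _ tensor_mapD).
by rewrite -(subrr 0) tensor_mapB subrr.
Qed.

Definition basis_vector (s : su11_index) : 'rV[K]_3 :=
  match s with Jplus => Jp K | Jminus => Jm K | Jzero => A0 K end.

Lemma tensor_map_in_factor s (a : 'I_n) :
  tensor_map (in_factor (env_in br (basis_vector s)) a) = J a s.
Proof.
have ri (k : 'I_n) := triple_span_rel (HJ.1 k (ltn_ord k)).
rewrite /tensor_map /in_factor /pure (plift_gen tensor_span_rel).
rewrite (@prod_single _ _ _ _ a) ?index_enum_uniq ?mem_index_enum //.
  rewrite ffunE eqxx /env_map /env_in (plift_gen (ri a)) /triple_span.
  by case: s; rewrite !mxE /= !scale0r scale1r ?addr0 ?add0r.
by move=> j ja; rewrite ffunE (negPf ja) /env_map (plift1 (ri j)).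
Qed.

Lemma tensor_map_casimir S :
  tensor_map (casimir K S) = triple_casimir (block_total (fun a : 'I_n => J a) S).
Proof.
have E s : tensor_map (lifted (basis_vector s) S) = block_total (fun a : 'I_n => J a) S s.
  by rewrite tensor_map_sum; apply: eq_bigr => a _; rewrite tensor_map_in_factor.
rewrite /casimir !tensor_mapB expr2 !tensor_mapM.
by rewrite (E Jzero) (E Jplus) (E Jminus).
Qed.

Lemma block_total_segment p q : (1 <= p)%N -> (q <= n)%N ->
  block_total (fun a : 'I_n => J a) (segment n p q) = range_total J p.-1 q.
Proof.
move=> p1 qn; apply/funext => s; rewrite /range_total /block_total.
under eq_bigl do rewrite inE.
rewrite -(big_mkord (fun a => (p <= a.+1 <= q)%N) (fun a => J a s)) /=.
rewrite [RHS](big_nat_widen _ _ n) // [RHS](big_nat_widenl _ 0) // big_nat_cond.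
by rewrite [RHS]big_nat_cond; apply: eq_bigl => a; case: p p1 => // p _ /=; lia.
Qed.
End TensorPowerHom.

(** * Signed binomial coefficients and formal power series *)

Definition char0 (L : fieldType) : Prop := forall n, n.+1%:R != 0 :> L.

Section Extension.
Variable L : fieldType.
Hypothesis L0 : char0 L.

Definition isnat (z : L) : Prop := exists j : nat, z = j%:R.

Lemma natr_inj0 : injective (fun n : nat => n%:R : L).
Proof.
move=> m n; wlog mn : m n / (m <= n)%N => [W|/eqP].
  by case/orP: (leq_total m n) => h e; [|apply/esym]; apply: W.
rewrite eq_sym -subr_eq0 -natrB //; case e : (n - m)%N => [|d]; last by rewrite (negPf (L0 d)).
by move=> _; lia.
Qed.

(** Extension by zero from the naturals to the field: coefficients at negative
    or non-integral indices vanish, so that recursions hold at every index. *)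
Definition ext0 (V : zmodType) (f : nat -> V) (z : L) : V :=
  if pselect (isnat z) is left h then f (projT1 (cid h)) else 0.

Lemma ext0E (V : zmodType) (f : nat -> V) n : ext0 f n%:R = f n.
Proof.
rewrite /ext0; case: pselect => [h|[]]; last by exists n.
by case: (cid h) => j /= /natr_inj0 ->.
Qed.

Lemma ext0_out (V : zmodType) (f : nat -> V) z : ~ isnat z -> ext0 f z = 0.
Proof. by rewrite /ext0; case: pselect. Qed.

Lemma isnatS z : isnat (z - 1) -> isnat z.
Proof. by move=> [j e]; exists j.+1; rewrite -addn1 natrD -e subrK. Qed.

Lemma not_isnatN1 : ~ isnat (-1).
Proof. by move=> [j /esym/eqP]; rewrite -subr_eq0 opprK natr1 (negPf (L0 j)). Qed.

Lemma isnat_case z : [\/ z = 0, isnat (z - 1) | ~ isnat z].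
Proof.
have [[[|j] ->]|] := pselect (isnat z); last by constructor 3.
- by constructor 1.
- by constructor 2; exists j; rewrite -natr1 addrK.
Qed.

(** (-1)^j binom(y, j), the coefficient of s^j in (1 - s)^y. *)
Definition sbinom (y : L) : L -> L :=
  ext0 (fun j => \prod_(i < j) (- (y - i%:R) / i.+1%:R)).

Lemma sbinom0 y : sbinom y 0 = 1.
Proof. by rewrite /sbinom -[X in ext0 _ X](mulr0n 1) ext0E big_ord0. Qed.

Lemma sbinom_out y z : ~ isnat z -> sbinom y z = 0.
Proof. exact: ext0_out. Qed.

Lemma sbinomS y z : z * sbinom y z = - (y - z + 1) * sbinom y (z - 1).
Proof.
have [->|[j e]|nz] := isnat_case z.
- by rewrite mul0r sub0r sbinom_out ?mulr0 //; apply: not_isnatN1.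
- have -> : z = j.+1%:R by rewrite -natr1 -e subrK.
  rewrite -natr1 addrK natr1 /sbinom !ext0E big_ord_recr /=.
  have := L0 j; rewrite -natr1 => h; field; exact: h.
- by rewrite !sbinom_out ?mulr0 // => /isnatS.
Qed.

Lemma sbinom_pascal y z : sbinom (y + 1) z = sbinom y z - sbinom y (z - 1).
Proof.
have [[j ->]|nz] := pselect (isnat z); last first.
  by rewrite !sbinom_out ?subr0 // => /isnatS.
elim: j => [|j IH]; first by rewrite sub0r !sbinom0 sbinom_out ?subr0 //; apply: not_isnatN1.
apply: (mulfI (L0 j)); rewrite sbinomS mulrBr sbinomS -natr1 addrK IH.
have := sbinomS y j%:R.
move: (sbinom y j%:R) (sbinom y (j%:R - 1)) => u v uv.
apply/eqP; rewrite -subr_eq0; apply/eqP.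
have -> : - (y + 1 - (j%:R + 1) + 1) * (u - v) -
   (- (y - (j%:R + 1) + 1) * u - (j%:R + 1) * u) = j%:R * u + (y - j%:R + 1) * v by ring.
by rewrite uv; ring.
Qed.

Lemma sbinom_absorb y z : (z + 1) * sbinom (y + 1) (z + 1) = - (y + 1) * sbinom y z.
Proof.
rewrite sbinomS addrK; have := sbinomS y z; rewrite sbinom_pascal => uv.
have -> : - (y + 1 - (z + 1) + 1) * (sbinom y z - sbinom y (z - 1)) =
  - (y + 1) * sbinom y z + (z * sbinom y z + (y - z + 1) * sbinom y (z - 1)) by ring.
by rewrite uv; ring.
Qed.

End Extension.

Section Series.
Variables (L : fieldType) (W : lmodType L).
Hypothesis L0 : char0 L.
Implicit Types (al : L -> L) (e : L -> W) (j V : su11_index -> rop W) (k y z : L).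

Lemma pointwise_linear (f : rop W) : linear (fun (w : L -> W) z => f (w z)).
Proof. by move=> a u v; apply/funext => z; rewrite /= linearP. Qed.
Definition pointwise (f : rop W) : rop (L -> W) := ROp (pointwise_linear f).

Lemma shift_coef_linear (d : L) (q : L -> L) :
  linear (fun (w : L -> W) z => q z *: w (z + d)).
Proof.
move=> a u v; apply/funext => z; rewrite scalrfctE !addrfctE scalrfctE /= scalerDr !scalerA.
by rewrite mulrC.
Qed.
Definition shift_coef d q : rop (L -> W) := ROp (shift_coef_linear d q).

(** A function w stands for the formal sum of the w z t^z over z in the field;
    J_+, J_0 and J_- are then d/dt, t d/dt + k and t^2 d/dt + 2 k t. *)
Definition power_op k (s : su11_index) : rop (L -> W) :=
  match s with
  | Jplus => shift_coef 1 (fun z => z + 1)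
  | Jminus => shift_coef (-1) (fun z => z - 1 + 2%:R * k)
  | Jzero => shift_coef 0 (fun z => z + k)
  end.

Lemma power_triple k : su11_triple (power_op k).
Proof.
have E d q d' q' w z : (shift_coef d q * shift_coef d' q') w z =
    (q' z * q (z + d')) *: w (z + (d' + d)).
  by rewrite /= scalerA addrA.
split; apply: ropP => w; apply/funext => z.
- rewrite ropB -[LHS]/(_ - _) !E mulr2n -[RHS]/(_ + _) /= addrN addNr addr0.
  by linear_comb L W; ring.
- rewrite ropB -[LHS]/(_ - _) !E /= addr0 add0r.
  by linear_comb L W; ring.
- rewrite ropB -[LHS]/(_ - _) !E -[RHS]/(- _) /= addr0 add0r.
  by linear_comb L W; ring.
Qed.

Lemma pointwise_comm_power f k s : GRing.comm (pointwise f) (power_op k s).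
Proof. by case: s; apply: ropP => w; apply/funext => z; rewrite /= linearZ. Qed.

Lemma pointwiseM f g : pointwise (f * g) = pointwise f * pointwise g.
Proof. exact: ropP. Qed.
Lemma pointwiseB f g : pointwise (f - g) = pointwise f - pointwise g.
Proof. exact: ropP. Qed.
Lemma pointwise_sum (I : Type) (r : seq I) (P : pred I) (F : I -> rop W) :
  pointwise (\sum_(i <- r | P i) F i) = \sum_(i <- r | P i) pointwise (F i).
Proof. by apply: (big_morph pointwise) => [f g|]; apply: ropP. Qed.

(** The sum over j of the al j e_j t^(y - j). *)
Definition series al e y : L -> W := fun z => al (y - z) *: e (y - z).

Definition supported al := forall z, ~ isnat z -> al z = 0.

(** The basis of a Verma module of lowest weight k, normalised like the powers
    of t under power_op. *)
Definition verma j k e := forall n : nat, let z := n%:R : L in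
  [/\ j Jplus (e z) = z *: e (z - 1), j Jzero (e z) = (k + z) *: e z &
      j Jminus (e z) = (2%:R * k + z) *: e (z + 1)].

Lemma supported_scale al (u v : L -> W) : supported al ->
  (forall n : nat, u n%:R = v n%:R) -> forall z, al z *: u z = al z *: v z.
Proof.
move=> sal uv z; have [[n ->]|nz] := pselect (isnat z); first by rewrite uv.
by rewrite sal // !scale0r.
Qed.

Lemma series_eq al al' e y : al =1 al' -> series al e y = series al' e y.
Proof. by move=> E; apply/funext => z; rewrite /series E. Qed.

Lemma series_raise j k k' e al y : verma j k e -> supported al ->
  (pointwise (j Jminus) + power_op k' Jminus) (series al e y) =
  series (fun z => (2%:R * k + z - 1) * al (z - 1) + (y - z + 2%:R * k') * al z) e (y + 1).
Proof.
move=> ve sal; apply/funext => z; rewrite ropD addrfctE /= /series ropZ.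
have -> : y + 1 - z = (y - z) + 1 by ring.
have -> : y - (z - 1) = (y - z) + 1 by ring.
(* The index t is kept apart from z, so that the terms of index t and t - 1
   become the atoms of a linear identity. *)
have [t tE] : exists t, t = y - z by [exists (y - z)].
rewrite -tE.
rewrite (supported_scale (u := fun t => j Jminus (e t)) (v := fun t => (2%:R * k + t) *: e (t + 1)) sal); last first.
  by move=> n; have [_ _ E] := ve n; exact: E.
rewrite addrK; linear_comb L W.
have -> : z = y - t by rewrite tE; ring.
ring.
Qed.

Lemma series_lower j k k' e al y : verma j k e -> supported al ->
  (pointwise (j Jplus) + power_op k' Jplus) (series al e y) =
  series (fun z => (z + 1) * al (z + 1) + (y - z) * al z) e (y - 1).
Proof.
move=> ve sal; apply/funext => z; rewrite ropD addrfctE /= /series ropZ.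
have -> : y - 1 - z = (y - z) - 1 by ring.
have -> : y - (z + 1) = (y - z) - 1 by ring.
have [t tE] : exists t, t = y - z by [exists (y - z)].
rewrite -tE.
rewrite (supported_scale (u := fun t => j Jplus (e t)) (v := fun t => t *: e (t - 1)) sal); last first.
  by move=> n; have [E _ _] := ve n; exact: E.
rewrite subrK; linear_comb L W.
have -> : z = y - t by rewrite tE; ring.
ring.
Qed.

Lemma series_weight j k k' e al y : verma j k e -> supported al ->
  (pointwise (j Jzero) + power_op k' Jzero) (series al e y) =
  (k + k' + y) *: series al e y.
Proof.
move=> ve sal; apply/funext => z; rewrite ropD addrfctE scalrfctE /= /series ropZ addr0.
have [t tE] : exists t, t = y - z by [exists (y - z)].
rewrite -tE.
rewrite (supported_scale (u := fun t => j Jzero (e t)) (v := fun t => (k + t) *: e t) sal); last first.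
  by move=> n; have [_ E _] := ve n; exact: E.
linear_comb L W.
have -> : z = y - t by rewrite tE; ring.
ring.
Qed.

(** The Wigner-Eckart theorem for a vector operator V on a Verma module of lowest
    weight k: its image lies in a sum of modules of lowest weights k - 1, k and
    k + 1, with bases Dm, D0 and Dp, and the commutation relations with the total
    triple fix all matrix entries. *)
Definition tensor_decomposition V k e Dm D0 Dp := forall n : nat, let z := n%:R : L in
  [/\ V Jplus (e z) = - (Dm z - z *: D0 (z - 1) + (z * (z - 1)) *: Dp (z - 2%:R)),
      V Jzero (e z) = - (Dm (z + 1) - (k + z) *: D0 z
                         + (z * (2%:R * k + z)) *: Dp (z - 1)) &
      V Jminus (e z) = - (Dm (z + 2%:R) - (2%:R * k + z) *: D0 (z + 1)
                          + ((2%:R * k + z) * (2%:R * k + z + 1)) *: Dp z)].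

(** In each of the three series the index is shifted so that the powers of t
    agree; this moves the factors z of the decomposition to the coefficients. *)
Lemma series_decomposition V k e Dm D0 Dp al y :
  tensor_decomposition V k e Dm D0 Dp -> supported al ->
  [/\ pointwise (V Jplus) (series al e y) =
        - (series al Dm y + series (fun z => - ((z + 1) * al (z + 1))) D0 (y - 1)
           + series (fun z => (z + 2%:R) * (z + 1) * al (z + 2%:R)) Dp (y - 2%:R)),
      pointwise (V Jzero) (series al e y) =
        - (series (fun z => al (z - 1)) Dm (y + 1) + series (fun z => - ((k + z) * al z)) D0 y
           + series (fun z => (z + 1) * (2%:R * k + z + 1) * al (z + 1)) Dp (y - 1)) &
      pointwise (V Jminus) (series al e y) =
        - (series (fun z => al (z - 2%:R)) Dm (y + 2%:R)
           + series (fun z => - ((2%:R * k + z - 1) * al (z - 1))) D0 (y + 1)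
           + series (fun z => (2%:R * k + z) * (2%:R * k + z + 1) * al z) Dp y)].
Proof.
move=> dV sal; split; apply/funext => z;
  rewrite opprfctE !addrfctE /= /series ropZ;
  rewrite ?[y - 1 - z]addrAC ?[y - 2%:R - z]addrAC ?[y + 1 - z]addrAC ?[y + 2%:R - z]addrAC;
  move: {y z}(y - z) => t.
- rewrite (supported_scale (u := fun z => V Jplus (e z)) (v := fun z => - (Dm z - z *: D0 (z - 1) + (z * (z - 1)) *: Dp (z - 2%:R))) sal); last first.
    by move=> n; have [E _ _] := dV n; exact: E.
  rewrite !subrK; linear_comb L W; ring.
- rewrite (supported_scale (u := fun z => V Jzero (e z)) (v := fun z => - (Dm (z + 1) - (k + z) *: D0 z
                         + (z * (2%:R * k + z)) *: Dp (z - 1))) sal); last first.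
    by move=> n; have [_ E _] := dV n; exact: E.
  rewrite !subrK addrK; linear_comb L W; ring.
- rewrite (supported_scale (u := fun z => V Jminus (e z)) (v := fun z => - (Dm (z + 2%:R) - (2%:R * k + z) *: D0 (z + 1)
                          + ((2%:R * k + z) * (2%:R * k + z + 1)) *: Dp z)) sal); last first.
    by move=> n; have [_ _ E] := dV n; exact: E.
  rewrite !addrK; linear_comb L W; ring.
Qed.
End Series.
Arguments power_op {L W} k s.

(** * Binomial identities behind one coupling *)

Section CoefficientIdentities.
Variable L : fieldType.
Hypothesis L0 : char0 L.
Variables (k k' : L).
Implicit Types (y z : L).

(** The coefficients of the image under the total J_- of the series with
    coefficients al over a family of lowest weight k (see series_raise). *)
Definition raised (k y : L) (al : L -> L) (z : L) : L :=
  (2%:R * k + z - 1) * al (z - 1) + (y - z + 2%:R * k') * al z.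

Lemma sbinomS_pred y z :
  z * sbinom y (z - 1) = sbinom y (z - 1) - (y - z + 2%:R) * sbinom y (z - 1 - 1).
Proof.
have -> : z * sbinom y (z - 1) = (z - 1) * sbinom y (z - 1) + sbinom y (z - 1) by ring.
by rewrite sbinomS //; ring.
Qed.

Lemma sbinom_pascal2 y z :
  sbinom (y + 2%:R) z = sbinom y z - sbinom y (z - 1) *+ 2 + sbinom y (z - 1 - 1).
Proof.
have -> : y + 2%:R = y + 1 + 1 by ring.
by rewrite sbinom_pascal // !(sbinom_pascal L0 y); ring.
Qed.

Lemma sbinom_absorb2 y z : (z + 2%:R) * (z + 1) * sbinom (y + 2%:R) (z + 2%:R) =
  (y + 2%:R) * (y + 1) * sbinom y z.
Proof.
have -> : y + 2%:R = y + 1 + 1 by ring.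
have -> : z + 2%:R = z + 1 + 1 by ring.
have h1 := sbinom_absorb L0 (y + 1) (z + 1).
have h2 := sbinom_absorb L0 y z.
rewrite mulrAC h1 -[- (_ + _) * _ * _]mulrA [sbinom _ _ * _]mulrC h2; ring.
Qed.

(** Ideal membership with given cofactors, for identities between binomials modulo
    two instances of their recursion. *)
Lemma eq_by_relations (A B l r l' r' c c' : L) : l = r -> l' = r' ->
  A - B = c * (l - r) + c' * (l' - r') -> A = B.
Proof. by move=> -> ->; rewrite !subrr !mulr0 addr0 => /eqP; rewrite subr_eq0 => /eqP. Qed.

(** In raising_st, s is the shift of the lowest weight of the inner family and t
    that of the total weight.  Each identity says that a combination of raised
    series has again signed binomials as coefficients, up to a constant factor:
    the result is a multiple of a coupled vector. *)
Lemma raising_m0 y z (K := k + k' + y) :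
  - ((2%:R * K - 2%:R) * sbinom y (z - 1)) + raised (k - 1) y (sbinom y) z
   = (y + 2%:R * k') * sbinom (y + 1) z.
Proof.
rewrite /raised sbinom_pascal //.
have h1 := sbinomS L0 y z; rewrite /K; ring: h1.
Qed.
Lemma raising_mp y z (K := k + k' + y) :
  raised (k - 1) (y + 1) (raised (k - 1) y (sbinom y)) z
  - 2%:R * (2%:R * K - 1) * raised (k - 1) (y + 1) (fun z => sbinom y (z - 1)) z
  + 2%:R * K * (2%:R * K - 1) * sbinom y (z - 2%:R)
   = (y + 2%:R * k') * (y + 2%:R * k' + 1) * sbinom (y + 2%:R) z.
Proof.
rewrite /raised sbinom_pascal2 //=.
have -> : z - 2%:R = z - 1 - 1 by ring.
apply: (eq_by_relations (c := z - 2%:R * (y + 2%:R * k') - 1)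
  (c' := 2%:R * (y + 2%:R * k') + y - z + 3%:R) (sbinomS L0 y z) (sbinomS_pred y z)).
rewrite /K; ring.
Qed.

Lemma lowering_0 y z : - ((z + 1) * sbinom (y + 1) (z + 1)) = (y + 1) * sbinom y z.
Proof. by rewrite sbinom_absorb //; ring. Qed.

(** Lowering has replaced the upper argument y by Y = y - 1, and the recursions
    hold for the binomials of Y. *)
Lemma raising_00 Y z (y := Y + 1) (K := k + k' + y) :
  - ((2%:R * K - 2%:R) * - ((k + z) * sbinom y z)) + raised k Y (fun z => y * sbinom Y z) z
   = (k * (2%:R * K - 2%:R) + y * (y - 1 + 2%:R * k')) * sbinom y z.
Proof.
rewrite /raised /K /y sbinom_pascal //.
have h1 := sbinomS L0 Y z; have h2 := sbinomS_pred Y z; ring: h1 h2.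
Qed.

Lemma raising_0p Y z (y := Y + 1) (K := k + k' + y) :
  raised k y (raised k Y (fun z => y * sbinom Y z)) z
  - 2%:R * (2%:R * K - 1) * raised k y (fun z => - ((k + z) * sbinom y z)) z
  + 2%:R * K * (2%:R * K - 1) * - ((2%:R * k + z - 1) * sbinom y (z - 1))
   = (y + 2%:R * k + 2%:R * k' - 1) * (y + 2%:R * k') * (y + 2%:R * k) * sbinom (y + 1) z.
Proof.
have -> : y + 1 = Y + 2%:R by rewrite /y; ring.
rewrite /raised /= sbinom_pascal2 /K /y !(sbinom_pascal L0 Y).
apply: (eq_by_relations
  (c := (Y + 1) * (z - 2%:R * (Y + 1 + 2%:R * k') + 1)
        + 2%:R * (2%:R * (k + k' + (Y + 1)) - 1) * (Y + 1 + 2%:R * k' - k - z))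
  (c' := (2%:R * k + z - 1) * (2%:R * (2%:R * (k + k' + (Y + 1)) - 1) - (Y + 1))
         - (Y + 1 + 2%:R * k') * (Y + 1 + 2%:R * k' + 2%:R * k - 1))
  (sbinomS L0 Y z) (sbinomS_pred Y z)).
ring.
Qed.

(** For s = 1 lowering has replaced the upper argument y by Y = y - 2. *)
Lemma raising_p0 Y z (y := Y + 2%:R) (K := k + k' + y) :
  - ((2%:R * K - 2%:R) * ((2%:R * k + z + 1) * - (y * sbinom (Y + 1) z)))
  + raised (k + 1) Y (fun z => y * (y - 1) * sbinom Y z) z
   = y * (y + 2%:R * k + 2%:R * k' - 1) * (y + 2%:R * k) * sbinom (Y + 1) z.
Proof.
rewrite /raised /K /y sbinom_pascal //.
have h1 := sbinomS L0 Y z; ring: h1.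
Qed.

Lemma raising_pp Y z (y := Y + 2%:R) (K := k + k' + y) :
  raised (k + 1) (Y + 1) (raised (k + 1) Y (fun z => y * (y - 1) * sbinom Y z)) z
  - 2%:R * (2%:R * K - 1) *
      raised (k + 1) (Y + 1) (fun z => (2%:R * k + z + 1) * - (y * sbinom (Y + 1) z)) z
  + 2%:R * K * (2%:R * K - 1) * ((2%:R * k + z) * (2%:R * k + z + 1) * sbinom y z)
   = (y + 2%:R * k + 2%:R * k' - 1) * (y + 2%:R * k + 2%:R * k') *
     (y + 2%:R * k) * (y + 2%:R * k + 1) * sbinom y z.
Proof.
rewrite /raised /= {5 6}/y sbinom_pascal2 !(sbinom_pascal L0 Y).
apply: (eq_by_relations
  (c := y * (y - 1) * (z - 2%:R * (y + 2%:R * k' - 1) + 1)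
        + 2%:R * (2%:R * K - 1) * y * (y + 2%:R * k' - 1 - (2%:R * k + 1) - z)
        + 2%:R * K * (2%:R * K - 1) * (z + 2%:R * (2%:R * k + 1) - 1))
  (c' := - ((y + 2%:R * k' + 2%:R * k) * (y + 2%:R * k' + 2%:R * k - 1)
            * (4%:R * k + z + y + 1)))
  (sbinomS L0 Y z) (sbinomS_pred Y z)).
rewrite /K /y; ring.
Qed.
End CoefficientIdentities.

(** * Coupling one more variable *)

Section CouplingStep.
Variables (L : fieldType) (W : lmodType L).
Hypothesis L0 : char0 L.
Implicit Types (al : L -> L) (e : L -> W) (j V : su11_index -> rop W) (k y z : L).

(** With these coefficients the derivatives of the e_j and of the powers of t
    cancel: this is the lowest weight vector of weight k + k' + y in the product
    of a Verma module of lowest weight k and the series in t. *)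
Definition coupled e y := series (sbinom y) e y.

Lemma supported_sbinom y : supported (sbinom y).
Proof. by move=> z; apply: sbinom_out. Qed.

Lemma supportedM al (q : L -> L) : supported al -> supported (fun z => q z * al z).
Proof. by move=> s z nz; rewrite s ?mulr0. Qed.

Lemma supported_pred al : supported al -> supported (fun z => al (z - 1)).
Proof. by move=> s z nz; apply: s => /isnatS. Qed.

Lemma supported_raised k' k y al : supported al -> supported (raised k' k y al).
Proof. by move=> s z nz; rewrite /raised !s ?mulr0 ?addr0 // => /isnatS. Qed.

Lemma series_scale (c : L) al e y : series (fun z => c * al z) e y = c *: series al e y.
Proof. by apply/funext => z; rewrite scalrfctE /series /= scalerA. Qed.

Lemma series_comb3 e y (c1 c2 c3 : L) al1 al2 al3 :
  c1 *: series al1 e y + c2 *: series al2 e y + c3 *: series al3 e y =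
  series (fun z => c1 * al1 z + c2 * al2 z + c3 * al3 z) e y.
Proof. by apply/funext => z; rewrite !addrfctE !scalrfctE /series /= !scalerA !scalerDl. Qed.

Variables (j V : su11_index -> rop W) (k k' : L) (e Dm D0 Dp : L -> W).
Hypotheses (ve : verma j k e) (vm : verma j (k - 1) Dm) (v0 : verma j k D0)
  (vp : verma j (k + 1) Dp) (dV : tensor_decomposition V k e Dm D0 Dp).

Let jt s := pointwise (j s) + power_op k' s.

Lemma coupled_lower y : jt Jplus (coupled e y) = 0.
Proof.
rewrite (series_lower _ _ ve (supported_sbinom y)); apply/funext => z.
rewrite /series sbinomS // addrK; set t := y - 1 - z.
have -> : - (y - (t + 1) + 1) * sbinom y t + (y - t) * sbinom y t = 0 by ring.
exact: scale0r.
Qed.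

Lemma coupled_weight y : jt Jzero (coupled e y) = (k + k' + y) *: coupled e y.
Proof. exact: (series_weight _ _ ve (supported_sbinom y)). Qed.

(** The part of V lowering the total weight by one; since the vector has lowest
    weight, the other two parts do not contribute to J_+. *)
Lemma V_lower_coupled y : pointwise (V Jplus) (coupled e y) =
  - (series (sbinom y) Dm y + series (fun z => y * sbinom (y - 1) z) D0 (y - 1)
     + series (fun z => y * (y - 1) * sbinom (y - 2%:R) z) Dp (y - 2%:R)).
Proof.
have [-> _ _] := series_decomposition y dV (supported_sbinom y).
congr (- (_ + _ + _)); apply: series_eq => z.
- by have := lowering_0 L0 (y - 1) z; rewrite subrK.
- have := sbinom_absorb2 L0 (y - 2%:R) z; rewrite subrK => ->.
  by congr (_ * _ * _); ring.
Qed.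

Lemma V_weight_coupled y : pointwise (V Jzero) (coupled e y) =
  - (series (fun z => sbinom y (z - 1)) Dm (y + 1)
     + series (fun z => - ((k + z) * sbinom y z)) D0 y
     + series (fun z => (2%:R * k + z + 1) * - (y * sbinom (y - 1) z)) Dp (y - 1)).
Proof.
have [_ -> _] := series_decomposition y dV (supported_sbinom y).
congr (- (_ + _ + _)); apply: series_eq => z.
have := lowering_0 L0 (y - 1) z; rewrite subrK => h.
by rewrite mulrAC -[(z + 1) * _]opprK h; ring.
Qed.

Lemma V_raise_coupled y : pointwise (V Jminus) (coupled e y) =
  - (series (fun z => sbinom y (z - 2%:R)) Dm (y + 2%:R)
     + series (fun z => - ((2%:R * k + z - 1) * sbinom y (z - 1))) D0 (y + 1)
     + series (fun z => (2%:R * k + z) * (2%:R * k + z + 1) * sbinom y z) Dp y).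
Proof. by have [_ _ ->] := series_decomposition y dV (supported_sbinom y). Qed.

Let raise_series k0 f al y (vf : verma j k0 f) (sal : supported al) :
  jt Jminus (series al f y) = series (raised k' k0 y al) f (y + 1).
Proof. exact: (series_raise k' y vf sal). Qed.

Let Vm_raise y : jt Jminus (pointwise (V Jplus) (coupled e y)) =
  - (series (raised k' (k - 1) y (sbinom y)) Dm (y + 1)
     + series (raised k' k (y - 1) (fun z => y * sbinom (y - 1) z)) D0 y
     + series (raised k' (k + 1) (y - 2%:R)
         (fun z => y * (y - 1) * sbinom (y - 2%:R) z)) Dp (y - 1)).
Proof.
have sb := supported_sbinom.
rewrite V_lower_coupled -[- _ as X in jt _ X]scaleN1r ropZ !ropDr scaleN1r.
rewrite (raise_series y vm (sb y)) (raise_series _ v0 (supportedM (fun=> y) (sb _))).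
rewrite (raise_series _ vp (supportedM (fun=> y * (y - 1)) (sb _))) subrK.
by have -> : y - 2%:R + 1 = y - 1 by ring.
Qed.

(** The combination on the left is, up to a scalar, the part of V that keeps the
    total weight: the descendants of the lower part cancel. *)
Lemma coupled_middle y (K := k + k' + y) :
  (2%:R * K - 2%:R) *: pointwise (V Jzero) (coupled e y)
    - jt Jminus (pointwise (V Jplus) (coupled e y)) =
  (y + 2%:R * k') *: coupled Dm (y + 1)
  + (k * (2%:R * K - 2%:R) + y * (y - 1 + 2%:R * k')) *: coupled D0 y
  + (y * (y + 2%:R * k + 2%:R * k' - 1) * (y + 2%:R * k)) *: coupled Dp (y - 1).
Proof.
rewrite V_weight_coupled Vm_raise.
set sm := series _ Dm _; set s0 := series _ D0 _; set sp := series _ Dp _.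
set rm := series _ Dm _; set r0 := series _ D0 _; set rp := series _ Dp _.
have Em : - (2%:R * K - 2%:R) *: sm + 1 *: rm + 0 *: rm = (y + 2%:R * k') *: coupled Dm (y + 1).
  rewrite series_comb3 -series_scale; apply: series_eq => z.
  by rewrite -(raising_m0 L0 k); rewrite /K; ring.
have E0 : - (2%:R * K - 2%:R) *: s0 + 1 *: r0 + 0 *: r0 =
    (k * (2%:R * K - 2%:R) + y * (y - 1 + 2%:R * k')) *: coupled D0 y.
  rewrite series_comb3 -series_scale; apply: series_eq => z.
  have := raising_00 L0 k k' (y - 1) z; rewrite subrK => <-; rewrite /K; ring.
have Ep : - (2%:R * K - 2%:R) *: sp + 1 *: rp + 0 *: rp =
    (y * (y + 2%:R * k + 2%:R * k' - 1) * (y + 2%:R * k)) *: coupled Dp (y - 1).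
  rewrite series_comb3 -series_scale; apply: series_eq => z.
  have := raising_p0 L0 k k' (y - 2%:R) z; rewrite subrK.
  have -> : y - 2%:R + 1 = y - 1 by ring.
  by move=> <-; rewrite /K; ring.
by rewrite -Em -E0 -Ep; linear_comb L (L -> W); ring.
Qed.

(** Likewise for the part that raises the total weight by one, where descendants
    of both other parts cancel. *)
Lemma coupled_upper y (K := k + k' + y) :
  jt Jminus (jt Jminus (pointwise (V Jplus) (coupled e y)))
  - (2%:R * (2%:R * K - 1)) *: jt Jminus (pointwise (V Jzero) (coupled e y))
  + (2%:R * K * (2%:R * K - 1)) *: pointwise (V Jminus) (coupled e y) =
  - (((y + 2%:R * k') * (y + 2%:R * k' + 1)) *: coupled Dm (y + 2%:R)
  + ((y + 2%:R * k + 2%:R * k' - 1) * (y + 2%:R * k') * (y + 2%:R * k)) *: coupled D0 (y + 1)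
  + ((y + 2%:R * k + 2%:R * k' - 1) * (y + 2%:R * k + 2%:R * k') *
     (y + 2%:R * k) * (y + 2%:R * k + 1)) *: coupled Dp y).
Proof.
have sb := supported_sbinom.
rewrite V_raise_coupled Vm_raise V_weight_coupled.
rewrite -![- _ as X in jt _ X]scaleN1r !ropZ !ropDr !scaleN1r.
rewrite (raise_series _ vm (supported_raised _ _ _ (sb _))).
rewrite (raise_series _ v0 (supported_raised _ _ _ (supportedM (fun=> y) (sb _)))).
rewrite (raise_series _ vp (supported_raised _ _ _ (supportedM (fun=> y * (y - 1)) (sb _)))).
rewrite (raise_series _ vm (supported_pred (sb _))).
rewrite (raise_series (al := fun z => - ((k + z) * sbinom y z)) _ v0); last first.
  by move=> z nz; rewrite sb // mulr0 oppr0.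
rewrite (raise_series (al := fun z => (2%:R * k + z + 1) * - (y * sbinom (y - 1) z)) _ vp); last first.
  by move=> z nz; rewrite sb // mulr0 oppr0 mulr0.
rewrite subrK; have -> : y + 1 + 1 = y + 2%:R by ring.
set um := series _ Dm _; set u0 := series _ D0 _; set up := series _ Dp _.
set sm := series _ Dm _; set s0 := series _ D0 _; set sp := series _ Dp _.
set rm := series _ Dm _; set r0 := series _ D0 _; set rp := series _ Dp _.
have Em : 1 *: um + - (2%:R * (2%:R * K - 1)) *: sm + (2%:R * K * (2%:R * K - 1)) *: rm =
    ((y + 2%:R * k') * (y + 2%:R * k' + 1)) *: coupled Dm (y + 2%:R).
  rewrite series_comb3 -series_scale; apply: series_eq => z.
  by rewrite -(raising_mp L0 k); rewrite /K; ring.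
have E0 : 1 *: u0 + - (2%:R * (2%:R * K - 1)) *: s0 + (2%:R * K * (2%:R * K - 1)) *: r0 =
    ((y + 2%:R * k + 2%:R * k' - 1) * (y + 2%:R * k') * (y + 2%:R * k)) *: coupled D0 (y + 1).
  rewrite series_comb3 -series_scale; apply: series_eq => z.
  have := raising_0p L0 k k' (y - 1) z; rewrite subrK => <-; rewrite /K; ring.
have Ep : 1 *: up + - (2%:R * (2%:R * K - 1)) *: sp + (2%:R * K * (2%:R * K - 1)) *: rp =
    ((y + 2%:R * k + 2%:R * k' - 1) * (y + 2%:R * k + 2%:R * k') *
     (y + 2%:R * k) * (y + 2%:R * k + 1)) *: coupled Dp y.
  rewrite series_comb3 -series_scale; apply: series_eq => z.
  have := raising_pp L0 k k' (y - 2%:R) z; rewrite subrK.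
  have -> : y - 2%:R + 1 = y - 1 by ring.
  by move=> <-; rewrite /K; ring.
by rewrite -Em -E0 -Ep; linear_comb L (L -> W); ring.
Qed.
End CouplingStep.

(** * Families generated by a lowest weight vector *)

Section LowestWeight.
Variables (L : fieldType) (W : lmodType L).
Hypothesis L0 : char0 L.
Implicit Types (e : L -> W) (J V : su11_index -> rop W) (k y z : L) (v w : W).

Lemma tripleP J : su11_triple J ->
  [/\ forall w, J Jplus (J Jminus w) = J Jminus (J Jplus w) + J Jzero w + J Jzero w,
      forall w, J Jzero (J Jplus w) = J Jplus (J Jzero w) - J Jplus w &
      forall w, J Jzero (J Jminus w) = J Jminus (J Jzero w) + J Jminus w].
Proof.
move=> [/subr_eqD r1 /subr_eqD r2 /subr_eqD r3]; split=> w.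
- by rewrite -ropM r1 mulr2n !ropD addrA.
- by rewrite -[X in _ = X - _]ropM r2 !ropD addrK.
- by rewrite -[X in _ = X + _]ropM r3 !ropD ropN subrK.
Qed.

Lemma verma_pred J k e n : verma J k e ->
  n%:R *: J Jminus (e (n%:R - 1)) = (n%:R * (2%:R * k + n%:R - 1)) *: e n%:R.
Proof.
move=> ve; case: n => [|n]; first by rewrite mul0r !scale0r.
have [_ _ E] := ve n; rewrite -[n.+1%:R]natr1 addrK E scalerA; congr (_ *: _); ring.
Qed.

Lemma verma_pred2 J k e n : verma J k e ->
  (n%:R * (n%:R - 1)) *: J Jminus (e (n%:R - 2%:R)) =
  (n%:R * (n%:R - 1) * (2%:R * k + n%:R - 2%:R)) *: e (n%:R - 1).
Proof.
move=> ve; case: n => [|n]; first by rewrite !mul0r !scale0r.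
rewrite -[n.+1%:R]natr1 addrK.
have -> : n%:R + 1 - 2%:R = n%:R - 1 :> L by ring.
rewrite -scalerA (verma_pred n ve) scalerA; congr (_ *: _); ring.
Qed.

Lemma casimir_verma J k e n : verma J k e ->
  triple_casimir J (e n%:R) = (k * (k - 1)) *: e n%:R.
Proof.
move=> ve; have [E1 E2 _] := ve n.
rewrite /triple_casimir !ropB !ropM E1 !E2 !ropZ E2 (verma_pred n ve).
linear_comb L W; ring.
Qed.

(** The last term is the part of V that keeps the total weight, as in
    coupled_middle: it alone carries the Casimir away from v. *)
Lemma casimir_complement J V k v :
  J Jplus v = 0 -> J Jzero v = k *: v -> J Jzero (V Jzero v) = V Jzero (J Jzero v) ->
  triple_casimir (fun s => J s - V s) v =
  (k * (k - 1)) *: v + triple_casimir V v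
  - ((2%:R * k - 2%:R) *: V Jzero v - J Jminus (V Jplus v)).
Proof.
move=> lo we co; rewrite /triple_casimir !ropB !ropM !ropB lo we sub0r !ropBr !ropNr !ropZ co we !ropZ.
linear_comb L W; ring.
Qed.

(** The images of v under the powers of the raising operator, divided by rising
    factorials of 2 k to have the normalisation of verma. *)
Definition lowest_family (U : rop W) k v : L -> W :=
  ext0 (fun n => (\prod_(i < n) (2%:R * k + i%:R)^-1) *: (U ^+ n) v).

Lemma lowest_familyE U k v n :
  lowest_family U k v n%:R = (\prod_(i < n) (2%:R * k + i%:R)^-1) *: (U ^+ n) v.
Proof. exact: ext0E. Qed.

Lemma lowest_family0 U k v : lowest_family U k v 0 = v.
Proof. by rewrite -[X in lowest_family _ _ _ X](mulr0n 1) lowest_familyE big_ord0 scale1r. Qed.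

Lemma lowest_family_comm (U X : rop W) k v n : GRing.comm X U ->
  X (lowest_family U k v n%:R) = lowest_family U k (X v) n%:R.
Proof.
by move=> c; rewrite !lowest_familyE ropZ -!ropM (commrX n c).
Qed.

Lemma lowest_family_verma J k v : su11_triple J -> J Jplus v = 0 -> J Jzero v = k *: v ->
  (forall n : nat, 2%:R * k + n%:R != 0) -> verma J k (lowest_family (J Jminus) k v).
Proof.
move=> /tripleP[r1 r2 r3] lo we nz.
pose e := lowest_family (J Jminus) k v.
have up n : J Jminus (e n%:R) = (2%:R * k + n%:R) *: e (n%:R + 1).
  rewrite natr1 /e !lowest_familyE big_ord_recr /= !ropZ scalerA.
  by rewrite mulrCA mulfV ?nz // mulr1 exprSr ropM.
have upE n : e (n%:R + 1) = (2%:R * k + n%:R)^-1 *: J Jminus (e n%:R).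
  by rewrite up scalerA mulVf ?nz // scale1r.
have wt n : J Jzero (e n%:R) = (k + n%:R) *: e n%:R.
  elim: n => [|n IH]; first by rewrite mulr0n /e lowest_family0 we addr0.
  rewrite -natr1 upE ropZ r3 IH ropZ; linear_comb L W; ring.
have dn n : J Jplus (e n%:R) = n%:R *: e (n%:R - 1).
  elim: n => [|n IH]; first by rewrite mulr0n /e lowest_family0 lo scale0r.
  have E : n%:R *: J Jminus (e (n%:R - 1)) = (n%:R * (2%:R * k + n%:R - 1)) *: e n%:R.
    case: (n) => [|l]; first by rewrite mul0r !scale0r.
    rewrite -[l.+1%:R]natr1 addrK up scalerA; congr (_ *: _); ring.
  rewrite -natr1 addrK upE ropZ r1 IH ropZ E wt.
  have h := nz n; linear_comb L W; field; exact: h.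
by move=> n; split; [apply: dn | apply: wt | apply: up].
Qed.

(** The commutators of V with the raising operator J_- propagate the
    decomposition from e_n to e_(n+1), so the lowest weight vector suffices. *)
Lemma decomposition_extend J V k e Dm D0 Dp :
  (forall w, V Jplus (J Jminus w) = J Jminus (V Jplus w) + V Jzero w + V Jzero w) ->
  (forall w, V Jzero (J Jminus w) = J Jminus (V Jzero w) + V Jminus w) ->
  (forall w, V Jminus (J Jminus w) = J Jminus (V Jminus w)) ->
  verma J k e -> verma J (k - 1) Dm -> verma J k D0 -> verma J (k + 1) Dp ->
  (forall n : nat, 2%:R * k + n%:R != 0) ->
  V Jplus (e 0) = - Dm 0 ->
  V Jzero (e 0) = - (Dm 1 - k *: D0 0) ->
  V Jminus (e 0) = - (Dm 2%:R - (2%:R * k) *: D0 1 + (2%:R * k * (2%:R * k + 1)) *: Dp 0) ->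
  tensor_decomposition V k e Dm D0 Dp.
Proof.
move=> c1 c2 c3 ve vm v0 vp nz b1 b2 b3; elim=> [|n [IH1 IH2 IH3]].
  by split; rewrite /= mulr0n ?mul0r ?add0r ?addr0 ?scale0r ?subr0 ?addr0.
have upE : e (n%:R + 1) = (2%:R * k + n%:R)^-1 *: J Jminus (e n%:R).
  by have [_ _ ->] := ve n; rewrite scalerA mulVf ?nz // scale1r.
rewrite /= -natr1 addrK.
have eS : n.+1%:R = n%:R + 1 :> L by rewrite natr1.
have eSS : n.+2%:R = n%:R + 2%:R :> L by rewrite -natrD addn2.
have [_ _ um] := vm n; have [_ _ u0] := v0 n; have [_ _ up] := vp n.
have [_ _ um1] := vm n.+1; have [_ _ um2] := vm n.+2; have [_ _ u01] := v0 n.+1.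
rewrite ?eS ?eSS in um1 um2 u01.
have p0 := verma_pred n v0; have pp := verma_pred n vp; have pp2 := verma_pred2 n vp.
have a2 : n%:R + 1 + 1 = n%:R + 2%:R :> L by ring.
have a3 : n%:R + 1 - 2%:R = n%:R - 1 :> L by ring.
rewrite a2 in um1 u01; rewrite a2 a3.
have a4 : n%:R + 1 + 2%:R = n%:R + 2%:R + 1 :> L by ring.
have h := nz n; rewrite ?a4; split; rewrite upE ropZ.
- rewrite c1 IH1 IH2 !(ropNr, ropDr) !ropZ um p0 pp2.
  linear_comb L W; field; exact: h.
- rewrite c2 IH2 IH3 !(ropNr, ropDr) !ropZ um1 u0 [n%:R * (2%:R * k + n%:R)]mulrC -!scalerA pp.
  linear_comb L W; field; exact: h.
- rewrite c3 IH3 !(ropNr, ropDr) !ropZ um2 u01 up.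
  linear_comb L W; field; exact: h.
Qed.

Lemma decomposition_self J k e : verma J k e ->
  tensor_decomposition J k e (fun=> 0) e (fun=> 0).
Proof.
move=> ve n; have [E1 E2 E3] := ve n; split; rewrite ?E1 ?E2 ?E3; linear_comb L W; ring.
Qed.

Lemma verma_sum J k (I : Type) (r : seq I) (P : pred I) (c : I -> L) (f : I -> L -> W) :
  (forall i, P i -> verma J k (f i)) ->
  verma J k (fun z => \sum_(i <- r | P i) c i *: f i z).
Proof.
move=> vf n; split; rewrite rop_sumr scaler_sumr; apply: eq_bigr => i Pi;
  have [E1 E2 E3] := vf i Pi n; rewrite ropZ ?E1 ?E2 ?E3 !scalerA mulrC //.
Qed.

End LowestWeight.

Section Gamma.
Variable L : fieldType.
Hypothesis L0 : char0 L.

Definition isint (z : L) : Prop := exists k : int, z = k%:~R.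

Lemma isintD (z : L) (k : int) : isint (z + k%:~R) <-> isint z.
Proof.
split=> [[l e]|[l ->]]; last by exists (l + k); rewrite intrD.
by exists (l - k); rewrite intrB -e addrK.
Qed.

Lemma not_isint_neq0 (z : L) (k : int) : ~ isint z -> z + k%:~R != 0.
Proof.
move=> nz; apply/eqP => e; apply: nz; exists (- k).
by rewrite mulrNz; apply/eqP; rewrite -addr_eq0 e.
Qed.

Lemma intr_inj0 : injective (fun k : int => k%:~R : L).
Proof.
move=> k l /eqP; rewrite -subr_eq0 -intrB => /eqP e; apply/eqP; rewrite -subr_eq0.
case: (k - l) e => [[|n]|n] //= /eqP.
- by rewrite -pmulrn (negPf (L0 n)).
- by rewrite NegzE mulrNz oppr_eq0 -pmulrn (negPf (L0 n)).
Qed.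

(** On a class modulo the integers that avoids the integers, the recursion can be
    solved in both directions from a chosen representative, since no factor
    vanishes. *)
Lemma gamma_exists : exists G : L -> L, (forall z, G z != 0) /\
  (forall z, ~ isint z -> G (z + 1) = z * G z).
Proof.
pose C (z w : L) : Prop := isint (z - w).
have Cne z : exists w, C z w by exists z; exists 0; rewrite subrr.
pose rep z := projT1 (cid (Cne z)).
have repP z : isint (z - rep z) := projT2 (cid (Cne z)).
have repS z : rep (z + 1) = rep z.
  (* The two classes are equal as predicates, so the choice from both is the same. *)
  have eC : C (z + 1) = C z.
    apply/funext => w; apply/propext; rewrite /C addrAC; exact: (isintD _ 1).
  by rewrite /rep; move: (Cne (z + 1)); rewrite eC => h; rewrite (Prop_irrelevance h (Cne z)).
pose ix z : int := projT1 (cid (repP z)).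
have ixP z : z = rep z + (ix z)%:~R.
  by rewrite -(projT2 (cid (repP z))) addrC subrK.
have ixS z : ix (z + 1) = ix z + 1.
  by apply: intr_inj0; have := ixP (z + 1); rewrite repS {1}(ixP z) -addrA => /addrI <-; rewrite intrD.
pose g (r : L) (k : int) : L := match k with
  | Posz n => \prod_(i < n) (r + i%:R)
  | Negz n => \prod_(i < n.+1) (r - i.+1%:R)^-1 end.
have gS r k : ~ isint r -> g r (k + 1) = (r + k%:~R) * g r k.
  move=> nr; case: k => n.
    have -> : Posz n + 1 = Posz n.+1 by lia.
    by rewrite /g big_ord_recr /= mulrC.
  case: n => [|n].
    have -> : Negz 0 + 1 = Posz 0 by [].
    rewrite /g big_ord0 big_ord1 NegzE mulrNz -pmulrn mulfV //.
    by have := not_isint_neq0 (- 1%:Z) nr; rewrite mulrNz.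
  have -> : Negz n.+1 + 1 = Negz n by rewrite !NegzE; lia.
  rewrite [in RHS]/g [in RHS]big_ord_recr /= mulrC -mulrA NegzE mulrNz -pmulrn mulVf ?mulr1 //.
  by have := not_isint_neq0 (- n.+2%:Z) nr; rewrite mulrNz.
exists (fun z => if pselect (isint z) then 1 else g (rep z) (ix z)); split=> z.
  case: (pselect (isint z)) => [_|nz] /=; first exact: oner_neq0.
  have nr : ~ isint (rep z) by move=> h; apply: nz; rewrite (ixP z); apply/isintD.
  case: (ix z) => n; rewrite /g; apply/prodf_neq0 => i _; last rewrite invr_neq0 //.
    exact: (not_isint_neq0 i nr).
  by have := not_isint_neq0 (- i.+1%:Z) nr; rewrite mulrNz.
move=> nz; have nr : ~ isint (rep z) by move=> h; apply: nz; rewrite (ixP z); apply/isintD.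
case: (pselect (isint (z + 1))) => [/(isintD _ 1)//|?]; case: (pselect (isint z)) => //= ?.
by rewrite repS ixS gS // -ixP.
Qed.
End Gamma.

(** * Coefficients of paths of shifts *)

Definition tminus : 'I_3 := @Ordinal 3 0 isT.
Definition tzero : 'I_3 := @Ordinal 3 1 isT.
Definition tplus : 'I_3 := @Ordinal 3 2 isT.

Lemma sum_trit (V : nmodType) (f : 'I_3 -> V) :
  \sum_s f s = f tminus + f tzero + f tplus.
Proof.
rewrite !big_ord_recl big_ord0 addr0 addrA.
by congr (_ + _ + _); congr (f _); apply: val_inj.
Qed.

Lemma trit_ind (P : 'I_3 -> Prop) : P tminus -> P tzero -> P tplus -> forall s, P s.
Proof.
move=> p0 p1 p2 [[|[|[|//]]] i]; [move: p0 | move: p1 | move: p2];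
  by congr P; apply: val_inj.
Qed.

Lemma trit_valE (L : pzRingType) : ((trit_val tminus)%:~R = -1 :> L) *
  ((trit_val tzero)%:~R = 0 :> L) * ((trit_val tplus)%:~R = 1 :> L).
Proof. by []. Qed.

Section Trits.
Variable r : nat.
Implicit Types (nu : trits r) (s : 'I_3).

Definition ext_trit nu s : trits r.+1 :=
  [ffun i => if insub (val i) is Some k then nu k else s].

Definition last_trit nu : 'I_3 := odflt tzero (omap nu (insub r.-1)).

Lemma trit_at_out nu i : (r < i)%N -> trit_at nu i = 0.
Proof. by case: i => // i ri; rewrite /trit_at insubF //; lia. Qed.

Lemma trit_at_ext nu s i :
  trit_at (ext_trit nu s) i = if i == r.+1 then trit_val s else trit_at nu i.
Proof.
case: i => [|i] //; rewrite eqSS /trit_at.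
have [ir|ri|->] := ltngtP i r.
- have ir' : (i < r.+1)%N by lia.
  by rewrite (insubT (fun i => i < r.+1)%N ir') ffunE /= (insubT (fun i => i < r)%N ir).
- by rewrite !insubF //; lia.
- by rewrite (insubT (fun i => i < r.+1)%N (ltnSn r)) ffunE /= insubF ?ltnn.
Qed.

Lemma trit_at_last nu : trit_at nu r = trit_val (last_trit nu).
Proof.
rewrite /last_trit; case: r nu => [|r'] nu //=; first by rewrite insubF.
by rewrite (insubT (fun i => i < r'.+1)%N (ltnSn r')).
Qed.

Lemma sum_ext_trit (V : nmodType) (f : trits r.+1 -> V) :
  \sum_nu f nu = \sum_nu \sum_s f (ext_trit nu s).
Proof.
rewrite pair_bigA /= (reindex (fun p : trits r * 'I_3 => ext_trit p.1 p.2)) //=.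
apply: onW_bij; exists (fun nu : trits r.+1 =>
    ([ffun i => nu (widen_ord (leqnSn r) i)], nu ord_max)).
- move=> [nu s] /=; congr (_, _); last by rewrite ffunE /= insubF ?ltnn.
  by apply/ffunP => i; rewrite !ffunE /= valK.
- move=> nu; apply/ffunP => i; rewrite ffunE /=.
  case: insubP => [k _ ki|]; first by rewrite ffunE; congr (nu _); apply: val_inj.
  by rewrite -leqNgt => ri; congr (nu _); apply: val_inj => /=; have := ltn_ord i; lia.
Qed.

Lemma num_zerosE nu : num_zeros nu = (\sum_(i < r) (trit_val (nu i) == 0%R))%N.
Proof.
rewrite /num_zeros -sum1dep_card big_mkcond /=.
by apply: eq_bigr => i _; case: eqP.
Qed.

End Trits.

Lemma num_zeros_ext r (nu : trits r) s :
  num_zeros (ext_trit nu s) = (num_zeros nu + (trit_val s == 0%R))%N.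
Proof.
rewrite !num_zerosE big_ord_recr /= ffunE /= insubF ?ltnn //; congr (_ + _)%N.
by apply: eq_bigr => i _; rewrite ffunE /= valK.
Qed.

Lemma last_trit_ext r (nu : trits r) s : last_trit (ext_trit nu s) = s.
Proof.
rewrite /last_trit /= (insubT (fun i => i < r.+1)%N (ltnSn r)) /= ffunE /=.
by rewrite insubF ?ltnn.
Qed.

Lemma trits0 (nu nu' : trits 0) : nu = nu'.
Proof. by apply/ffunP => -[]. Qed.

Lemma sum_trits0 (V : nmodType) (f : trits 0 -> V) (nu : trits 0) : \sum_nu f nu = f nu.
Proof.
rewrite (bigD1 nu) //= big1 ?addr0 // => nu' /eqP[]; exact: trits0.
Qed.

Section Coefficients.
Variable L : fieldType.
Hypothesis L0 : char0 L.
Implicit Types (x b : nat -> L).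

(** The coefficient G_nu without its last numerator B, for a path of shifts that
    can still be continued. *)
Definition pathcoef x b r (nu : trits r) : L :=
  2%:R ^+ num_zeros nu *
    (\prod_(0 <= i < r)
       Bcoef (trit_at nu i) (trit_at nu i.+1) (x i) (b i) (x i.+1) (b i.+1)) /
    (\prod_(1 <= i < r.+1) bcoef (trit_at nu i) (x i) (b i)).

Lemma pathcoef0 x b (nu : trits 0) : pathcoef x b nu = 1.
Proof.
rewrite /pathcoef !big_geq // /num_zeros (_ : [set _ | _] = set0) ?cards0 ?expr0 ?divr1 ?mulr1 //.
by apply/setP => -[].
Qed.

Lemma pathcoef_ext x b r (nu : trits r) s :
  pathcoef x b (ext_trit nu s) =
  pathcoef x b nu *
   (Bcoef (trit_at nu r) (trit_val s) (x r) (b r) (x r.+1) (b r.+1)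
    * (2%:R ^+ (trit_val s == 0) / bcoef (trit_val s) (x r.+1) (b r.+1))).
Proof.
rewrite /pathcoef num_zeros_ext exprD (@big_nat_recr _ _ _ r 0) // (@big_nat_recr _ _ _ r.+1 1) //.
rewrite (eq_big_nat _ _ (F2 := fun i =>
  Bcoef (trit_at nu i) (trit_at nu i.+1) (x i) (b i) (x i.+1) (b i.+1))); last first.
  by move=> i /andP[_ ir]; rewrite !trit_at_ext eqSS !(@ltn_eqF i) // ltnW.
rewrite [X in _ / (X * _)](eq_big_nat _ _ (F2 := fun i => bcoef (trit_at nu i) (x i) (b i))); last first.
  by move=> i /andP[_ ir]; rewrite trit_at_ext (@ltn_eqF i).
rewrite !trit_at_ext eqxx (@ltn_eqF r) // invfM.
by rewrite /=; move: (2%:R ^+ _) (2%:R ^+ _) => c1 c2; ring.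
Qed.

Lemma two_neq0 : 2%:R != 0 :> L. Proof. exact: L0. Qed.

(** Summing over the shift of an inner variable contracts two steps of a path
    into one. *)
Lemma transfer_identity (x0 b0 x1 b1 x2 b2 : L) t : ~ isint (2%:R * x1 + b1) ->
  \sum_s Bcoef 0 (trit_val s) x0 b0 x1 b1 *
    (2%:R ^+ (trit_val s == 0) / bcoef (trit_val s) x1 b1
     * Bcoef (trit_val s) (trit_val t) x1 b1 x2 b2) =
  Bcoef 0 (trit_val t) x0 b0 x2 b2.
Proof.
move=> h; have h2 := two_neq0.
have n0 : 2%:R * x1 + b1 != 0 by have := not_isint_neq0 0 h; rewrite addr0.
have n1 : 2%:R * x1 + b1 + 1 != 0 by exact: (not_isint_neq0 1 h).
have n2 : 2%:R * x1 + b1 - 1 != 0 by exact: (not_isint_neq0 (-1) h).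
have e1 : 2%:R * (- x1 - b1) + b1 + 1 = - (2%:R * x1 + b1 - 1) by ring.
have e0 : 2%:R * (- x1 - b1) + b1 = - (2%:R * x1 + b1) by ring.
rewrite sum_trit; elim/trit_ind: t;
  rewrite /Bcoef /bcoef /reflect_var /trit_val /= e1 e0; field; by rewrite !oppr_eq0 h2 n0 n1 n2.
Qed.

Lemma path_sum x b r t : (forall i, (i < r)%N -> ~ isint (2%:R * x i.+1 + b i.+1)) ->
  \sum_(nu : trits r) pathcoef x b nu *
    Bcoef (trit_at nu r) (trit_val t) (x r) (b r) (x r.+1) (b r.+1) =
  Bcoef 0 (trit_val t) (x 0) (b 0) (x r.+1) (b r.+1).
Proof.
elim: r t => [|r IH] t gx; first by rewrite (sum_trits0 _ [ffun=> tzero]) pathcoef0 mul1r.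
rewrite -(transfer_identity _ _ _ _ _ (gx r (ltnSn r))) sum_ext_trit exchange_big.
apply: eq_bigr => s _; rewrite -IH => [|i ir]; last by apply: gx; lia.
rewrite mulr_suml; apply: eq_bigr => nu _.
by rewrite pathcoef_ext trit_at_ext eqxx -!mulrA.
Qed.

(** Together with path_sum this identifies the sum of all the G_nu, the one of
    nu = 0 included, in terms of the constants of the operators. *)
Lemma kappa_identity (x0 b0 x1 b1 : L) :
  Bcoef 0 0 x0 b0 x1 b1 + kappa 0 (b1 - b0 - 1) =
  kappa x0 b0 + kappa x1 b1.
Proof. by rewrite /Bcoef /reflect_var /kappa /=; field; apply: two_neq0. Qed.

Section Gauge.
Variable G : L -> L.
Hypothesis GS : forall z, ~ isint z -> G (z + 1) = z * G z.

(** The factors in V_lower_coupled, coupled_middle and coupled_upper, for an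
    inner shift s and a total shift t. *)
Definition stepcoef (k k' y : L) (s t : 'I_3) : L :=
  match val s, val t with
  | 0%N, 0%N => 1
  | 1%N, 0%N => y
  | _, 0%N => y * (y - 1)
  | 0%N, 1%N => y + 2%:R * k'
  | 1%N, 1%N => k * (2%:R * (k + k' + y) - 2%:R) + y * (y - 1 + 2%:R * k')
  | _, 1%N => y * (y + 2%:R * k + 2%:R * k' - 1) * (y + 2%:R * k)
  | 0%N, _ => (y + 2%:R * k') * (y + 2%:R * k' + 1)
  | 1%N, _ => (y + 2%:R * k + 2%:R * k' - 1) * (y + 2%:R * k') * (y + 2%:R * k)
  | _, _ => (y + 2%:R * k + 2%:R * k' - 1) * (y + 2%:R * k + 2%:R * k') *
     (y + 2%:R * k) * (y + 2%:R * k + 1)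
  end.

(** The values of G at the two ends differ by as many factors x + x' + b + i as
    the total shift requires; these complete stepcoef to B.  For s = t = 0 the
    two values coincide, so that nothing is assumed of x + x' + b. *)
Lemma gauge_identity (x b x' b' : L) s t :
  (s == tzero) && (t == tzero) \/ ~ isint (x + x' + b) ->
  Bcoef (trit_val s) (trit_val t) x b x' b' *
     G (x + (trit_val s)%:~R + (x' + (trit_val t)%:~R) + b + 1) =
  G (x + x' + b + 1) * stepcoef (x + (b + 1) / 2%:R) ((b' - b) / 2%:R) (x' - x) s t.
Proof.
have h2 := two_neq0; set S := x + x' + b => hS.
case: hS => [/andP[/eqP-> /eqP->]|hS].
  rewrite /= !addr0 -/S mulrC; congr (_ * _).
  by rewrite /Bcoef /stepcoef /reflect_var /trit_val /=; field.
have G0 : G (S + 1) = S * G S by apply: GS.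
have G1 : G (S + 2%:R) = (S + 1) * G (S + 1).
  have -> : S + 2%:R = S + 1 + 1 by ring.
  by apply: GS => /(isintD _ 1).
have G2 : G (S + 3%:R) = (S + 2%:R) * G (S + 2%:R).
  have -> : S + 3%:R = S + 2%:R + 1 by ring.
  by apply: GS => /(isintD _ 2).
have Gm : G S = (S - 1) * G (S - 1).
  by rewrite -{1}[S](subrK 1); apply: GS => /(isintD _ (-1)).
(* The factor relating G at the shifted point to G (S + 1) belongs to either side,
   according to the sign of s + t; E and E' are the two cases. *)
have E c d : x + (trit_val s)%:~R + (x' + (trit_val t)%:~R) + b + 1 = c ->
    G (S + 1) = d * G c ->
    Bcoef (trit_val s) (trit_val t) x b x' b' =
    d * stepcoef (x + (b + 1) / 2%:R) ((b' - b) / 2%:R) (x' - x) s t ->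
    Bcoef (trit_val s) (trit_val t) x b x' b' *
     G (x + (trit_val s)%:~R + (x' + (trit_val t)%:~R) + b + 1) =
    G (S + 1) * stepcoef (x + (b + 1) / 2%:R) ((b' - b) / 2%:R) (x' - x) s t.
  by move=> -> -> ->; ring.
have E' c d : x + (trit_val s)%:~R + (x' + (trit_val t)%:~R) + b + 1 = c ->
    G c = d * G (S + 1) ->
    d * Bcoef (trit_val s) (trit_val t) x b x' b' =
    stepcoef (x + (b + 1) / 2%:R) ((b' - b) / 2%:R) (x' - x) s t ->
    Bcoef (trit_val s) (trit_val t) x b x' b' *
     G (x + (trit_val s)%:~R + (x' + (trit_val t)%:~R) + b + 1) =
    G (S + 1) * stepcoef (x + (b + 1) / 2%:R) ((b' - b) / 2%:R) (x' - x) s t.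
  by move=> -> -> <-; ring.
elim/trit_ind: s E E'; elim/trit_ind: t => E E';
  [ apply: (E (S - 1) (S * (S - 1))) | apply: (E S S) | apply: (E (S + 1) 1)
  | apply: (E S S) | apply: (E (S + 1) 1) | apply: (E' (S + 2%:R) (S + 1))
  | apply: (E (S + 1) 1) | apply: (E' (S + 2%:R) (S + 1))
  | apply: (E' (S + 3%:R) ((S + 2%:R) * (S + 1))) ];
  rewrite ?mul1r ?G2 ?G1 ?G0 ?Gm /S /Bcoef /stepcoef /reflect_var /trit_val /=; try ring;
  field; exact: h2.
Qed.
End Gauge.
End Coefficients.

(** * Coupled vectors attached to points *)

Section Shifts.
Variable L : fieldType.
Hypothesis L0 : char0 L.
Variable b : nat -> L.
Implicit Types (x : nat -> L).

(** The lowest weight of the first i + 1 factors on the vector of x; the Casimir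
    eigenvalue k (k - 1) is kappa (x i) (b i). *)
Definition kweight x i : L := x i + (b i + 1) / 2%:R.

(** Lowest weights of the single factors, chosen such that adding
    y = x_(i+1) - x_i leads from one kweight to the next (kweight_step). *)
Definition kfactor i : L :=
  if i is i'.+1 then (b i - b i') / 2%:R else (b 0%N + 1) / 2%:R.

Definition shifted o r (nu : trits r) x : nat -> L :=
  fun i => x i + (trit_at nu (i - o))%:~R.

(** At such points, and at all their integral shifts, the denominators b_i do not
    vanish and the recursion of G applies. *)
Definition generic m x : Prop := x 0%N = 0 /\
  (forall i, (i < m)%N -> ~ isint (2%:R * x i.+1 + b i.+1) /\
    ~ isint (x i + x i.+1 + b i)).

(** The components of J^[o+1] on the vector of x after r couplings: the sum over
    the paths of shifts of x_(o+1), ..., x_(o+r) whose last shift is s. *)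
Definition pathsum o r (V : lmodType L) (F : (nat -> L) -> V) (s : 'I_3) x : V :=
  \sum_(nu : trits r | last_trit nu == s)
     pathcoef (raise o x) (raise o b) nu *: F (shifted o nu x).

(** The paths with one more shift t, before division by its denominator b; for
    t = 0 the coefficients are the G_nu. *)
Definition gsum o r (V : lmodType L) (F : (nat -> L) -> V) (t : 'I_3) x : V :=
  \sum_(nu : trits r)
    (pathcoef (raise o x) (raise o b) nu *
     Bcoef (trit_at nu r) (trit_val t) (x (o + r)%N) (b (o + r)%N)
       (x (o + r).+1) (b (o + r).+1)) *: F (shifted o (ext_trit nu t) x).

Lemma shifted0 o r (nu : trits r) x i : (i <= o)%N -> shifted o nu x i = x i.
Proof. by rewrite -subn_eq0 /shifted => /eqP ->; rewrite addr0. Qed.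

Lemma shifted_out o r (nu : trits r) x i : (o + r < i)%N -> shifted o nu x i = x i.
Proof. by move=> h; rewrite /shifted trit_at_out ?addr0 //; lia. Qed.

Lemma shifted_ext o r (nu : trits r) s x i :
  shifted o (ext_trit nu s) x i =
  if i == (o + r).+1 then x i + (trit_val s)%:~R else shifted o nu x i.
Proof.
rewrite /shifted trit_at_ext; have -> : (i - o == r.+1)%N = (i == (o + r).+1) by lia.
by case: eqP.
Qed.

Lemma shifted_inner o r (nu : trits r) x i : (o + r < i)%N ->
  shifted o (ext_trit nu tzero) x i = x i.
Proof.
by move=> h; rewrite shifted_ext shifted_out //; case: eqP; rewrite ?trit_valE ?addr0.
Qed.

Lemma shifted_last o r (nu : trits r) x :
  shifted o nu x (o + r)%N = x (o + r)%N + (trit_val (last_trit nu))%:~R.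
Proof. by rewrite /shifted addKn trit_at_last. Qed.

Lemma generic_shifted m o r (nu : trits r) x : generic m x -> generic m (shifted o nu x).
Proof.
move=> [x0 gx]; split=> [|i im]; first by rewrite shifted0.
have [g1 g2] := gx i im; rewrite /shifted; split.
- apply: contra_not g1 => /(isintD _ (- (trit_at nu (i.+1 - o) *+ 2))).
  by congr isint; rewrite rmorphN rmorphMn /=; ring.
- apply: contra_not g2 => /(isintD _ (- (trit_at nu (i - o) + trit_at nu (i.+1 - o)))).
  by congr isint; rewrite rmorphN rmorphD /=; ring.
Qed.

Lemma genericW m m' x : (m' <= m)%N -> generic m x -> generic m' x.
Proof. by move=> mm [x0 g]; split=> // i im; apply: g; lia. Qed.

Lemma pathsum_ext o r (V : lmodType L) (F : (nat -> L) -> V) t x :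
  pathsum o r.+1 F t x = (2%:R ^+ (trit_val t == 0) / bcoef (trit_val t) (x (o + r).+1) (b (o + r).+1))
     *: gsum o r F t x.
Proof.
rewrite /pathsum /gsum big_mkcond sum_ext_trit scaler_sumr; apply: eq_bigr => nu _.
rewrite (bigD1 t) //= last_trit_ext eqxx big1 => [|s st]; last first.
  by rewrite last_trit_ext (negPf st).
rewrite addr0 pathcoef_ext scalerA /raise addnS; congr (_ *: _).
by move: (2%:R ^+ _) => c; ring.
Qed.

Lemma pathsum0 o (V : lmodType L) (F : (nat -> L) -> V) t x :
  pathsum o 0 F t x = if t == tzero then F x else 0.
Proof.
have nu : trits 0 := [ffun=> tzero].
have lt : last_trit nu = tzero by rewrite /last_trit insubF.
rewrite /pathsum big_mkcond (sum_trits0 _ nu) lt eq_sym; case: eqP => // _.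
rewrite pathcoef0 scale1r; congr F; apply/funext => i.
by rewrite /shifted; case: (i - o)%N => [|j]; rewrite ?addr0 // trit_at_out ?addr0.
Qed.

End Shifts.

Section Model.
Variables (L : fieldType) (b : nat -> L) (G : L -> L).
Hypothesis L0 : char0 L.
Hypothesis G_neq0 : forall z, G z != 0.
Hypothesis GS : forall z, ~ isint z -> G (z + 1) = z * G z.
Implicit Types (x : nat -> L).
Local Notation kw := (kweight b).

(** After m + 1 factors, each generic point x carries a Verma module with basis
    e x 0, e x 1, ... on which the Casimirs of intervals act by the coefficients
    of the difference operators.  The decomposition of J^[o+1] for o <= m is the
    part of the induction hypothesis that yields the inner intervals ending at
    the next factor. *)
Record model m (W : lmodType L) (J : nat -> su11_index -> rop W)
    (e : (nat -> L) -> L -> W) : Prop := Model {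
  model_comm : commuting_triples m.+1 J;
  model_local : forall x x', (forall i, (i <= m)%N -> x i = x' i) -> e x = e x';
  model_verma : forall x, generic b m x -> verma (range_total J 0 m.+1) (kw x m) (e x);
  model_neq0 : forall x, generic b m x -> e x 0 != 0;
  model_initial : forall x q (n : nat), generic b m x -> (q <= m)%N ->
    triple_casimir (range_total J 0 q.+1) (e x n%:R) = (kw x q * (kw x q - 1)) *: e x n%:R;
  model_inner : forall x o r (n : nat), generic b m x -> (o + r < m)%N ->
    triple_casimir (range_total J o.+1 (o + r).+2) (e x n%:R) =
    (kw x o * (kw x o - 1) + kw x (o + r).+1 * (kw x (o + r).+1 - 1)) *: e x n%:R
    - gsum b o r (fun x => e x n%:R) tzero x;
  model_decomposition : forall x o r, generic b m x -> (o + r)%N = m ->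
    tensor_decomposition (range_total J 0 o.+1) (kw x m) (e x)
      (fun z => pathsum b o r (fun x => e x z) tminus x)
      (fun z => pathsum b o r (fun x => e x z) tzero x)
      (fun z => pathsum b o r (fun x => e x z) tplus x) }.

Lemma pathsum_verma (W : lmodType L) (j : su11_index -> rop W) (f : (nat -> L) -> L -> W)
    o r m s x : (o + r)%N = m ->
  (forall u, generic b m u -> verma j (kw u m) (f u)) -> generic b m x ->
  verma j (kw x m + (trit_val s)%:~R) (fun z => pathsum b o r (fun u => f u z) s x).
Proof.
move=> orm vf gx; rewrite /pathsum; apply: verma_sum => nu /eqP <-.
have := vf _ (generic_shifted o nu gx).
by rewrite /kweight -orm shifted_last addrAC.
Qed.

Section Step.
Variables (m : nat) (W : lmodType L) (J : nat -> su11_index -> rop W).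
Variable (e : (nat -> L) -> L -> W).
Hypothesis M : model m J e.

Definition next_ops : nat -> su11_index -> rop (L -> W) := fun a s =>
  if (a <= m)%N then pointwise (J a s) else power_op (kfactor b m.+1) s.

(** The coupled vector; its scalar is the one for which gauge_identity applies. *)
Definition next_vec x : L -> W :=
  G (x m + x m.+1 + b m + 1) *: coupled (e x) (x m.+1 - x m).

(** The conditions for the coupled vector alone, without its descendants.  They
    leave x m.+1 free, so that the last variable can be the constant N; and with
    two factors in all, x_0 + x_1 + beta_0 can be an integer. *)
Definition joinable x := generic b m x /\ ((0 < m)%N -> ~ isint (x m + x m.+1 + b m)).

Lemma pointwise_triple (j : su11_index -> rop W) :
  su11_triple j -> su11_triple (fun s => pointwise (j s)).
Proof.
move=> [r1 r2 r3]; split; rewrite -!pointwiseM -pointwiseB ?r1 ?r2 ?r3 //; exact: ropP.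
Qed.

Lemma next_comm : commuting_triples m.+2 next_ops.
Proof.
have [Mt Mc] := model_comm M; split=> [a|a c s t] am.
  rewrite /next_ops; case: leqP => h; first exact/pointwise_triple/Mt.
  exact: power_triple.
move=> cm ac; rewrite /next_ops; case: leqP => ha; case: leqP => hc.
- by rewrite /GRing.comm -!pointwiseM (Mc a c).
- exact: pointwise_comm_power.
- exact/commr_sym/pointwise_comm_power.
- by move: ac; rewrite (_ : a = c) ?eqxx //; lia.
Qed.

Lemma next_total_le l h : (h <= m.+1)%N ->
  range_total next_ops l h = fun s => pointwise (range_total J l h s).
Proof.
move=> hm; apply/funext => s; rewrite /range_total pointwise_sum.
by apply: eq_big_nat => a /andP[_ ah]; rewrite /next_ops (_ : (a <= m)%N) //; lia.
Qed.

Lemma next_totalE : range_total next_ops 0 m.+2 =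
  fun s => pointwise (range_total J 0 m.+1 s) + power_op (kfactor b m.+1) s.
Proof.
apply/funext => s; rewrite /range_total big_nat_recr //=; congr (_ + _).
  by have := next_total_le 0 (leqnn m.+1); rewrite /range_total => /(congr1 (fun f => f s)).
by rewrite /next_ops ltnn.
Qed.

Lemma kweight_step x : kw x m + kfactor b m.+1 + (x m.+1 - x m) = kw x m.+1.
Proof. by rewrite /kweight /kfactor; field; apply: L0. Qed.

Lemma coupled_sum (I : Type) (r : seq I) (P : pred I) (c : I -> L) (f : I -> L -> W) y :
  coupled (fun z => \sum_(i <- r | P i) c i *: f i z) y =
  \sum_(i <- r | P i) c i *: coupled (f i) y.
Proof.
apply/funext => z; rewrite fct_sumE /coupled /series scaler_sumr.
by apply: eq_bigr => i _; rewrite scalrfctE !scalerA mulrC.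
Qed.

Section Coupled.
Variables (o r : nat).
Hypothesis orm : (o + r)%N = m.
Let D s x : L -> W := fun z => pathsum b o r (fun u => e u z) s x.

Let D_verma x s : generic b m x ->
  verma (range_total J 0 m.+1) (kw x m + (trit_val s)%:~R) (D s x).
Proof. by move=> gx; apply: (pathsum_verma _ orm) => // u; apply: model_verma. Qed.

(** Shifting the point commutes with coupling up to the factors stepcoef.  For a
    point that merely is joinable with m = 0 there are no inner shifts, and the
    terms with s != 0 are empty on both sides. *)
Lemma gsum_next x t : joinable x -> t = tzero \/ ~ isint (x m + x m.+1 + b m) ->
  gsum b o r next_vec t x = G (x m + x m.+1 + b m + 1) *:
    \sum_s stepcoef (kw x m) (kfactor b m.+1) (x m.+1 - x m) s t *:
      coupled (D s x) (x m.+1 + (trit_val t)%:~R - (x m + (trit_val s)%:~R)).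
Proof.
move=> [gx jx] ht; rewrite /gsum (partition_big (@last_trit r) xpredT) //= scaler_sumr.
apply: eq_bigr => s _.
have [hs|[s0 m0]] : ((s == tzero) && (t == tzero) \/ ~ isint (x m + x m.+1 + b m)) \/
    (s != tzero /\ m = 0%N).
- case: ht => [->|h]; last by left; right.
  case: (eqVneq s tzero) => [_|_]; first by left; left; rewrite eqxx.
  by case: (posnP m) => [m0|/jx h]; [right | left; right].
- rewrite scalerA -(gauge_identity L0 GS _ hs) /D /pathsum coupled_sum scaler_sumr.
  apply: eq_bigr => nu /eqP lnu; rewrite scalerA /next_vec -orm.
  rewrite !shifted_ext eqxx ltn_eqF // shifted_last trit_at_last lnu.
  rewrite scalerA (model_local M (x' := shifted o nu x)); last first.
    by move=> i im; rewrite shifted_ext ltn_eqF //; lia.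
  by congr (_ *: _); ring.
- have r0 : r = 0%N by lia.
  rewrite big_pred0 => [|nu].
    rewrite (_ : coupled _ _ = 0) ?scaler0 //.
    apply/funext => z; rewrite /coupled /series /D.
    move: (x m.+1 + _ - _ - z) => q; rewrite [X in _ *: X](_ : _ = 0) ?scaler0 //.
    by rewrite /pathsum; subst r; rewrite big_pred0 // => nu; rewrite /last_trit insubF // eq_sym (negPf s0).
  by move: nu; rewrite r0 => nu; rewrite /last_trit insubF // eq_sym (negPf s0).
Qed.

Local Notation T := (range_total next_ops 0 m.+2).

Let TE s : T s = pointwise (range_total J 0 m.+1 s) + power_op (kfactor b m.+1) s.
Proof. by rewrite next_totalE. Qed.

Lemma next_lower x : generic b m x -> ~ isint (x m + x m.+1 + b m) ->
  pointwise (range_total J 0 o.+1 Jplus) (next_vec x) = - gsum b o r next_vec tminus x.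
Proof.
move=> gx hS; rewrite gsum_next; [|by split|by right].
rewrite /next_vec ropZ (V_lower_coupled L0 (model_decomposition M gx orm)) -scalerN.
congr (_ *: - _); rewrite sum_trit !trit_valE !series_scale /stepcoef /= scale1r.
by congr (coupled _ _ + _ *: coupled _ _ + _ *: coupled _ _); ring.
Qed.

Lemma next_middle x : joinable x ->
  (2%:R * kw x m.+1 - 2%:R) *: pointwise (range_total J 0 o.+1 Jzero) (next_vec x)
  - T Jminus (pointwise (range_total J 0 o.+1 Jplus) (next_vec x)) =
  gsum b o r next_vec tzero x.
Proof.
move=> jx; have gx := jx.1; rewrite gsum_next //; last by left.
have vD s := D_verma s gx.
have := coupled_middle L0 (kfactor b m.+1) (vD tminus)
  (eq_ind _ (fun k => verma _ k _) (vD tzero) _ (addr0 _)) (vD tplus)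
  (model_decomposition M gx orm) (x m.+1 - x m).
cbv zeta; rewrite kweight_step -TE => H.
rewrite /next_vec !ropZ !scalerA [_ * G _]mulrC -scalerA -scalerBr H.
congr (_ *: _); rewrite sum_trit !trit_valE /stepcoef /=.
rewrite kweight_step.
by congr (_ *: coupled _ _ + _ *: coupled _ _ + _ *: coupled _ _); ring.
Qed.

Lemma next_upper x : generic b m x -> ~ isint (x m + x m.+1 + b m) ->
  T Jminus (T Jminus (pointwise (range_total J 0 o.+1 Jplus) (next_vec x)))
  - (2%:R * (2%:R * kw x m.+1 - 1)) *: T Jminus (pointwise (range_total J 0 o.+1 Jzero) (next_vec x))
  + (2%:R * kw x m.+1 * (2%:R * kw x m.+1 - 1)) *:
     pointwise (range_total J 0 o.+1 Jminus) (next_vec x) =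
  - gsum b o r next_vec tplus x.
Proof.
move=> gx hS; rewrite gsum_next; [|by split|by right].
have vD s := D_verma s gx.
have := coupled_upper L0 (kfactor b m.+1) (vD tminus)
  (eq_ind _ (fun k => verma _ k _) (vD tzero) _ (addr0 _)) (vD tplus)
  (model_decomposition M gx orm) (x m.+1 - x m).
cbv zeta; rewrite kweight_step -TE => H.
rewrite /next_vec !ropZ !scalerA ![_ * G _]mulrC -!(scalerA (G _)) -scalerBr -scalerDr H -scalerN.
congr (_ *: - _); rewrite sum_trit !trit_valE /stepcoef /=.
by congr (_ *: coupled _ _ + _ *: coupled _ _ + _ *: coupled _ _); ring.
Qed.
End Coupled.

Local Notation T := (range_total next_ops 0 m.+2).

Lemma next_local x x' : (forall i, (i <= m.+1)%N -> x i = x' i) -> next_vec x = next_vec x'.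
Proof.
move=> xx; rewrite /next_vec !xx // (model_local M (x' := x')) // => i im.
by apply: xx; lia.
Qed.

Lemma next_lowest x : generic b m x -> T Jplus (next_vec x) = 0.
Proof.
move=> gx; rewrite next_totalE /next_vec ropZ.
by rewrite (coupled_lower L0 _ (model_verma M gx)) scaler0.
Qed.

Lemma next_weight x : generic b m x -> T Jzero (next_vec x) = kw x m.+1 *: next_vec x.
Proof.
move=> gx; rewrite next_totalE /next_vec ropZ.
by rewrite (coupled_weight _ (model_verma M gx)) kweight_step scalerA mulrC -scalerA.
Qed.

Lemma next_neq0 x : generic b m x -> next_vec x != 0.
Proof.
move=> gx; rewrite scaler_eq0 (negPf (G_neq0 _)) /=; apply/eqP => /(congr1 (fun f => f (x m.+1 - x m))).
rewrite /coupled /series subrr sbinom0 // scale1r => /eqP; apply/negP; exact: model_neq0 M _ gx.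
Qed.

Lemma pointwise_casimir (j : su11_index -> rop W) :
  triple_casimir (fun s => pointwise (j s)) = pointwise (triple_casimir j).
Proof. by rewrite /triple_casimir !pointwiseB !pointwiseM. Qed.

Lemma next_casimir_small (j : su11_index -> rop W) x y (c : L) (f : L -> W) :
  (forall n : nat, triple_casimir j (e x n%:R) = c *: e x n%:R - f n%:R) ->
  pointwise (triple_casimir j) (coupled (e x) y) = c *: coupled (e x) y - coupled f y.
Proof.
move=> H; apply/funext => z.
rewrite -[LHS]/(triple_casimir j (coupled (e x) y z)).
rewrite !addrfctE opprfctE scalrfctE /coupled /series ropZ.
rewrite (supported_scale (u := fun t => triple_casimir j (e x t))
  (v := fun t => c *: e x t - f t) (@supported_sbinom _ y)) //.
by rewrite scalerBr !scalerA mulrC.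
Qed.

Lemma next_initial x q : generic b m x -> (q <= m.+1)%N ->
  triple_casimir (range_total next_ops 0 q.+1) (next_vec x) =
  (kw x q * (kw x q - 1)) *: next_vec x.
Proof.
move=> gx; rewrite leq_eqVlt => /predU1P[->|qm].
  rewrite /triple_casimir !ropB !ropM next_lowest // rop0r subr0.
  by rewrite !next_weight // ropZ next_weight // scalerA -scalerBl mulrBr mulr1.
rewrite next_total_le; last by lia.
rewrite pointwise_casimir /next_vec ropZ (@next_casimir_small _ _ _ (kw x q * (kw x q - 1)) (fun=> 0)).
  rewrite (_ : coupled (fun=> 0) _ = 0) ?subr0 ?scalerA 1?mulrC //.
  by apply/funext => z; rewrite /coupled /series scaler0.
by move=> n; rewrite subr0; apply: (model_initial M) => //; lia.
Qed.

(** For an interval that ends at the new factor, its triple is the difference of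
    the total and J^[o+1], and casimir_complement applies.  A shorter interval
    acts on the coefficients of the series only. *)
Lemma next_inner x o r : joinable x -> (o + r <= m)%N ->
  triple_casimir (range_total next_ops o.+1 (o + r).+2) (next_vec x) =
  (kw x o * (kw x o - 1) + kw x (o + r).+1 * (kw x (o + r).+1 - 1)) *: next_vec x
  - gsum b o r next_vec tzero x.
Proof.
move=> jx; have gx := jx.1; rewrite leq_eqVlt => /predU1P[orm|orm].
  have E : range_total next_ops o.+1 (o + r).+2 =
      fun s => T s - range_total next_ops 0 o.+1 s.
    apply/funext => s; rewrite (@total_split _ _ 0 o.+1); last by lia.
    by rewrite orm addrC addKr.
  rewrite E (casimir_complement (k := kw x m.+1)); last first.
  - have c := total_comm next_comm.
    rewrite -!ropM; congr (rop_fun _ _).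
    rewrite (@total_split _ _ 0 o.+1 m.+2); last by lia.
    apply: commrD; first exact: commr_refl.
    by apply: (total_comm next_comm); lia.
  - exact: next_weight.
  - exact: next_lowest.
  rewrite next_initial //; last by lia.
  rewrite next_total_le; last by lia.
  rewrite (next_middle orm) // orm; linear_comb L (L -> W); ring.
rewrite next_total_le; last by lia.
rewrite pointwise_casimir {1}/next_vec ropZ.
rewrite (@next_casimir_small _ x _ _ (fun z => gsum b o r (fun u => e u z) tzero x)
  (fun n => model_inner M n gx orm)) /gsum.
rewrite coupled_sum scalerBr scaler_sumr /next_vec.
congr (_ - _); [by rewrite !scalerA mulrC | apply: eq_bigr => nu _].
rewrite (@shifted_inner _ _ _ _ _ m) 1?(@shifted_inner _ _ _ _ _ m.+1); try lia.
by rewrite !scalerA mulrC.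
Qed.

(** 1 / G (2 k): the ratios of its values at shifted points produce the
    denominators b_i of pathsum_ext. *)
Definition norm_factor x : L := (G (2%:R * x m.+1 + b m.+1 + 1))^-1.

Definition next_fam x : L -> L -> W :=
  lowest_family (T Jminus) (kw x m.+1) (norm_factor x *: next_vec x).

Lemma two_kweight x i : 2%:R * kw x i = 2%:R * x i + b i + 1.
Proof. by rewrite /kweight; field; apply: L0. Qed.

Lemma generic_joinable x : generic b m.+1 x -> joinable x.
Proof.
move=> gx; split; first by apply: genericW gx.
by case: gx => _ g m0; have [_] := g m (ltnSn m).
Qed.

Lemma kweight_neq0 x (k : int) : generic b m.+1 x -> 2%:R * kw x m.+1 + k%:~R != 0.
Proof.
move=> [_ g]; have [h _] := g m (ltnSn m); rewrite two_kweight -addrA -[1]/(1%:~R) -intrD.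
exact: not_isint_neq0.
Qed.

Lemma next_fam_verma x : generic b m.+1 x -> verma T (kw x m.+1) (next_fam x).
Proof.
move=> gx; have gx' : generic b m x by apply: genericW gx.
apply: lowest_family_verma => //.
- exact: (total_triple next_comm).
- by rewrite ropZ next_lowest // scaler0.
- by rewrite ropZ next_weight // !scalerA; congr (_ *: _); ring.
- by move=> n; apply: (kweight_neq0 n gx).
Qed.

Lemma next_fam_inner x o r (n : nat) : generic b m.+1 x -> (o + r < m.+1)%N ->
  triple_casimir (range_total next_ops o.+1 (o + r).+2) (next_fam x n%:R) =
  (kw x o * (kw x o - 1) + kw x (o + r).+1 * (kw x (o + r).+1 - 1)) *: next_fam x n%:R
  - gsum b o r (fun x => next_fam x n%:R) tzero x.
Proof.
move=> gx orm; rewrite /next_fam (lowest_family_comm L0); last first.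
  by apply: (total_casimir_comm next_comm); lia.
rewrite (ropZ _ (norm_factor x)) next_inner //; last exact: generic_joinable.
rewrite !(lowest_familyE L0) !(ropZ _ (norm_factor x)) ropBr (ropZ _ (_ + _)) /gsum rop_sumr.
rewrite !scalerBr !scalerA.
congr (_ - _); first by congr (_ *: _); ring.
rewrite scaler_sumr; apply: eq_bigr => nu _.
rewrite (lowest_familyE L0) !(ropZ _ (norm_factor _)) !(ropZ _ (_ * _)) !scalerA /norm_factor /kweight shifted_inner; last by lia.
by congr (_ *: _); ring.
Qed.

Lemma next_fam_gsum0 x o r t : (o + r)%N = m ->
  gsum b o r (fun u => next_fam u 0) t x =
  (G (2%:R * (x m.+1 + (trit_val t)%:~R) + b m.+1 + 1))^-1 *: gsum b o r next_vec t x.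
Proof.
move=> orm; rewrite /gsum scaler_sumr; apply: eq_bigr => nu _.
rewrite /next_fam (lowest_family0 L0) /norm_factor shifted_ext -orm eqxx.
by rewrite !scalerA; congr (_ *: _); ring.
Qed.

(** By decomposition_extend it suffices to treat the lowest weight vector.  There
    next_lower, next_middle and next_upper express the three components through
    A, B, C, the images under J_+, J_0, J_- of J^[o+1], and their descendants. *)
Lemma next_fam_decomposition x o r : generic b m.+1 x -> (o + r)%N = m ->
  tensor_decomposition (range_total next_ops 0 o.+1) (kw x m.+1) (next_fam x)
      (fun z => pathsum b o r.+1 (fun x => next_fam x z) tminus x)
      (fun z => pathsum b o r.+1 (fun x => next_fam x z) tzero x)
      (fun z => pathsum b o r.+1 (fun x => next_fam x z) tplus x).
Proof.
move=> gx orm; have gx' : generic b m x by apply: genericW gx.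
have hS : ~ isint (x m + x m.+1 + b m) by case: gx => _ g; have [_] := g m (ltnSn m).
have hK : ~ isint (2%:R * x m.+1 + b m.+1) by case: gx => _ g; have [] := g m (ltnSn m).
have orm1 : (o + r.+1)%N = m.+1 by lia.
have vD s := pathsum_verma s orm1 next_fam_verma gx.
have v0 : verma T (kw x m.+1) (fun z => pathsum b o r.+1 (fun u => next_fam u z) tzero x).
  by have := vD tzero; rewrite trit_valE addr0.
have vm := vD tminus; have vp := vD tplus; rewrite trit_valE in vm; rewrite trit_valE in vp.
have nz (k : int) := kweight_neq0 k gx.
set V := range_total next_ops 0 o.+1.
have VT : su11_triple V by apply: (total_triple next_comm); lia.
have [rel1 rel2 rel3] : [/\ forall w, V Jplus (T Jminus w) = T Jminus (V Jplus w) + V Jzero w + V Jzero w,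
   forall w, V Jzero (T Jminus w) = T Jminus (V Jzero w) + V Jminus w &
   forall w, V Jminus (T Jminus w) = T Jminus (V Jminus w)].
  have TE s : T s = V s + range_total next_ops o.+1 m.+2 s by apply: total_split; lia.
  have c s w : range_total next_ops o.+1 m.+2 Jminus (V s w) =
      V s (range_total next_ops o.+1 m.+2 Jminus w).
    rewrite -!ropM; congr (rop_fun _ _); apply: (total_comm next_comm); lia.
  have [q1 q2 q3] := tripleP VT.
  by split=> w; rewrite TE !ropD !ropDr c ?q1 ?q2 ?q3; linear_comb L (L -> W); ring.
have VE s : pointwise (range_total J 0 o.+1 s) = V s.
  by rewrite /V next_total_le //; lia.
have F1 := next_lower orm gx' hS; have F2 := next_middle orm (generic_joinable gx).
have F3 := next_upper orm gx' hS; rewrite !VE in F1 F2 F3.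
have e0 : next_fam x 0 = norm_factor x *: next_vec x by rewrite /next_fam (lowest_family0 L0).
(* All coefficients are rational functions of u = 2 k - 1, where k is the lowest
   weight of next_fam x. *)
set u := 2%:R * x m.+1 + b m.+1 in hK.
have Ku : 2%:R * kw x m.+1 = u + 1 by rewrite two_kweight.
have u0 : u != 0 by have := not_isint_neq0 0 hK; rewrite addr0.
have u1 : u + 1 != 0 by exact: (not_isint_neq0 1 hK).
have u2 : u + 2%:R != 0 by exact: (not_isint_neq0 2 hK).
have um1 : u - 1 != 0 by exact: (not_isint_neq0 (-1) hK).
have h2 : 2%:R != 0 :> L by exact: L0.
have gm : (G (2%:R * (x m.+1 - 1) + b m.+1 + 1))^-1 = u * (u - 1) * norm_factor x.
  have Gu : G u = (u - 1) * G (u - 1).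
    by rewrite -[in LHS](subrK 1 u) GS // => /(isintD _ (-1)).
  rewrite /norm_factor -/u (GS hK) Gu; have -> : 2%:R * (x m.+1 - 1) + b m.+1 + 1 = u - 1 by rewrite /u; ring.
  by have g0 := G_neq0 (u - 1); field; rewrite g0 u0 um1.
have gp : (G (2%:R * (x m.+1 + 1) + b m.+1 + 1))^-1 =
    norm_factor x / ((u + 1) * (u + 2%:R)).
  have -> : 2%:R * (x m.+1 + 1) + b m.+1 + 1 = u + 1 + 1 + 1 by rewrite /u; ring.
  rewrite GS; last by move=> /(isintD _ 1)/(isintD _ 1).
  rewrite GS; last by move=> /(isintD _ 1).
  have -> : u + 1 + 1 = u + 2%:R by ring.
  rewrite /norm_factor -/u; have g0 := G_neq0 (u + 1); field.
  by rewrite g0 u1 u2.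
set A := V Jplus (next_vec x) in F1 F2 F3; set B := V Jzero (next_vec x) in F2 F3.
set C := V Jminus (next_vec x) in F3; set p := norm_factor x in e0 gm gp *.
have F1' : gsum b o r next_vec tminus x = - A by rewrite F1 opprK.
have F2' : gsum b o r next_vec tzero x = (u - 1) *: B - T Jminus A.
  by rewrite -F2 Ku; congr (_ *: _ - _); ring.
have F3' : gsum b o r next_vec tplus x =
    - (T Jminus (T Jminus A) - (2%:R * u) *: T Jminus B + ((u + 1) * u) *: C).
  by rewrite -[LHS]opprK -F3 Ku; congr (- (_ - _ *: _ + _ *: _)); ring.
have Pm0 : pathsum b o r.+1 (fun u => next_fam u 0) tminus x = - (p *: A).
  rewrite pathsum_ext orm next_fam_gsum0 // trit_valE gm F1' !scalerN scalerA.
  congr (- (_ *: _)).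
  rewrite /bcoef /reflect_var /=.
  have -> : 2%:R * (- x m.+1 - b m.+1) + b m.+1 + 1 = - (u - 1) by rewrite /u; ring.
  have -> : 2%:R * (- x m.+1 - b m.+1) + b m.+1 = - u by rewrite /u; ring.
  by rewrite expr0; field; rewrite !oppr_eq0 u0 um1.
have P00 : pathsum b o r.+1 (fun u => next_fam u 0) tzero x =
    (2%:R / ((u + 1) * (u - 1)) * p) *: ((u - 1) *: B - T Jminus A).
  rewrite pathsum_ext orm next_fam_gsum0 // trit_valE addr0 -/(norm_factor x) -/p F2' scalerA.
  by congr (_ *: _); rewrite /bcoef /reflect_var /= -/u expr1.
have Pp0 : pathsum b o r.+1 (fun u => next_fam u 0) tplus x =
    (p / ((u + 1) * u * ((u + 1) * (u + 2%:R)))) *: 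
     - (T Jminus (T Jminus A) - (2%:R * u) *: T Jminus B + ((u + 1) * u) *: C).
  rewrite pathsum_ext orm next_fam_gsum0 // trit_valE gp F3' scalerA.
  by congr (_ *: _); rewrite /bcoef /reflect_var /= -/u expr0; field; rewrite u0 u1 u2.
have Pm1 : pathsum b o r.+1 (fun u => next_fam u 1) tminus x = - ((p / (u - 1)) *: T Jminus A).
  have [_ _] := vm 0%N; rewrite !mulr0n add0r Pm0 ropNr ropZ => H.
  rewrite -scalerA [p *: _]scalerA mulrC -scalerA -scalerN H scalerA.
  have -> : 2%:R * (kw x m.+1 - 1) + 0 = u - 1 by rewrite mulrBr Ku; ring.
  by rewrite mulVf // scale1r.
have Pm2 : pathsum b o r.+1 (fun u => next_fam u 2%:R) tminus x =
    - ((p / (u * (u - 1))) *: T Jminus (T Jminus A)).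
  have [_ _] := vm 1%N; rewrite Pm1 ropNr ropZ => H.
  have E : 2%:R * (kw x m.+1 - 1) + 1 = u by rewrite mulrBr Ku; ring.
  rewrite E in H.
  have -> : p / (u * (u - 1)) = u^-1 * (p / (u - 1)) by field; rewrite u0 um1.
  by rewrite -scalerA -scalerN H scalerA mulVf // scale1r.
have P01 : pathsum b o r.+1 (fun u => next_fam u 1) tzero x =
    (2%:R / ((u + 1) * (u + 1) * (u - 1)) * p) *: ((u - 1) *: T Jminus B - T Jminus (T Jminus A)).
  have [_ _] := v0 0%N; rewrite !mulr0n add0r addr0 Ku P00 ropZ ropBr ropZ => H.
  have -> : 2%:R / ((u + 1) * (u + 1) * (u - 1)) * p =
     (u + 1)^-1 * (2%:R / ((u + 1) * (u - 1)) * p) by field; rewrite u1 um1.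
  by rewrite -scalerA H scalerA mulVf // scale1r.
have kE : kw x m.+1 = (u + 1) / 2%:R by rewrite -Ku; field.
apply: decomposition_extend (next_fam_verma gx) vm v0 vp _ _ _ _ => //.
- by move=> n; apply: (nz n).
- by rewrite e0 ropZ Pm0 opprK.
- rewrite e0 ropZ Pm1 P00 -/B kE; linear_comb L (L -> W); field; rewrite ?h2 ?u1 ?um1 //.
- rewrite e0 ropZ Pm2 P01 Pp0 Ku -/C.
  by linear_comb L (L -> W); field; rewrite ?h2 ?u0 ?u1 ?u2 ?um1.
Qed.

Theorem next_model : model m.+1 next_ops next_fam.
Proof.
split.
- exact: next_comm.
- move=> x x' xx; rewrite /next_fam /norm_factor /kweight (next_local xx) xx //.
- exact: next_fam_verma.
- move=> x gx; rewrite /next_fam (lowest_family0 L0) scaler_eq0 invr_eq0 (negPf (G_neq0 _)) /=.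
  by apply: next_neq0; apply: genericW gx.
- move=> x q n gx qm; rewrite /next_fam (lowest_family_comm L0); last first.
    by apply: (total_casimir_comm next_comm); lia.
  rewrite (ropZ _ (norm_factor x)) next_initial //; last by apply: genericW gx.
  rewrite !(lowest_familyE L0) !(ropZ _ (norm_factor x)) (ropZ _ (_ * _)) !scalerA.
  by congr (_ *: _); ring.
- by move=> x o r n gx orm; apply: next_fam_inner.
- move=> x o [|r] gx; rewrite ?addn0 ?addnS => orm.
    have E t : (fun z => pathsum b o 0 (fun u => next_fam u z) t x) =
        if t == tzero then next_fam x else fun=> 0.
      by apply/funext => z; rewrite pathsum0; case: eqP.
    by rewrite !E orm; apply: decomposition_self; apply: next_fam_verma.
  by apply: next_fam_decomposition => //; case: orm.
Qed.

End Step.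

Definition base_vec (x : nat -> L) (z t : L) : L^o := (t == z)%:R.

Theorem base_model : model 0 (fun=> power_op (kfactor b 0)) base_vec.
Proof.
have E s : range_total (fun=> power_op (W := L^o) (kfactor b 0)) 0 1 s = power_op (kfactor b 0) s.
  by rewrite /range_total big_nat1.
have V x : generic b 0 x -> verma (power_op (W := L^o) (kfactor b 0)) (kw x 0) (base_vec x).
  move=> [x0 _] n; rewrite /kweight x0 add0r.
  split; apply/funext => t; rewrite scalrfctE /base_vec /=.
  - have -> : (t + 1 == n%:R) = (t == n%:R - 1) by rewrite eq_sym -subr_eq eq_sym.
    by case: eqP => [->|_]; rewrite ?scaler0 // subrK.
  - by rewrite addr0; case: eqP => [->|_]; rewrite ?scaler0 // addrC.
  - have -> : (t - 1 == n%:R) = (t == n%:R + 1) by rewrite subr_eq.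
    by case: eqP => [->|_]; rewrite ?scaler0 // addrK addrC.
have ET : range_total (fun=> power_op (W := L^o) (kfactor b 0)) 0 1 = power_op (kfactor b 0).
  by apply/funext.
split.
- by split=> [a _|[|a] [|c] s t //]; apply: power_triple.
- by move=> x x' _.
- by move=> x gx; rewrite ET; apply: V.
- by move=> x gx; apply/eqP => /(congr1 (fun f => f 0)) /eqP; rewrite /base_vec eqxx oner_eq0.
- by move=> x [|//] n gx _; rewrite ET (casimir_verma _ (V x gx)).
- by [].
- move=> x [|//] [|//] gx _; rewrite ET.
  have E' t : (fun z => pathsum b 0 0 (fun u => base_vec u z) t x) =
        if t == tzero then base_vec x else fun=> 0.
    by apply/funext => z; rewrite pathsum0; case: eqP.
  by rewrite !E'; apply: decomposition_self; apply: V.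
Qed.

Theorem model_exists m : exists (W : lmodType L) (J : nat -> su11_index -> rop W)
  (e : (nat -> L) -> L -> W), model m J e.
Proof.
elim: m => [|m [W [J [e M]]]].
  by exists (L -> L^o : lmodType L), (fun=> power_op (kfactor b 0)), base_vec; apply: base_model.
by exists (L -> W : lmodType L), (next_ops m J), (next_fam m J e); apply: next_model.
Qed.
End Model.

(** * Translations of rational functions *)

Section Translations.
Variables (K : fieldType) (m : nat).
Local Notation L := (ratfun K m).

Lemma translated_inj (c : 'I_m -> K) : injective (comp_mpoly (translated c)).
Proof. exact: can_inj (translatedK c). Qed.

Lemma ratfun_translate_zmod (c : 'I_m -> K) : zmod_morphism (ratfun_translate c : L -> L).
Proof.
move=> f g; have := ratfun_translate_linear c (-1) g f.
by rewrite !scaleN1r [- g + f]addrC [- _ + _]addrC.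
Qed.

Lemma ratfun_translate_monoid (c : 'I_m -> K) : monoid_morphism (ratfun_translate c : L -> L).
Proof.
split; last exact: (frac_mapM (@translated_inj c)).
by rewrite -[1 in LHS]tofrac1 /ratfun_translate (frac_map_tofrac (@translated_inj c)) rmorph1 tofrac1.
Qed.

HB.instance Definition _ c := GRing.isZmodMorphism.Build L L
  (ratfun_translate c) (ratfun_translate_zmod c).
HB.instance Definition _ c := GRing.isMonoidMorphism.Build L L
  (ratfun_translate c) (ratfun_translate_monoid c).

Lemma ratfun_translate_div (c : 'I_m -> K) (f g : L) :
  ratfun_translate c (f / g) = ratfun_translate c f / ratfun_translate c g.
Proof. exact: (fmorph_div (ratfun_translate c)). Qed.

Lemma ratfun_translate_poly (c : 'I_m -> K) p :
  ratfun_translate c (ratpoly p) = ratpoly (comp_mpoly (translated c) p).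
Proof. exact: (frac_map_tofrac (@translated_inj c)). Qed.

Lemma ratfun_translateZ (c : 'I_m -> K) k (f : L) :
  ratfun_translate c (k *: f) = k *: ratfun_translate c f.
Proof.
have := ratfun_translate_linear c k f 0.
by rewrite !addr0 (rmorph0 (ratfun_translate c)) addr0.
Qed.

Lemma mpoly_linear_ext (f g : {linear {mpoly K[m]} -> {mpoly K[m]}}) :
  (forall e : 'X_{1..m}, f 'X_[e] = g 'X_[e]) -> f =1 g.
Proof.
move=> fg p; rewrite [p]mpolyE !linear_sum; apply: eq_bigr => e _ /=.
by rewrite !linearZ /= fg.
Qed.

Lemma comp_translated (c d : 'I_m -> K) p :
  comp_mpoly (translated c) (comp_mpoly (translated d) p) =
  comp_mpoly (translated (fun i => c i + d i)) p.
Proof.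
apply: (mpoly_linear_ext (f := comp_mpoly (translated c) \o comp_mpoly (translated d))) => e /=.
rewrite !comp_mpolyX rmorph_prod /=; apply: eq_bigr => i _.
rewrite rmorphXn /= !tnth_mktuple rmorphD /= comp_mpolyC comp_mpolyXU -tnth_nth tnth_mktuple.
by rewrite mpolyCD addrA.
Qed.

Lemma ratfun_translate_comp (c d : 'I_m -> K) (f : L) :
  ratfun_translate c (ratfun_translate d f) = ratfun_translate (fun i => c i + d i) f.
Proof.
have E p : ratfun_translate c (ratfun_translate d (ratpoly p)) =
    ratfun_translate (fun i => c i + d i) (ratpoly p : L).
  by rewrite !ratfun_translate_poly comp_translated.
rewrite (frac_repr f).
apply: etrans (congr1 (ratfun_translate c) (ratfun_translate_div d _ _)) _.
apply: etrans (ratfun_translate_div c _ _) _.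
apply: etrans _ (esym (ratfun_translate_div (fun i => c i + d i) _ _)).
exact: (congr2 (fun a b : L => a / b) (E _) (E _)).
Qed.

Lemma ratfun_translate0 (c : 'I_m -> K) (f : L) : c =1 (fun=> 0) -> ratfun_translate c f = f.
Proof.
move=> c0; have id p : comp_mpoly (translated c) p = p.
  apply: (mpoly_linear_ext (f := comp_mpoly (translated c)) (g := idfun)) => e /=.
  rewrite comp_mpolyX [RHS]mpolyXE_id.
  by apply: eq_bigr => i _; rewrite tnth_mktuple c0 mpolyC0 addr0.
have E p : ratfun_translate c (ratpoly p : L) = ratpoly p.
  by rewrite ratfun_translate_poly id.
by rewrite (frac_repr f) ratfun_translate_div; congr (_ / _); apply: E.
Qed.

Lemma ratfun_translate_alg (c : 'I_m -> K) k : ratfun_translate c k%:A = k%:A :> L.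
Proof. by rewrite ratfun_translateZ rmorph1. Qed.

Lemma ratfun_algE (k : K) : k%:A = ratpoly k%:MP :> L.
Proof. exact: mulr1. Qed.

Lemma ratfun_scaleE (k : K) (f : L) : k *: f = k%:A * f.
Proof. by rewrite -scalerAl mul1r. Qed.

Lemma ratfun_char0 : char0 K -> char0 L.
Proof.
move=> K0 n; rewrite -(rmorph_nat (in_alg L)) fmorph_eq0; exact: K0.
Qed.
End Translations.

(** * Relations between independent vectors *)

Section RestrictedScalars.
Variables (K L : fieldType) (W : lmodType L).

(** The scalars are restricted along io.  The vector w0 is a parameter because an
    algebra has to be nonzero, and a nonzero vector witnesses this. *)
Definition scalar_rop (io : {rmorphism K -> L}) (w0 : W) (w0_neq0 : w0 != 0) : Type := rop W.

Variables (io : {rmorphism K -> L}) (w0 : W) (w0_neq0 : w0 != 0).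
Local Notation kop := (scalar_rop io w0_neq0).

HB.instance Definition _ := GRing.PzRing.on kop.

Fact kop_oner_neq0 : (1 : kop) != 0.
Proof.
apply: contraNneq w0_neq0 => h; apply/eqP.
exact: (congr1 (fun s : rop W => s w0) h).
Qed.

HB.instance Definition _ := GRing.PzSemiRing_isNonZero.Build kop kop_oner_neq0.

Fact kop_scale_linear (k : K) (s : rop W) : linear (fun w => io k *: s w).
Proof. by move=> a u v; rewrite linearP scalerDr !scalerA mulrC. Qed.

Definition kop_scale (k : K) (s : kop) : kop := ROp (kop_scale_linear k s).

Fact kop_scaleA k l s : kop_scale k (kop_scale l s) = kop_scale (k * l) s.
Proof. by apply: ropP => w /=; rewrite scalerA rmorphM. Qed.
Fact kop_scale1 : left_id 1 kop_scale.
Proof. by move=> s; apply: ropP => w /=; rewrite rmorph1 scale1r. Qed.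
Fact kop_scaleDr : right_distributive kop_scale +%R.
Proof. by move=> k s t; apply: ropP => w /=; rewrite scalerDr. Qed.
Fact kop_scaleDl s : {morph kop_scale^~ s : k l / k + l}.
Proof. by move=> k l; apply: ropP => w /=; rewrite rmorphD scalerDl. Qed.

HB.instance Definition _ := GRing.Zmodule_isLmodule.Build K kop
  kop_scaleA kop_scale1 kop_scaleDr kop_scaleDl.

Fact kop_scaleAl (k : K) (s t : kop) : k *: (s * t) = k *: s * t.
Proof. by apply: ropP => w; rewrite /= linearZ. Qed.
Fact kop_scaleAr (k : K) (s t : kop) : k *: (s * t) = s * (k *: t).
Proof. exact: ropP. Qed.

HB.instance Definition _ := GRing.Lmodule_isLalgebra.Build K kop kop_scaleAl.
HB.instance Definition _ := GRing.Lalgebra_isAlgebra.Build K kop kop_scaleAr.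
End RestrictedScalars.

Section Transfer.
Variables (L : fieldType) (W : lmodType L) (I : eqType) (F : I -> W).
Implicit Types (s : seq (L * I)).

Lemma collect_terms (V : lmodType L) (H : I -> V) s :
  \sum_(p <- s) p.1 *: H p.2 =
  \sum_(i <- undup (map snd s)) (\sum_(p <- s | p.2 == i) p.1) *: H i.
Proof.
transitivity (\sum_(i <- undup (map snd s)) \sum_(p <- s | p.2 == i) p.1 *: H p.2); last first.
  apply: eq_bigr => i _; rewrite scaler_suml; apply: eq_bigr => p /eqP -> //.
rewrite (exchange_big_dep xpredT) //=; apply: eq_big_seq => p ps.
rewrite -big_filter (_ : filter _ _ = [:: p.2]) ?big_seq1 //.
rewrite -(filter_pred1_uniq (undup_uniq (map snd s))) ?mem_undup ?map_f //.
by apply: eq_filter => i; rewrite /= eq_sym.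
Qed.

Hypothesis separated : forall i i', i != i' -> exists X : rop W, exists c : I -> L,
  (forall k, X (F k) = c k *: F k) /\ c i != c i'.
Hypothesis F_neq0 : forall i, F i != 0.

(** A product of factors X - c_j, one for each vector F j to be killed. *)
Lemma separating_operator i (r : seq I) : i \notin r -> exists (Q : rop W) (c : I -> L),
  [/\ forall k, Q (F k) = c k *: F k, forall k, k \in r -> c k = 0 & c i != 0].
Proof.
elim: r => [|j r IH] /=.
  by move=> _; exists 1, (fun=> 1); split=> // [k|]; rewrite ?scale1r ?oner_neq0.
rewrite inE negb_or => /andP[ij /IH[Q [c [Qc c0 ci]]]].
have [X [d [Xd dij]]] := separated ij.
have linX : linear (fun w => X w - d j *: w).
  by move=> a u v; rewrite ropDr ropZ; linear_comb L W; ring.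
exists (Q * ROp linX), (fun k => c k * (d k - d j)); split.
- by move=> k; rewrite ropM Qc /= ropZ Xd; linear_comb L W; ring.
- by move=> k; rewrite inE => /predU1P[->|/c0->]; rewrite ?subrr ?mulr0 ?mul0r.
- by rewrite mulf_neq0 // subr_eq0.
Qed.

Lemma independent_family (r : seq I) (a : I -> L) : uniq r ->
  \sum_(i <- r) a i *: F i = 0 -> forall i, i \in r -> a i = 0.
Proof.
move=> ur s0 i ir; have /separating_operator[Q [c [Qc c0 ci]]] : i \notin rem i r.
  by rewrite mem_rem_uniq // inE eqxx.
have := congr1 Q s0; rewrite rop_sumr rop0r (perm_big _ (perm_to_rem ir)) big_cons /=.
rewrite big1_seq ?addr0 => [|k /andP[_ kr]]; last by rewrite ropZ Qc c0 // scale0r scaler0.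
rewrite ropZ Qc scalerA => /eqP; rewrite scaler_eq0 (negPf (F_neq0 i)) orbF mulf_eq0 (negPf ci) orbF.
by move/eqP.
Qed.

(** Once terms with equal indices are collected, a relation between independent
    vectors has zero coefficients, and so it holds for any other family. *)
Lemma transfer_zero (V : lmodType L) (H : I -> V) s :
  \sum_(p <- s) p.1 *: F p.2 = 0 -> \sum_(p <- s) p.1 *: H p.2 = 0.
Proof.
rewrite !collect_terms => /(independent_family (undup_uniq _)) a0.
by rewrite big1_seq // => i /andP[_ ir]; rewrite a0 // scale0r.
Qed.
End Transfer.

Theorem coupled_vectors (L : fieldType) (b : nat -> L) (L0 : char0 L) (m : nat) :
  exists (W : lmodType L) (J : nat -> su11_index -> rop W) (F : (nat -> L) -> W),
  [/\ commuting_triples m.+2 J,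
      forall x, joinable b m x -> F x != 0,
      forall x q, joinable b m x -> (q <= m.+1)%N ->
        triple_casimir (range_total J 0 q.+1) (F x) = kappa (x q) (b q) *: F x &
      forall x o r, joinable b m x -> (o + r <= m)%N ->
        triple_casimir (range_total J o.+1 (o + r).+2) (F x) =
        (kappa (x o) (b o) + kappa (x (o + r).+1) (b (o + r).+1)) *: F x
        - gsum b o r F tzero x].
Proof.
have [G [G_neq0 GS]] := gamma_exists L0.
have [W [J [e M]]] := model_exists b L0 G_neq0 GS m.
have kappaE (x c : L) : (x + (c + 1) / 2%:R) * (x + (c + 1) / 2%:R - 1) = kappa x c.
  by rewrite /kappa; field; apply: L0.
exists (L -> W : lmodType L), (next_ops b m J), (next_vec b G m e); split.
- exact: (next_comm M).
- by move=> x [gx _]; apply: (next_neq0 L0 G_neq0 M gx).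
- by move=> x q [gx _] qm; rewrite (next_initial G L0 M gx qm) /kweight kappaE.
- by move=> x o r jx orm; rewrite (next_inner L0 GS M jx orm) /kweight !kappaE.
Qed.

(** * The lattice of points *)

Import Num.Theory.

Lemma double_shift (F : fieldType) (x c : F) (z : int) :
  2%:R * (x + z%:~R) + c = 2%:R * x + c + (z *+ 2)%:~R.
Proof. by rewrite rmorphMn /=; ring. Qed.

Lemma sum_shift (F : fieldType) (x y c : F) (z t : int) :
  x + z%:~R + (y + t%:~R) + c = x + y + c + (z + t)%:~R.
Proof. by rewrite rmorphD /=; ring. Qed.

Lemma rmorph_double (F : fieldType) (f : {rmorphism F -> F}) (x c : F) :
  f (2%:R * x + c) = 2%:R * f x + f c.
Proof. by rewrite rmorphD rmorphM rmorph_nat. Qed.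

Lemma rmorph_sum3 (F : fieldType) (f : {rmorphism F -> F}) (x y c : F) :
  f (x + y + c) = f x + f y + f c.
Proof. by rewrite !rmorphD. Qed.

Lemma sum_unit (F : fieldType) (x y c : F) (p q : bool) : p (+) q ->
  x + p%:R + (y + q%:R) + c = x + y + c + 1.
Proof. by case: p; case: q => //= _; ring. Qed.

Section LatticeAction.
Variables (R : realType) (n : nat) (beta : nat -> R) (N : nat).
Hypothesis n_ge2 : (2 <= n)%N.
Local Notation m := n.-2.
Local Notation K := (R[i]).
Local Notation L := (ratfun R[i] n.-2).
Local Notation I := ({ffun 'I_n.-2 -> int}).
Local Notation xv := (xvar R n N).
Local Notation bp := (bpar n beta).

Lemma complex_char0 : char0 K.
Proof. by move=> j; rewrite pnatr_eq0. Qed.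

Lemma L_char0 : char0 L.
Proof. exact/ratfun_char0/complex_char0. Qed.

(** The substitution of the point v of the lattice, as a field automorphism. *)
Definition translate (v : I) : L -> L := ratfun_translate (fun k => (v k)%:~R).

HB.instance Definition _ v := GRing.RMorphism.on (translate v).

Definition lattice_coord (v : I) (i : nat) : int :=
  if i is i'.+1 then if insub i' is Some k then v k else 0 else 0.

Definition point (v : I) (i : nat) : L := xv i + (lattice_coord v i)%:~R.

Lemma translate_var v i : translate v (xv i) = point v i.
Proof.
rewrite /point /lattice_coord /xvar; case: i => [|i]; first by rewrite rmorph0 addr0.
case: insubP => [k _ _|_]; last by rewrite rmorph_nat addr0.
rewrite /translate ratfun_translate_poly comp_mpolyXU -tnth_nth tnth_mktuple.
rewrite /ratpoly tofracD; congr (_ + _).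
by rewrite -[LHS]ratfun_algE -(rmorph_int (in_alg L)).
Qed.

Lemma translate_par v i : translate v (bp i) = bp i.
Proof. exact: ratfun_translate_alg. Qed.

Lemma translateZ v k (f : L) : translate v (k *: f) = k *: translate v f.
Proof. exact: ratfun_translateZ. Qed.

Lemma translate_add v w (f : L) : translate v (translate w f) = translate (v + w) f.
Proof.
have E : (fun k => (v k)%:~R + (w k)%:~R) = (fun k => ((v + w) k)%:~R) :> ('I_m -> K).
  by apply/funext => k; rewrite ffunE intrD.
exact: etrans (ratfun_translate_comp _ _ _) (congr1 (fun c => ratfun_translate c f) E).
Qed.

Lemma translate0 (f : L) : translate 0 f = f.
Proof. by apply: ratfun_translate0 => k; rewrite ffunE. Qed.

(** Automorphisms fix the integers. *)
Lemma not_isint_translate (z : L) v (k : int) : translate v z = z + k%:~R -> k != 0 -> ~ isint z.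
Proof.
move=> vz k0 [l zl]; move: vz; rewrite zl rmorph_int -[LHS]addr0 => /addrI /esym.
by move/(@intr_inj0 L L_char0 k 0)/eqP; rewrite (negPf k0).
Qed.

Definition unit_shift (i : nat) : I := [ffun k : 'I_n.-2 => Posz (k.+1 == i)].

Lemma coord_unit_shift i j : (0 < i <= m)%N ->
  lattice_coord (unit_shift i) j = Posz (j == i).
Proof.
move=> im; case: j => [|j] /=; first by case: i im.
case: insubP => [k _ <-|jm]; first by rewrite ffunE.
by case: eqP => // ji; move: jm; rewrite -ji in im; lia.
Qed.

Lemma point_unit_shift i j : (0 < i <= m)%N ->
  translate (unit_shift i) (xv j) = xv j + (j == i)%:R.
Proof.
move=> im; rewrite translate_var.
exact: (congr1 (fun z : int => xv j + z%:~R) (coord_unit_shift j im)).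
Qed.

(** A unit translation changes each of these linear forms by 1 or 2, so none of
    them is an integer. *)
Lemma point_generic v : generic bp m (point v) /\
  ((0 < m)%N -> ~ isint (point v m + point v m.+1 + bp m)).
Proof.
have E i j k : (0 < k <= m)%N -> (i == k) (+) (j == k) ->
    ~ isint (point v i + point v j + bp k.-1) /\ ~ isint (point v i + point v j + bp k).
  move=> km ij.
  have A (c : L) : translate (unit_shift k) c = c -> ~ isint (point v i + point v j + c).
    move=> cc; rewrite /point.
    rewrite sum_shift => /isintD; apply: (@not_isint_translate _ (unit_shift k) 1) => //.
    by rewrite (rmorph_sum3 (translate _)) /= !point_unit_shift // cc sum_unit.
  by split; apply: A; apply: translate_par.
split; last first.
  by move=> m_gt0; apply: (E m m.+1 m _ _).2; rewrite ?m_gt0 ?leqnn // eqxx; case: eqP => //; lia.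
split=> [|i im]; first by rewrite /point addr0.
split; last by apply: (E i i.+1 i.+1 _ _).1; rewrite ?eqxx //; case: eqP => //; lia.
rewrite /point.
rewrite double_shift => /isintD; apply: (@not_isint_translate _ (unit_shift i.+1) 2) => //.
have -> : translate (unit_shift i.+1) (2%:R * xv i.+1 + bp i.+1) =
    2%:R * translate (unit_shift i.+1) (xv i.+1) + translate (unit_shift i.+1) (bp i.+1).
  exact: (rmorph_double (translate _)).
rewrite point_unit_shift // translate_par eqxx.
exact: (double_shift (xv i.+1) (bp i.+1) 1).
Qed.

Definition path_shift o r (nu : trits r) : I := [ffun k : 'I_n.-2 => trit_at nu (k.+1 - o)].

Lemma shifted_point o r (nu : trits r) v : (o + r <= m)%N ->
  shifted o nu (point v) = point (v + path_shift o nu).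
Proof.
move=> orm; apply/funext => i; rewrite /shifted /point -addrA -intrD; congr (_ + _%:~R).
case: i => [|i] /=; first by rewrite ?sub0n ?addr0.
case: insubP => [k _ <-|im]; first by rewrite !ffunE.
by rewrite trit_at_out //; lia.
Qed.

Lemma Enu_translate o r (nu : trits r) (f : L) :
  Enu (raise o (@shiftop _ _)) nu f = translate (path_shift o nu) f.
Proof.
have E (s : seq nat) : (\prod_(i <- s) raise o (@shiftop K m) i (trit_at nu i)) f =
   ratfun_translate (fun k => \sum_(i <- s) if k.+1 == (o + i)%N then (trit_at nu i)%:~R else 0) f.
  elim: s => [|i s IH].
    by rewrite big_nil ratfun_translate0 // => k; rewrite big_nil.
  rewrite big_cons -[LHS]/(raise o (@shiftop K m) i (trit_at nu i)
    ((\prod_(j <- s) raise o (@shiftop K m) j (trit_at nu j)) f)) IH.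
  apply: etrans (ratfun_translate_comp _ _ _) _.
  apply: (congr1 (fun c => ratfun_translate c f)).
  by apply/funext => k; rewrite big_cons.
rewrite /Enu E /translate; apply: (congr1 (fun c => ratfun_translate c f)).
apply/funext => k; rewrite ffunE.
have [ko|ok] := leqP k.+1 o.
  rewrite (eqP ko) big1_seq // => i /andP[_]; rewrite mem_index_iota => /andP[i1 _].
  by case: eqP => //; lia.
have [kr|rk] := leqP (k.+1 - o) r; last first.
  rewrite trit_at_out // big1_seq // => i /andP[_]; rewrite mem_index_iota => /andP[i1 i2].
  by case: eqP => //; lia.
rewrite (bigD1_seq (k.+1 - o)%N) ?iota_uniq ?mem_index_iota //=; last by lia.
rewrite subnKC ?eqxx; last by lia.
by rewrite big1 ?addr0 // => i ik; case: eqP => // kE; case/eqP: ik; lia.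
Qed.
End LatticeAction.

(** * Operators realizing difference operators *)

Section Realization.
Variables (K L : fieldType) (io : {rmorphism K -> L}) (W : lmodType L).
Variables (I : eqType) (F : I -> W) (i0 : I).
Hypothesis F_neq0 : forall i, F i != 0.
Hypothesis separated : forall i i', i != i' -> exists X : rop W, exists c : I -> L,
  (forall k, X (F k) = c k *: F k) /\ c i != c i'.
Variables (D : algType K) (act : D -> L -> L) (T : I -> L -> L).
Hypothesis act_lin : forall k d d' f, act (k *: d + d') f = io k * act d f + act d' f.
Hypothesis actM : forall d d' f, act (d * d') f = act d (act d' f).
Hypothesis act1 : forall f, act 1 f = f.
Hypothesis act_inj : forall d d', (forall f, act d f = act d' f) -> d = d'.
Hypothesis T0 : forall f, T i0 f = f.
Hypothesis T_lin : forall i k f g, T i (io k * f + g) = io k * T i f + T i g.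
Local Notation A := (scalar_rop io (F_neq0 i0)).

(** X combines the vectors F k with the same coefficients as those by which d
    combines the values of a function at the points k. *)
Definition realizes (X : A) (d : D) : Prop := forall i, exists s : seq (L * I),
  (X : rop W) (F i) = \sum_(p <- s) p.1 *: F p.2 /\
  forall f, T i (act d f) = \sum_(p <- s) p.1 * T p.2 f.

(** Coefficients with respect to the F k determine the values of d f, because
    relations between the F k transfer to the values of f. *)
Lemma realizes_unique X d d' : realizes X d -> realizes X d' -> d = d'.
Proof.
move=> r r'; apply: act_inj => f; rewrite -[LHS]T0 -[RHS]T0.
have [s [Xs ds]] := r i0; have [s' [Xs' ds']] := r' i0.
apply/eqP; rewrite -subr_eq0 ds ds'; apply/eqP.
have E (V : lmodType L) (H : I -> V) : \sum_(p <- s ++ [seq (- p.1, p.2) | p <- s']) p.1 *: H p.2 =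
    \sum_(p <- s) p.1 *: H p.2 - \sum_(p <- s') p.1 *: H p.2.
  rewrite big_cat big_map -sumrN; congr (_ + _).
  by apply: eq_bigr => p _; rewrite scaleNr.
have := @transfer_zero _ _ _ F separated F_neq0 L^o (fun i => T i f)
  (s ++ [seq (- p.1, p.2) | p <- s']).
rewrite (E W F) (E L^o (fun i => T i f)) -Xs -Xs' subrr => H; exact: (H erefl).
Qed.

Lemma realizes_lin k X X' d d' : realizes X d -> realizes X' d' ->
  realizes (k *: X + X') (k *: d + d').
Proof.
move=> r r' i; have [s [Xs ds]] := r i; have [s' [Xs' ds']] := r' i.
exists ([seq (io k * p.1, p.2) | p <- s] ++ s'); split.
  rewrite big_cat big_map -[LHS]/(io k *: (X : rop W) (F i) + (X' : rop W) (F i)) Xs Xs'.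
  by rewrite scaler_sumr; congr (_ + _); apply: eq_bigr => p _; rewrite scalerA.
move=> f; rewrite act_lin T_lin ds ds' big_cat big_map mulr_sumr; congr (_ + _).
by apply: eq_bigr => p _; rewrite mulrA.
Qed.

Lemma realizes_one : realizes 1 1.
Proof.
move=> i; exists [:: (1, i)]; split; first by rewrite big_seq1 scale1r.
by move=> f; rewrite big_seq1 act1 mul1r.
Qed.

(** X comes first in X * X' and d last in d * d', so that in both products the
    coefficients of the left factor multiply from outside. *)
Lemma realizes_mul X X' d d' : realizes X d -> realizes X' d' ->
  realizes (X * X') (d * d').
Proof.
move=> r r' i; have [s [Xs ds]] := r i.
have [S HS] := choice r'.
exists [seq (p.1 * q.1, q.2) | p <- s, q <- S p.2]; split.
  rewrite big_allpairs_dep -[LHS]/((X' : rop W) ((X : rop W) (F i))) Xs rop_sumr.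
  apply: eq_bigr => p _; rewrite ropZ (HS p.2).1 scaler_sumr.
  by apply: eq_bigr => q _; rewrite scalerA.
move=> f; rewrite actM ds big_allpairs_dep; apply: eq_bigr => p _.
by rewrite (HS p.2).2 mulr_sumr; apply: eq_bigr => q _; rewrite mulrA.
Qed.

End Realization.

(** * Casimirs of intervals generate *)
Section IntervalGeneration.
Variables (K : fieldType) (A : algType K) (n : nat) (J : 'I_n -> su11_index -> A).

Implicit Types (S : {set 'I_n}) (x y : A).

Definition block_casimir S : A := triple_casimir (block_total J S).

Definition interval_gens (c : A) : Prop := exists i j : nat,
  [/\ (1 <= i <= j)%N, (j <= n)%N & c = block_casimir (segment n i j)].

Local Notation gen := (generated interval_gens).

Lemma gen_lin2 (k l : K) x y : gen x -> gen y -> gen (k *: x + l *: y).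
Proof.
move=> gx gy; apply: generated_lin => //.
have g0 : gen 0.
  have -> : 0 = (-1) *: 1 + 1 :> A by rewrite scaleN1r addNr.
  by apply: generated_lin; apply: generated_one.
by rewrite -[_ *: y]addr0; apply: generated_lin.
Qed.

Lemma gen_add x y : gen x -> gen y -> gen (x + y).
Proof. by move=> gx gy; have := gen_lin2 1 1 gx gy; rewrite !scale1r. Qed.
Lemma gen_sub x y : gen x -> gen y -> gen (x - y).
Proof. by move=> gx gy; have := gen_lin2 1 (-1) gx gy; rewrite scale1r scaleN1r. Qed.

Definition cross (S S' : {set 'I_n}) : A :=
  let j := block_total J S in let j' := block_total J S' in
  j Jzero * j' Jzero + j' Jzero * j Jzero - j Jplus * j' Jminus - j' Jplus * j Jminus.

Lemma block_totalU S S' s : [disjoint S & S'] ->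
  block_total J (S :|: S') s = block_total J S s + block_total J S' s.
Proof. by move=> d; rewrite /block_total -bigU /=; first by apply: eq_bigl => a; rewrite !inE. Qed.

Lemma block_casimirU S S' : [disjoint S & S'] ->
  block_casimir (S :|: S') = block_casimir S + block_casimir S' + cross S S'.
Proof.
move=> d; rewrite /block_casimir -triple_casimirD; congr triple_casimir.
by apply/funext => s; apply: block_totalU.
Qed.

Lemma crossC S S' : cross S S' = cross S' S.
Proof. by rewrite /cross; zlinear A. Qed.

Lemma crossUr S S1 S2 : [disjoint S1 & S2] ->
  cross S (S1 :|: S2) = cross S S1 + cross S S2.
Proof. by move=> d; rewrite /cross !block_totalU // !mulrDl !mulrDr; zlinear A. Qed.

Lemma cross0 S : cross S set0 = 0.
Proof.
by rewrite /cross /block_total !big_set0 !mulr0 !mul0r !subr0 addr0.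
Qed.

Lemma gen_segment i j : (1 <= i)%N -> (j <= n)%N -> gen (block_casimir (segment n i j)).
Proof.
move=> i1 jn; have [ij|ji] := leqP i j.
  by apply: generated_gen; exists i, j; rewrite i1 ij.
have -> : segment n i j = set0 by apply/setP => a; rewrite !inE; lia.
rewrite /block_casimir /triple_casimir /block_total !big_set0 !mul0r !subr0.
by rewrite -(subrr 1); apply: gen_sub; apply: generated_one.
Qed.

Lemma segment1 (a : 'I_n) : segment n a.+1 a.+1 = [set a].
Proof. by apply/setP => c; rewrite !inE -val_eqE /=; lia. Qed.

Lemma gen_cross_segment (a : 'I_n) j : (a < j <= n)%N ->
  gen (cross [set a] (segment n a.+2 j)).
Proof.
move=> aj; have d : [disjoint [set a] & segment n a.+2 j].
  by rewrite disjoints1 inE; lia.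
have := block_casimirU d.
have -> : [set a] :|: segment n a.+2 j = segment n a.+1 j.
  by apply/setP => c; rewrite !inE -val_eqE /=; lia.
move=> e; have -> : cross [set a] (segment n a.+2 j) =
    block_casimir (segment n a.+1 j) - block_casimir [set a] - block_casimir (segment n a.+2 j).
  by rewrite e; zlinear A.
by rewrite -segment1; apply: gen_sub; [apply: gen_sub|]; apply: gen_segment => //; lia.
Qed.

(** The cross term of a single factor and the interval after it comes from
    Casimirs of intervals; its increments as the interval grows are the cross
    terms of pairs. *)
Lemma gen_cross_pair (a c : 'I_n) : a != c -> gen (cross [set a] [set c]).
Proof.
wlog ac : a c / (a < c)%N => [W ac|_].
  have [h|h|h] := ltngtP a c; first exact: W.
    by rewrite crossC; apply: W => //; rewrite eq_sym.
  by case/eqP: ac; apply: val_inj.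
have cn := ltn_ord c.
have d : [disjoint segment n a.+2 c & [set c]].
  by rewrite disjoint_sym disjoints1 inE; lia.
have e := crossUr [set a] d.
have E : segment n a.+2 c :|: [set c] = segment n a.+2 c.+1.
  by apply/setP => k; rewrite !inE -val_eqE /=; lia.
rewrite E in e.
have -> : cross [set a] [set c] =
    cross [set a] (segment n a.+2 c.+1) - cross [set a] (segment n a.+2 c).
  by rewrite e; zlinear A.
by apply: gen_sub; apply: gen_cross_segment; lia.
Qed.

Lemma gen_cross (a : 'I_n) (S : {set 'I_n}) : a \notin S -> gen (cross [set a] S).
Proof.
have [k] := ubnP #|S|; elim: k S => // k IH S Sk aS.
have [->|[c cS]] := set_0Vmem S.
  by rewrite cross0 -(subrr 1); apply: gen_sub; apply: generated_one.
rewrite -(setD1K cS) crossUr; last by rewrite disjoints1 !inE eqxx.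
apply: gen_add; first by apply: gen_cross_pair; apply: contraNneq aS => ->.
apply: IH; last by rewrite !inE negb_and aS orbT.
by move: Sk; rewrite (cardsD1 c S) cS; lia.
Qed.

Lemma gen_block_casimir (S : {set 'I_n}) : gen (block_casimir S).
Proof.
have [k] := ubnP #|S|; elim: k S => // k IH S Sk.
have [->|[c cS]] := set_0Vmem S.
  have -> : set0 = segment n 1 0 by apply/setP => a; rewrite !inE; lia.
  exact: gen_segment.
rewrite -(setD1K cS) block_casimirU; last by rewrite disjoints1 !inE eqxx.
apply: gen_add; last by apply: gen_cross; rewrite !inE eqxx.
apply: gen_add; first by rewrite -segment1; apply: gen_segment => //; apply: ltn_ord.
by apply: IH; move: Sk; rewrite (cardsD1 c S) cS; lia.
Qed.
End IntervalGeneration.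

(** * The difference operators at the points of the lattice *)

Section WeightOperators.
Variables (L : fieldType) (x b : nat -> L).

(** Gcoef over an arbitrary field; a path ends with a shift 0. *)
Definition pathweight r (nu : trits r) : L :=
  2%:R ^+ num_zeros nu *
    (\prod_(0 <= i < r.+1)
       Bcoef (trit_at nu i) (trit_at nu i.+1) (x i) (b i) (x i.+1) (b i.+1)) /
    (\prod_(1 <= i < r.+1) bcoef (trit_at nu i) (x i) (b i)).

Lemma pathweightE r (nu : trits r) :
  pathweight nu = pathcoef x b nu * Bcoef (trit_at nu r) 0 (x r) (b r) (x r.+1) (b r.+1).
Proof.
rewrite /pathweight /pathcoef (@big_nat_recr _ _ _ r 0) // [trit_at nu r.+1]trit_at_out //.
have E (a p q c : L) : a * (p * c) / q = a * p / q * c by ring.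
exact: E.
Qed.

Lemma pathweight_sum (L0 : char0 L) r :
  (forall i, (i < r)%N -> ~ isint (2%:R * x i.+1 + b i.+1)) ->
  \sum_(nu : trits r) pathweight nu = kappa (x 0) (b 0) + kappa (x r.+1) (b r.+1)
    - kappa 0 (b r.+1 - b 0%N - 1).
Proof.
move=> gx; rewrite -(kappa_identity L0) addrK -(path_sum L0 tzero gx).
by apply: eq_bigr => nu _; rewrite pathweightE.
Qed.
End WeightOperators.

Lemma rmorph_pathweight (L : fieldType) (f : {rmorphism L -> L}) (x b : nat -> L) r (nu : trits r) :
  f (pathweight x b nu) = pathweight (f \o x) (f \o b) nu.
Proof.
have fr s z c : f (reflect_var s z c) = reflect_var s (f z) (f c).
  by rewrite /reflect_var; case: eqP; rewrite ?rmorphB ?rmorphN.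
have fB s t z c z' c' : f (Bcoef s t z c z' c') = Bcoef s t (f z) (f c) (f z') (f c').
  rewrite /Bcoef -!fr; move: (reflect_var s z c) (reflect_var t z' c') => u u'.
  by case: (s != 0); case: (t != 0) => /=;
    rewrite !(rmorph_nat, rmorphM, rmorphD, rmorphN, fmorphV, rmorph1).
have fb s z c : f (bcoef s z c) = bcoef s (f z) (f c).
  rewrite /bcoef -!fr; move: (reflect_var s z c) => u.
  by case: (s != 0) => /=; rewrite !(rmorph_nat, rmorphM, rmorphD, rmorphN, rmorph1).
rewrite /pathweight fmorph_div rmorphM; congr (_ * _ / _).
- by rewrite rmorphXn rmorph_nat.
- by rewrite rmorph_prod; apply: eq_bigr => i _; rewrite fB.
- by rewrite rmorph_prod; apply: eq_bigr => i _; rewrite fb.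
Qed.

Lemma rmorph_kappa (L : fieldType) (f : {rmorphism L -> L}) x c : f (kappa x c) = kappa (f x) (f c).
Proof. by rewrite /kappa !(rmorph_nat, rmorphM, rmorphD, rmorphN, fmorphV, rmorph1). Qed.

Lemma rmorph_kappa0 (L : fieldType) (f : {rmorphism L -> L}) b c :
  f (kappa 0 (b - c - 1)) = kappa 0 (f b - f c - 1).
Proof. by rewrite rmorph_kappa rmorph0 !rmorphB rmorph1. Qed.

Lemma rmorph_difference_operator (L : fieldType) (f : {rmorphism L -> L}) (J : finType) (P : pred J)
    (g h : J -> L) (x c : L) :
  f (- (\sum_(i | P i) g i * (h i - x)) + c * x) =
  - (\sum_(i | P i) f (g i) * (f (h i) - f x)) + f c * f x.
Proof.
rewrite rmorphD rmorphN rmorphM rmorph_sum; congr (- _ + _).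
by apply: eq_bigr => i _; rewrite rmorphM rmorphB.
Qed.

(** Trades the differences E_nu - 1 for the E_nu, at the cost of the sum of all
    coefficients, which is what the constant c is there to compensate. *)
Lemma difference_operator_total (L : fieldType) (J : finType) (P : pred J)
    (g h : J -> L) (x c k : L) :
  (forall i, ~~ P i -> h i = x) -> \sum_i g i = k - c ->
  - (\sum_(i | P i) g i * (h i - x)) + c * x = k * x - \sum_i g i * h i.
Proof.
move=> hx gs; rewrite big_mkcond (eq_bigr (fun i => g i * h i - g i * x)) => [|i _].
  by rewrite sumrB -mulr_suml gs; ring.
by case: ifPn => [_|/hx ->]; rewrite ?subrr // mulrBr.
Qed.

Section HatC.
Variables (R : realType) (n : nat) (beta : nat -> R) (N : nat).
Hypothesis n_ge2 : (2 <= n)%N.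
Local Notation m := n.-2.
Local Notation K := (R[i]).
Local Notation L := (ratfun R[i] n.-2).
Local Notation I := ({ffun 'I_n.-2 -> int}).
Local Notation xv := (xvar R n N).
Local Notation bp := (bpar n beta).
Local Notation pt := (@point R n N).

Lemma translate_kappa (v : I) i :
  translate v (kappa (xv i) (bp i)) = kappa (pt v i) (bp i).
Proof.
transitivity (kappa (translate v (xv i)) (translate v (bp i))).
  exact: (rmorph_kappa (translate v)).
by rewrite translate_var translate_par.
Qed.

Lemma translate_hatC_initial (v : I) q (f : L) : (1 <= q)%N ->
  translate v (hatC n beta N 1 q f) = kappa (pt v q.-1) (bp q.-1) * translate v f.
Proof.
move=> q1.
rewrite -translate_kappa; exact: (rmorphM (translate v) (kappa (xv q.-1) (bp q.-1)) f).
Qed.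

Lemma linop_sum (J : finType) (P : pred J) (d : J -> linop L) (f : L) :
  (\sum_(i | P i) d i) f = \sum_(i | P i) d i f.
Proof. by apply: (big_morph (fun d : linop L => d f)). Qed.

Lemma path_shift0 o r (nu : trits r) :
  ~~ [exists i, trit_val (nu i) != 0] -> path_shift n o nu = 0.
Proof.
move=> /existsPn nu0; apply/ffunP => k; rewrite !ffunE.
case: (k.+1 - o)%N => // j; rewrite /trit_at; case: insubP => // i _ _.
by apply/eqP; have := nu0 i; rewrite negbK.
Qed.

Lemma translate_hatC_inner (v : I) o r (f : L) : (o + r <= m)%N ->
  translate v (hatC n beta N o.+2 (o + r).+2 f) =
  (kappa (pt v o) (bp o) + kappa (pt v (o + r).+1) (bp (o + r).+1)) * translate v f
  - \sum_(nu : trits r) pathweight (raise o (pt v)) (raise o bp) nu *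
      translate (v + path_shift n o nu) f.
Proof.
move=> orm.
pose c : L := kappa 0 (bp (o + r).+1 - bp o - 1).
have E : hatC n beta N o.+2 (o + r).+2 f =
    - (\sum_(nu : trits r | [exists i, trit_val (nu i) != 0])
        pathweight (raise o xv) (raise o bp) nu * (translate (path_shift n o nu) f - f)) + c * f.
  rewrite /hatC /hatC_of /= !subSS subn0 addKn addn1 /hatC_from2 /=.
  rewrite -[LHS]/(- (racah_op (raise o xv) (raise o bp) (raise o (@shiftop _ _)) r f)
     + kappa 0 (raise o bp r.+1 - raise o bp 0%N - 1) * f).
  rewrite /raise addnS addn0 -/c /racah_op linop_sum; congr (- _ + _).
  apply: eq_bigr => nu _.
  rewrite -[LHS]/(Gcoef (raise o xv) (raise o bp) nu *
    (Enu (raise o (@shiftop _ _)) nu f - f)).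
  by rewrite Enu_translate.
have TG (nu : trits r) : translate v (pathweight (raise o xv) (raise o bp) nu) =
    pathweight (raise o (pt v)) (raise o bp) nu.
  apply: etrans (rmorph_pathweight (translate v) _ _ _) _; congr (pathweight _ _ nu).
    by apply/funext => i; apply: translate_var.
  by apply/funext => i; apply: translate_par.
have Tc : translate v c = c.
  transitivity (kappa 0 (translate v (bp (o + r).+1) - translate v (bp o) - 1) : L).
    exact: (rmorph_kappa0 (translate v)).
  by rewrite !translate_par.
transitivity (- (\sum_(nu : trits r | [exists i, trit_val (nu i) != 0])
        translate v (pathweight (raise o xv) (raise o bp) nu) *
        (translate v (translate (path_shift n o nu) f) - translate v f))
     + translate v c * translate v f).
  by rewrite E; apply: (rmorph_difference_operator (translate v)).
rewrite Tc (eq_bigr (fun nu => pathweight (raise o (pt v)) (raise o bp) nu *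
  (translate (v + path_shift n o nu) f - translate v f))) => [|nu _]; last first.
  by rewrite TG translate_add.
apply: difference_operator_total => [nu /path_shift0 ->|]; first by rewrite addr0.
have := @pathweight_sum _ (raise o (pt v)) (raise o bp) (L_char0 R n) r.
rewrite /raise addn0 addnS; apply=> i ir.
have [[_ g] _] := point_generic beta N n_ge2 v.
have oim : (o + i < m)%N by lia.
by have [h _] := g _ oim; rewrite addnS.
Qed.
End HatC.

(** * The correspondence between Casimirs and difference operators *)

(** Two points with equal values are exchanged by the symmetry x -> - x - b of
    kappa, which is impossible when 2 x + b is not an integer. *)
Lemma kappa_separates (L : fieldType) (L0 : char0 L) (x b : L) (z z' : int) :
  ~ isint (2%:R * x + b) -> z != z' -> kappa (x + z%:~R) b != kappa (x + z'%:~R) b.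
Proof.
move=> h zz; rewrite -subr_eq0.
have -> : kappa (x + z%:~R) b - kappa (x + z'%:~R) b =
    (z - z')%:~R * (2%:R * x + b + (z + z')%:~R).
  by rewrite /kappa intrB intrD; field; apply: L0.
rewrite mulf_neq0 ?(not_isint_neq0 _ h) //; apply: contraNneq zz => e.
by rewrite -subr_eq0; apply/eqP/(intr_inj0 L0).
Qed.

Section Homomorphism.
Variables (R : realType) (n : nat) (beta : nat -> R) (N : nat).
Hypothesis n_ge2 : (2 <= n)%N.
Local Notation m := n.-2.
Local Notation K := (R[i]).
Local Notation L := (ratfun R[i] n.-2).
Local Notation I := ({ffun 'I_n.-2 -> int}).
Local Notation bp := (bpar n beta).
Local Notation pt := (@point R n N).
Local Notation tens := (tensor_power (@su11_br K) n).

Lemma joinable_point v : joinable bp m (pt v).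
Proof. exact: point_generic. Qed.

Variables (W : lmodType L) (J : nat -> su11_index -> rop W) (F : (nat -> L) -> W).
Hypothesis J_comm : commuting_triples n J.
Hypothesis F_neq0 : forall x, joinable bp m x -> F x != 0.
Hypothesis F_initial : forall x q, joinable bp m x -> (q <= m.+1)%N ->
  triple_casimir (range_total J 0 q.+1) (F x) = kappa (x q) (bp q) *: F x.
Hypothesis F_inner : forall x o r, joinable bp m x -> (o + r <= m)%N ->
  triple_casimir (range_total J o.+1 (o + r).+2) (F x) =
  (kappa (x o) (bp o) + kappa (x (o + r).+1) (bp (o + r).+1)) *: F x
  - gsum bp o r F tzero x.

Definition vec (v : I) : W := F (pt v).

Lemma vec_neq0 v : vec v != 0.
Proof. exact/F_neq0/joinable_point. Qed.

(** Points that differ in x_(k+1) are told apart by the Casimir of the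
    first k + 2 factors. *)
Lemma vec_separated (v w : I) : v != w -> exists X : rop W, exists c : I -> L,
  (forall u, X (vec u) = c u *: vec u) /\ c v != c w.
Proof.
move=> vw; have /existsP[k vk] : [exists k, v k != w k].
  by apply: contraNT vw => /existsPn vw; apply/eqP/ffunP => k; apply/eqP; rewrite -[_ == _]negbK vw.
exists (triple_casimir (range_total J 0 k.+2)), (fun u => kappa (pt u k.+1) (bp k.+1)); split.
  by move=> u; apply: F_initial; [apply: joinable_point | have := ltn_ord k; lia].
have C u : lattice_coord u k.+1 = u k by rewrite -[LHS]/(if insub (val k) is Some k' then u k' else 0) valK.
have E u : pt u k.+1 = xvar R n N k.+1 + (u k)%:~R.
  exact: (congr1 (fun z : int => xvar R n N k.+1 + z%:~R : L) (C u)).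
rewrite !E; apply: kappa_separates vk; first exact: L_char0.
have [[_ g] _] := point_generic beta N n_ge2 0.
have [h _] := g k (ltn_ord k); move: h; rewrite E ffunE addr0; exact.
Qed.

Local Notation io := (in_alg L : {rmorphism K -> L}).
Local Notation A := (scalar_rop io (vec_neq0 0)).
Local Notation JA := (J : nat -> su11_index -> A).

Let J_commA : @commuting_triples A n JA := J_comm.

Definition tmap : tens -> A := tensor_map JA.

Definition corresponds (c : tens) (d : linop L) : Prop :=
  @realizes K L io W I vec 0 vec_neq0 (linop L)
    (fun d f => d f) (@translate R n) (tmap c) d.

Lemma corresponds_unique c d d' : corresponds c d -> corresponds c d' -> d = d'.
Proof.
apply: realizes_unique; first exact: vec_separated.
- by move=> e e' ee; apply: linopP.
- exact: translate0.
Qed.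

Lemma corresponds_lin k c c' d d' : corresponds c d -> corresponds c' d' ->
  corresponds (k *: c + c') (k *: d + d').
Proof.
move=> r r'; rewrite /corresponds /tmap (tensor_mapD J_commA) (tensor_mapZ J_commA).
apply: realizes_lin r r'.
- by move=> l e e' f; rewrite -[LHS]/(l *: e f + e' f) ratfun_scaleE.
- move=> i l f g; have E h : io l * h = l *: h by rewrite ratfun_scaleE.
  rewrite !E -translateZ; exact: (rmorphD (translate i)).
Qed.

Lemma corresponds_one : corresponds 1 1.
Proof. by rewrite /corresponds /tmap (tensor_map1 J_commA); apply: realizes_one. Qed.

Lemma corresponds_mul c c' d d' : corresponds c d -> corresponds c' d' ->
  corresponds (c * c') (d * d').
Proof.
move=> r r'; rewrite /corresponds /tmap (tensor_mapM J_commA).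
exact: realizes_mul r r'.
Qed.

Lemma corresponds_segment i j : (1 <= i <= j)%N -> (j <= n)%N ->
  corresponds (casimir K (segment n i j)) (hatC n beta N i j).
Proof.
move=> /andP[i1 ij] jn v; rewrite /tmap (tensor_map_casimir J_commA) (block_total_segment _ i1 jn).
case: i i1 ij => [//|[|o]] _ ij.
  exists [:: (kappa (pt v j.-1) (bp j.-1), v)]; split.
    rewrite big_seq1 /= -(F_initial (joinable_point v)); last by lia.
    by case: j ij jn.
  by move=> f; rewrite big_seq1 /= translate_hatC_initial.
have [r jE] : exists r, j = (o + r).+2 by exists (j - o.+2)%N; lia.
have orm : (o + r <= m)%N by lia.
(* The combination has a term for v itself and one for each nu, also for nu = 0. *)
exists ((kappa (pt v o) (bp o) + kappa (pt v (o + r).+1) (bp (o + r).+1), v) ::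
  [seq (- pathweight (raise o (pt v)) (raise o bp) nu, v + path_shift n o nu) |
     nu <- index_enum (trits r)]); split.
  rewrite big_cons big_map jE -[LHS]/(triple_casimir (range_total J o.+1 (o + r).+2) (F (pt v))).
  rewrite (F_inner (joinable_point v) orm) /gsum -sumrN; congr (_ + _).
  apply: eq_bigr => nu _; rewrite -scaleNr /vec -shifted_point //.
  rewrite pathweightE /raise addnS; congr (- _ *: F _).
  apply/funext => k; rewrite shifted_ext; case: eqP => // ->.
  by rewrite shifted_out ?addr0.
move=> f; rewrite big_cons big_map jE (translate_hatC_inner beta N n_ge2 v f orm) -sumrN.
congr (_ + _); apply: eq_bigr => nu _; exact/esym/mulNr.
Qed.
End Homomorphism.

(** * The morphism *)

(** A relation between two algebras that is functional and compatible with the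
    operations maps a generated subalgebra to another as soon as generators have
    partners. *)
Section GeneratedCorrespondence.
Variables (K : fieldType) (A B : algType K) (S : A -> Prop) (T : B -> Prop).
Variable rel : A -> B -> Prop.
Hypothesis rel_one : rel 1 1.
Hypothesis rel_lin : forall k a a' b b', rel a b -> rel a' b' ->
  rel (k *: a + a') (k *: b + b').
Hypothesis rel_mul : forall a a' b b', rel a b -> rel a' b' -> rel (a * a') (b * b').

Lemma generated_correspond :
  (forall a, S a -> exists2 b, generated T b & rel a b) ->
  forall a, generated S a -> exists2 b, generated T b & rel a b.
Proof.
move=> ST a; elim=> {a} [a /ST //||k a a' _ [b gb ab] _ [b' gb' ab']|a a' _ [b gb ab] _ [b' gb' ab']].
- by exists 1 => //; apply: generated_one.
- by exists (k *: b + b'); [apply: generated_lin | apply: rel_lin].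
- by exists (b * b'); [apply: generated_mul | apply: rel_mul].
Qed.

Hypothesis rel_unique : forall a b b', rel a b -> rel a b' -> b = b'.
Hypothesis relS : forall a, S a -> exists2 b, generated T b & rel a b.

Lemma generated_image (a : gen_alg S) : exists b : gen_alg T, rel (gen_alg_val a) (gen_alg_val b).
Proof.
case: a => a /= /asboolP /(generated_correspond relS)[b gb ab].
by exists (GenAlg (introT (generatedP T b) gb)).
Qed.

Definition gen_alg_map (a : gen_alg S) : gen_alg T := projT1 (cid (generated_image a)).

Lemma gen_alg_map_rel a : rel (gen_alg_val a) (gen_alg_val (gen_alg_map a)).
Proof. exact: projT2 (cid (generated_image a)). Qed.

Lemma gen_alg_map_eq a b : rel (gen_alg_val a) (gen_alg_val b) -> gen_alg_map a = b.
Proof. by move=> ab; apply: val_inj; apply: rel_unique ab; apply: gen_alg_map_rel. Qed.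

Fact gen_alg_map_linear : linear gen_alg_map.
Proof.
move=> k a a'; apply: gen_alg_map_eq.
rewrite -[gen_alg_val (k *: a + a')]/(k *: gen_alg_val a + gen_alg_val a').
exact: rel_lin (gen_alg_map_rel a) (gen_alg_map_rel a').
Qed.

Fact gen_alg_map_monoid : monoid_morphism gen_alg_map.
Proof.
split; first exact/gen_alg_map_eq/rel_one.
by move=> a a'; apply: gen_alg_map_eq; apply: rel_mul (gen_alg_map_rel a) (gen_alg_map_rel a').
Qed.

HB.instance Definition _ :=
  GRing.isLinear.Build K (gen_alg S) (gen_alg T) _ gen_alg_map gen_alg_map_linear.
HB.instance Definition _ :=
  GRing.isMonoidMorphism.Build (gen_alg S) (gen_alg T) gen_alg_map gen_alg_map_monoid.

Lemma gen_alg_morphism : exists phi : {lrmorphism gen_alg S -> gen_alg T},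
  forall a, rel (gen_alg_val a) (gen_alg_val (phi a)).
Proof. by exists gen_alg_map; apply: gen_alg_map_rel. Qed.
End GeneratedCorrespondence.

Lemma casimir_block (K : fieldType) (n : nat) (S : {set 'I_n}) :
  casimir K S = block_casimir (fun a s => in_factor (env_in (@su11_br K) (basis_vector K s)) a) S.
Proof. by rewrite /casimir expr2. Qed.

Lemma casimir_generated (K : fieldType) n (S : {set 'I_n}) :
  generated (fun c => exists i j, [/\ (1 <= i <= j)%N, (j <= n)%N & c = casimir K (segment n i j)])
    (casimir K S).
Proof.
rewrite casimir_block.
elim: (gen_block_casimir (fun a s => in_factor (env_in (@su11_br K) (basis_vector K s)) a) S)
  => [c [i [j [ij jn ->]]]||k c d _ gc _ gd|c d _ gc _ gd].
- by apply: generated_gen; exists i, j; split=> //; rewrite casimir_block.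
- exact: generated_one.
- exact: generated_lin.
- exact: generated_mul.
Qed.

Unset Implicit Arguments.
Set Strict Implicit.
Set Printing Implicit Defensive.

Theorem theorem3p1 (R : realType) (n : nat) (n_ge2 : (2 <= n)%N)
    (beta : nat -> R) (N : nat) :
  exists phi : {lrmorphism racah R[i] n -> discrete_racah n beta N},
    (forall (i j : nat) (c : racah R[i] n),
        (1 <= i <= j)%N -> (j <= n)%N -> gen_alg_val c = casimir R[i] (segment n i j) ->
        gen_alg_val (phi c) = hatC n beta N i j)
    /\ (forall d : discrete_racah n beta N, exists c, phi c = d).
Proof.
have [W [J [F [J_comm F_neq0 F_initial F_inner]]]] :=
  coupled_vectors (bpar n beta) (L_char0 R n) n.-2.
have nE : n.-2.+2 = n by lia.
rewrite nE in J_comm.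
pose rel := @corresponds R n beta N n_ge2 W J F F_neq0.
have rel_one : rel 1 1 by apply: corresponds_one.
have rel_lin k a a' b b' : rel a b -> rel a' b' -> rel (k *: a + a') (k *: b + b').
  exact: corresponds_lin.
have rel_mul a a' b b' : rel a b -> rel a' b' -> rel (a * a') (b * b').
  exact: corresponds_mul.
have rel_segment i j : (1 <= i <= j)%N -> (j <= n)%N ->
    rel (casimir R[i] (segment n i j)) (hatC n beta N i j).
  exact: corresponds_segment.
have rel_unique a b b' : rel a b -> rel a b' -> b = b'.
  exact: corresponds_unique.
have rel_gens a : racah_gens a -> exists2 b, generated (hatC_gens beta N) b & rel a b.
  case=> S _ ->.
  apply: (@generated_correspond _ _ _ _ _ rel rel_one rel_lin rel_mul _ _ (casimir_generated _ S)).
  move=> _ [i [j [ij jn ->]]]; exists (hatC n beta N i j); last exact: rel_segment.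
  by apply: generated_gen; exists i, j.
have gens_rel b : hatC_gens beta N b -> exists2 a, generated (@racah_gens R[i] n) a & rel a b.
  case=> i [j [ij [jn ->]]]; exists (casimir R[i] (segment n i j)); last exact: rel_segment.
  apply: generated_gen; exists (segment n i j) => //; apply/set0Pn.
  have jn' : (j.-1 < n)%N by lia.
  by exists (Ordinal jn'); rewrite inE /=; lia.
have [phi phi_rel] := gen_alg_morphism rel_one rel_lin rel_mul rel_unique rel_gens.
exists phi; split=> [i j c ij jn cE|[d gd]].
  have := phi_rel c; rewrite cE => h; exact: (rel_unique _ _ _ h (rel_segment i j ij jn)).
have [c gc cd] := @generated_correspond _ _ _ _ _ (fun b a => rel a b) rel_one
  (fun k a a' b b' => @rel_lin k b b' a a') (fun a a' b b' => @rel_mul b b' a a')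
  gens_rel _ (elimT (generatedP _ d) gd).
pose c' : racah R[i] n := GenAlg (introT (generatedP _ c) gc).
exists c'; apply: val_inj; exact: (rel_unique _ _ _ (phi_rel c') cd).
Qed.
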